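(* Assume in addition $\mathbb E Y_0^3<\infty$ and $\mathbb E\varepsilon_1^3<\infty$. Then $\sqrt n(\tilde\alpha_n-\alpha)\to\mathcal N(0,\sigma_{\alpha,\varepsilon}^2)$ in distribution as $n\to\infty$. Moreover, conditionally on the value $Y_{s-1}$, $$\sqrt n\big(\tilde\theta_n-(Y_s-\alpha Y_{s-1}-\mu_\varepsilon)\big)\to\mathcal N(0,Y_{s-1}^2\sigma_{\alpha,\varepsilon}^2)$$ in distribution as $n\to\infty$.
   Context: Let $\alpha\in(0,1)$. Let $(\varepsilon_k)_{k\in\mathbb N}$ be i.i.d. non-negative integer-valued random variables with $\mathbb E\varepsilon_1^2<\infty$ and $\mathbb P(\varepsilon_1\ne 0)>0$; write $\mu_\varepsilon=\mathbb E\varepsilon_1$ (assumed known), $\sigma_\varepsilon^2=\operatorname{Var}\varepsilon_1$. For each $k\in\mathbb N$ let $(\xi_{k,j})_{j\in\mathbb N}$ be i.i.d. Bernoulli random variables with mean $\alpha$, these sequences being mutually independent and independent of $(\varepsilon_k)$. The INAR(1) Markov chain $X_k=\sum_{j=1}^{X_{k-1}}\xi_{k,j}+\varepsilon_k$ (with any independent initial value) has a unique stationary distribution; $\tilde X$ denotes a random variable with it, and $\sigma_{\alpha,\varepsilon}^2=\frac{\alpha(1-\alpha)\mathbb E\tilde X^3+\sigma_\varepsilon^2\mathbb E\tilde X^2}{(\mathbb E\tilde X^2)^2}$. Innovational outlier: fix a known time $s\in\mathbb N$ and size $\theta\in\mathbb N$. Let $Y_0$ be a non-negative integer-valued random variable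 independent of all $\xi_{k,j},\varepsilon_k$, and $Y_k=\sum_{j=1}^{Y_{k-1}}\xi_{k,j}+\varepsilon_k+\delta_{k,s}\theta$, $k\in\mathbb N$. Define $\tilde\alpha_n=\frac{\sum_{k=1,k\neq s}^n(Y_k-\mu_\varepsilon)Y_{k-1}}{\sum_{k=1,k\neq s}^nY_{k-1}^2}$ when the denominator is positive (and $0$ otherwise) and $\tilde\theta_n=Y_s-\tilde\alpha_nY_{s-1}-\mu_\varepsilon$; this is the conditional least squares estimator minimizing $\sum_{k=1,k\ne s}^n(Y_k-\alpha'Y_{k-1}-\mu_\varepsilon)^2+(Y_s-\alpha'Y_{s-1}-\mu_\varepsilon-\theta')^2$. Conditional convergence: for random variables $\zeta_n$ and a $\mathbb Z_+$-valued random variable $\eta$, ''conditionally on the value $\eta$, $\zeta_n\to\mathcal N(0,v(\eta))$'' means: for every $m$ with $\mathbb P(\eta=m)>0$, the conditional distribution of $\zeta_n$ given $\{\eta=m\}$ converges weakly to $\mathcal N(0,v(m))$ (a degenerate normal if $v(m)=0$). *)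

(* Defs.v *)
From HB Require Import structures.
From mathcomp Require Import all_boot all_order all_algebra.
From mathcomp Require Import all_classical all_reals all_analysis.
From mathcomp Require Import normal_distribution.
Set Implicit Arguments. Unset Strict Implicit. Unset Printing Implicit Defensive.
Import Order.TTheory GRing.Theory Num.Theory.
Import numFieldNormedType.Exports.
Local Open Scope classical_set_scope.
Local Open Scope ring_scope.

Section defs.
Context {d : measure_display} {T : measurableType d} {R : realType}.
Variable P : probability T R.

Definition nat_rv (X : T -> nat) : Prop := forall m, measurable [set w | X w = m].

Definition mutually_independent (I : eqType) (X : I -> T -> nat) : Prop :=
  forall (J : seq I) (v : I -> nat), uniq J ->
    P (\big[setI/setT]_(j <- J) [set w | X j w = v j]) =
    (\prod_(j <- J) P [set w | X j w = v j])%E.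

Inductive inar_idx := IY0 | IEps of nat | IXi of nat & nat.
Definition inar_idx_code (i : inar_idx) : nat + (nat + (nat * nat)) :=
  match i with IY0 => inl 0%N | IEps k => inr (inl k) | IXi k j => inr (inr (k, j)) end.
Definition inar_idx_decode (c : nat + (nat + (nat * nat))) : inar_idx :=
  match c with inl _ => IY0 | inr (inl k) => IEps k | inr (inr (k, j)) => IXi k j end.
Lemma inar_idx_codeK : cancel inar_idx_code inar_idx_decode.
Proof. by case. Qed.
HB.instance Definition _ := Equality.copy inar_idx (can_type inar_idx_codeK).

Definition inar_family (Y0 : T -> nat) (eps : nat -> T -> nat)
  (xi : nat -> nat -> T -> nat) (i : inar_idx) : T -> nat :=
  match i with
  | IY0 => Y0
  | IEps k => eps k.+1
  | IXi k j => xi k.+1 j.+1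
  end.

Definition thinning (xi : nat -> nat -> T -> nat) (k x : nat) (w : T) : nat :=
  (\sum_(1 <= j < x.+1) xi k j w)%N.

(* INAR(1) process with an innovational outlier of size theta at time s *)
Fixpoint Yproc (Y0 : T -> nat) (eps : nat -> T -> nat)
  (xi : nat -> nat -> T -> nat) (s theta : nat) (k : nat) (w : T) : nat :=
  match k with
  | 0 => Y0 w
  | k'.+1 => (thinning xi k'.+1 (Yproc Y0 eps xi s theta k' w) w
             + eps k'.+1 w + (if k'.+1 == s then theta else 0))%N
  end.

Definition mean_eps (eps : nat -> T -> nat) : R :=
  fine (\int[P]_w ((eps 1%N w)%:R)%:E).
Definition var_eps (eps : nat -> T -> nat) : R :=
  fine (\int[P]_w (((eps 1%N w)%:R - mean_eps eps) ^+ 2)%:E).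

Definition inar_trans (eps : nat -> T -> nat) (xi : nat -> nat -> T -> nat)
  (x y : nat) : R :=
  fine (P [set w | (thinning xi 1 x w + eps 1%N w)%N = y]).

Definition is_stationary (eps : nat -> T -> nat) (xi : nat -> nat -> T -> nat)
  (pi : nat -> R) : Prop :=
  (forall m, 0 <= pi m) /\
  (\sum_(m <oo) (pi m)%:E = 1)%E /\
  (forall y, (\sum_(x <oo) (pi x * inar_trans eps xi x y)%:E)%E = (pi y)%:E).

Definition pmf_moment (pi : nat -> R) (k : nat) : \bar R :=
  (\sum_(m <oo) ((m%:R ^+ k * pi m)%:E))%E.

Definition sigma2_alpha_eps (alpha : R) (eps : nat -> T -> nat)
  (pi : nat -> R) : R :=
  (alpha * (1 - alpha) * fine (pmf_moment pi 3) + var_eps eps * fine (pmf_moment pi 2))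
  / (fine (pmf_moment pi 2)) ^+ 2.

(* CLS estimators *)
Definition alpha_tilde (Y : nat -> T -> nat) (mu : R) (s n : nat) (w : T) : R :=
  let num := \sum_(1 <= k < n.+1 | k != s) ((Y k w)%:R - mu) * (Y k.-1 w)%:R in
  let den := \sum_(1 <= k < n.+1 | k != s) (Y k.-1 w)%:R ^+ 2 in
  if 0 < den then num / den else 0.

Definition theta_tilde (Y : nat -> T -> nat) (mu : R) (s n : nat) (w : T) : R :=
  (Y s w)%:R - alpha_tilde Y mu s n w * (Y s.-1 w)%:R - mu.

Definition cvg_dist_cond (Z : nat -> T -> R) (A : set T) (F : R -> R) : Prop :=
  forall x : R, {for x, continuous F} ->
    (fun n => fine (P ([set w | Z n w <= x] `&` A)) / fine (P A)) @ \oo --> F x.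

End defs.

(* cdf of N(0, v), v >= 0; for v = 0 the degenerate law at 0 *)
Definition normal_cdf {R : realType} (v : R) (x : R) : R :=
  if 0 < v then fine (normal_prob 0 (Num.sqrt v) [set y | y <= x])
  else (if 0 <= x then 1 else 0).

(* Main.v *)
Require Import Defs.
From HB Require Import structures.
From mathcomp Require Import all_boot all_order all_algebra.
From mathcomp Require Import all_classical all_reals all_analysis.
From mathcomp Require Import normal_distribution measurable_realfun.
From mathcomp Require Import ring lra.
Set Implicit Arguments. Unset Strict Implicit. Unset Printing Implicit Defensive.
Import Order.TTheory GRing.Theory Num.Theory.
Import numFieldNormedType.Exports.
Local Open Scope classical_set_scope.
Local Open Scope ring_scope.

(* Let [Q f x = E f(alpha o x + eps)] be the INAR(1) kernel, where [alpha o x] is binomial thinning.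
   Its finite difference satisfies [Delta (Q f) = alpha Q (Delta f)], so [Q^j] contracts increments
   geometrically and, with moment drift bounds, [Q^j f] tends to the stationary mean of [f] for [f]
   of cubic growth.  Past the outlier time [s] the process is an INAR(1) chain, and
   [c sqrt n (alpha_tilde - alpha) <= x] compares [c / sqrt n] times a martingale with [x] times an
   ergodic average.
   The ergodic average is handled by an approximate Poisson equation.  The martingale is handled by
   Lindeberg replacement: its law is tested against [F s t = Phi ((a - s) / sqrt (del^2 + t))],
   an explicit solution of the heat equation that already smooths the indicator of
   [s <= a], so no convolution is needed; a Poisson corrector turns the conditional variances into
   the stationary one.  Only third moments are available, so the increments are truncated on
   [Y <= K], the remainder being small in [L^2].  All of this holds on any event [A] determined by
   the history up to time [s], which gives the law of [theta_tilde] conditionally on [Y_(s-1)]. *)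

(** * The normal distribution function *)

(** Third moments shape the whole argument. The summand [(Y_k - alpha Y_(k-1) - mu) Y_(k-1)] has a
    conditional variance of cubic order in [Y_(k-1)], so its stationary variance is just finite,
    whereas the third absolute moment wanted by a replacement argument would need moments of the
    chain of order above three. Truncating on the starting state [Y_(k-1)], not on the summand,
    keeps the martingale property and leaves finitely many states. The law of large numbers for
    [Y^2] meets the same obstacle, because [Y^2] need not be square integrable. A scale [c] serves
    both claims: the error of [theta_tilde] is [- Y_(s-1)] times that of [alpha_tilde], so [c = - m]
    on the event [Y_(s-1) = m], and [c = 1] with the full space gives the first claim. The value
    [m = 0] is degenerate and treated by hand. The histories are discrete, so conditioning means
    restricting an integral to an atom. Integrands are kept nonnegative and only upper bounds are
    proved, which is why the complementary event is needed for the other side. *)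

Section gauss.
Context {R : realType}.
Implicit Types (x y z s t : R).

Definition phi x : R := normal_pdf 0 1 x.

Lemma set_le_itv x : [set y | y <= x] = [set` `]-oo, x]].
Proof. by apply/seteqP; split => y /=; rewrite in_itv. Qed.

Lemma phiE x : phi x = normal_peak 1 * expR (- x ^+ 2 / 2).
Proof. by rewrite /phi normal_pdfE ?oner_neq0 // /normal_fun subr0 expr1n. Qed.

Lemma phi_ge0 x : 0 <= phi x.
Proof. exact: normal_pdf_ge0. Qed.

Lemma is_derive_phi x : is_derive x 1 phi (- x * phi x).
Proof.
rewrite phiE (_ : phi = (fun x => normal_peak 1 * expR (- x ^+ 2 / 2)) :> (R -> R)).
  apply: is_derive_eq.
  by rewrite /GRing.scale /=; field.
by apply/funext => y; exact: phiE.
Qed.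

Definition ncdf (sd x : R) : R := fine (normal_prob 0 sd [set y | y <= x]).

Lemma is_derive_ncdf (sd x : R) : sd != 0 -> is_derive x 1 (ncdf sd) (normal_pdf 0 sd x).
Proof.
(* The fundamental theorem of calculus asks for integrability up to a point strictly beyond [x];
   [x + 1] is an arbitrary choice. *)
move=> sd0; have xu : x < x + 1 by rewrite ltrDl.
have int1 : (@lebesgue_measure R).-integrable [set` `]-oo, x + 1]] (EFin \o normal_pdf 0 sd).
  by apply: integrableS (integrable_normal_pdf 0 sd).
have /= := continuous_FTC1 xu int1 _ (@continuous_normal_pdf R 0 sd sd0 x).
rewrite ltNyr => /(_ isT) [dF Fx].
rewrite (_ : ncdf sd = fun y => \int[lebesgue_measure]_(t in [set` `]-oo, y]]) normal_pdf 0 sd t).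
  by apply: DeriveDef; [exact: dF|rewrite -derive1E].
by apply/funext => y; rewrite /ncdf /normal_prob set_le_itv.
Qed.

Lemma normal_prob_le_fin x (sd : R) : normal_prob 0 sd [set y | y <= x] \is a fin_num.
Proof. by rewrite fin_num_measure // set_le_itv. Qed.

Lemma ncdf_nd sd x y : x <= y -> ncdf sd x <= ncdf sd y.
Proof.
move=> xy; rewrite fine_le ?normal_prob_le_fin // le_measure ?inE //.
- by rewrite set_le_itv.
- by rewrite set_le_itv.
- by move=> z /= /le_trans; apply.
Qed.

Section idrv.
(** The identity, seen as a random variable under the normal law, makes the general limits of a
    distribution function available. *)
Let id_rv : measurableTypeR R -> R := idfun.
#[local] HB.instance Definition _ :=
  @isMeasurableFun.Build _ _ _ _ id_rv (@measurable_id _ _ setT).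

Let cdf_ncdf sd x : cdf (id_rv : {RV (normal_prob 0 sd) >-> R}) x = (ncdf sd x)%:E.
Proof. by rewrite /ncdf fineK ?normal_prob_le_fin // set_le_itv. Qed.

Lemma ncdf_cvgNy sd : ncdf sd x @[x --> -oo%R] --> (0 : R).
Proof.
have := cvg_cdfNy0 (id_rv : {RV (normal_prob 0 sd) >-> R}).
rewrite (_ : cdf _ = fun x => (ncdf sd x)%:E); first by move/fine_cvgP => [].
by apply/funext => x; exact: cdf_ncdf.
Qed.

Lemma ncdf_cvgy sd : ncdf sd x @[x --> +oo%R] --> (1 : R).
Proof.
have := cvg_cdfy1 (id_rv : {RV (normal_prob 0 sd) >-> R}).
rewrite (_ : cdf _ = fun x => (ncdf sd x)%:E); first by move/fine_cvgP => [].
by apply/funext => x; exact: cdf_ncdf.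
Qed.
End idrv.

Definition Phi : R -> R := ncdf 1.

Lemma is_derive_Phi x : is_derive x 1 Phi (phi x).
Proof. exact: is_derive_ncdf (oner_neq0 R). Qed.

Lemma Phi_ge0 x : 0 <= Phi x.
Proof. by rewrite fine_ge0. Qed.

Lemma Phi_le1 x : Phi x <= 1.
Proof.
rewrite -lee_fin fineK ?normal_prob_le_fin //; apply: probability_le1.
by rewrite set_le_itv.
Qed.

Lemma Phi_nd x y : x <= y -> Phi x <= Phi y.
Proof. exact: ncdf_nd. Qed.

Lemma Phi_continuous : continuous Phi.
Proof.
move=> x; apply: differentiable_continuous; apply/derivable1_diffP.
by have := is_derive_Phi x => -[].
Qed.

Lemma normal_pdf_scale sd x : 0 < sd -> normal_pdf 0 sd x = phi (x / sd) / sd.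
Proof.
move=> sd0; rewrite phiE normal_pdfE ?gt_eqF // /normal_fun subr0 /normal_peak.
rewrite expr1n mul1r -mulrnAr sqrtrM ?sqr_ge0 // sqrtr_sqr gtr0_norm //.
rewrite invfM mulrAC -mulrA mulrC; congr (_ * _).
rewrite mulrC; congr (_ * expR _); rewrite expr_div_n; field.
by rewrite gt_eqF.
Qed.

(** Both sides have the same derivative in [x], so their difference is constant, and its limit at
    minus infinity is 0. No change of variables in the integral is involved. *)
Lemma ncdf_scale sd x : 0 < sd -> ncdf sd x = Phi (x / sd).
Proof.
move=> sd0; pose h y := ncdf sd y - Phi (y / sd).
have dh (y : R) : is_derive y (1 : R) h 0.
  have d1 := @is_derive_ncdf sd y (lt0r_neq0 sd0).
  have d2 : is_derive y (1 : R) (fun y => Phi (y / sd)) (phi (y / sd) / sd).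
    have := is_derive_Phi (y / sd) => d2.
    have d3 : is_derive y (1 : R) (fun y => y / sd) (sd^-1).
      by apply: is_derive_eq; rewrite /GRing.scale /= ; ring.
    exact: (@is_derive1_comp _ Phi (fun y => y / sd)).
  apply: is_derive_eq; rewrite normal_pdf_scale // subrr //.
have hc y : h y = h x by apply: is_derive_0_is_cst.
suff h0 : h y @[y --> -oo%R] --> (0 : R).
  have : h y @[y --> -oo%R] --> h x.
    rewrite (_ : h = cst (h x)); first exact: cvg_cst.
    by apply/funext => y; rewrite (hc y).
  move=> /(cvg_unique _ h0) hx; apply/eqP; rewrite -subr_eq0; apply/eqP.
  by rewrite -/(h x) -hx.
rewrite -[X in _ --> X]subr0; apply: (@cvgB _ R^o).
  exact: (ncdf_cvgNy sd).
apply: cvg_comp (ncdf_cvgNy 1).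
by apply: (@gt0_cvgMlNy R _ _ _ (fun x => x)); [rewrite invr_gt0|exact: cvg_id].
Qed.

Lemma normal_cdfE v x : 0 < v -> normal_cdf v x = Phi (x / Num.sqrt v).
Proof. by move=> v0; rewrite /normal_cdf v0 -ncdf_scale ?sqrtr_gt0. Qed.

Lemma Phi_small e : 0 < e -> exists2 B, 0 < B & forall x, x <= - B -> Phi x <= e.
Proof.
move=> e0; have /cvgr0_norm_le /(_ _ e0) := @ncdf_cvgNy 1.
move=> -[M [_ HM]]; exists (Num.max 1 (- M + 1)); first by rewrite lt_max ltr01.
move=> x xB; apply: le_trans (ler_norm _) _; apply: HM.
apply: le_lt_trans xB _; rewrite ltrNl lt_max; apply/orP; right.
by rewrite ltrDl.
Qed.

Lemma Phi_large e : 0 < e -> exists2 B, 0 < B & forall x, B <= x -> 1 - e <= Phi x.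
Proof.
move=> e0; have /cvgrPdist_le /(_ _ e0) := @ncdf_cvgy 1.
move=> -[M [_ HM]]; exists (Num.max 1 (M + 1)); first by rewrite lt_max ltr01.
move=> x xB; have : `|1 - Phi x| <= e.
  apply: HM; apply: lt_le_trans xB; rewrite lt_max; apply/orP; right.
  by rewrite ltrDl.
by move=> /(le_trans (ler_norm _)); rewrite lerBlDr -lerBlDl.
Qed.
End gauss.

(** * Taylor estimates for a solution of the heat equation *)

Section heat.
Context {R : realType}.
Implicit Types (x y z s t : R).

(** No order of [a] and [b] is assumed, because the Taylor estimates concern increments of either
    sign. *)
Lemma mvt_between (f df : R -> R) a b :
  (forall x, Num.min a b <= x <= Num.max a b -> is_derive x 1 f (df x)) ->
  exists2 c, Num.min a b <= c <= Num.max a b & f b - f a = df c * (b - a).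
Proof.
wlog ab : a b / a <= b => [hw|].
  move=> dab; case/orP: (le_total a b) => [ab|ba]; first exact: hw.
  move: dab; rewrite minC maxC => /(hw _ _ ba)[c cab E]; exists c => //.
  by rewrite -(opprB (f a)) E -mulrN opprB.
rewrite min_l // max_r // => dab.
have [||c] := @MVT_segment R f df a b ab.
- move=> x; rewrite in_itv /= => /andP[/ltW ax /ltW xb]; apply: dab.
  by rewrite ax.
- apply: derivable_within_continuous => x; rewrite in_itv /= => xab.
  by have := dab x xab => -[].
- by rewrite in_itv /= => cab E; exists c.
Qed.

(** One integration of a growth bound; the mean value theorem loses the factor [1 / k.+1], which is
    harmless. Two uses produce the third-order Taylor remainder. *)
Lemma norm_le_of_derive (h dh : R -> R) (C : R) (k : nat) :
  (forall x, is_derive x 1 h (dh x)) -> h 0 = 0 ->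
  (forall x, `|dh x| <= C * `|x| ^+ k) -> 0 <= C -> forall x, `|h x| <= C * `|x| ^+ k.+1.
Proof.
move=> dH h0 hb C0 x; have [c cab E] := mvt_between (a := 0) (b := x) (fun y _ => dH y).
move: E; rewrite h0 !subr0 => ->; rewrite normrM exprSr mulrA ler_wpM2r //.
apply: le_trans (hb _) _; rewrite ler_wpM2l // lerXn2r ?nnegrE //.
move: cab; rewrite minEle maxEle; case: ifP => [x0 /andP[c0 cx]|].
  by rewrite !ger0_norm.
by move/negbT; rewrite -ltNge => x0 /andP[c0 cx]; rewrite !ler0_norm ?lerN2 // ltW.
Qed.

(** The 8 comes from [1 + y ^+ 2 / 2 <= expR y] at [y = x ^+ 2 / 2], whose left side is
    [1 + x ^+ 4 / 8]. *)
Lemma phi_poly4 x : (1 + x ^+ 4) * phi x <= 8 * normal_peak 1.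
Proof.
have x20 : 0 <= x ^+ 2 / 2 by rewrite mulr_ge0 ?sqr_ge0 // invr_ge0.
rewrite phiE mulrCA [leRHS]mulrC ler_wpM2l ?normal_peak_ge0 // mulNr expRN.
rewrite ler_pdivrMr ?expR_gt0 //.
have := expR_ge1Dxn 1 x20; rewrite (_ : (2`!)%:R = 2) //.
set e := expR _; rewrite expr_div_n -exprM => H.
have x4 : 0 <= x ^+ 4 by rewrite (_ : 4 = 2 * 2)%N // exprM sqr_ge0.
nra.
Qed.

Lemma abs_le_1X4 x : `|x| <= 1 + x ^+ 4.
Proof.
have h1 := sqr_ge0 (x - 1); have h2 := sqr_ge0 (x + 1); have h3 := sqr_ge0 (x ^+ 2 - 1).
have h4 := sqr_ge0 (x ^+ 2).
by rewrite ler_norml; apply/andP; split; lra.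
Qed.

Variables (a del : R).
Hypothesis del0 : 0 < del.

(** [hF s t] is the probability that [s] plus a centred normal variable of variance [del ^+ 2 + t]
    is at most [a]. Here [t] is the variance still to come, and [del] keeps the derivatives bounded
    down to [t = 0]. [hF1], [hF2], [hF3] are derivatives in [s], and [hF2t] is the derivative of
    [hF2] in [t]. *)
Definition hsd t := Num.sqrt (del ^+ 2 + t).
Definition hz s t := (a - s) / hsd t.
Definition hF s t := Phi (hz s t).
Definition hF1 s t := - phi (hz s t) / hsd t.
Definition hF2 s t := - (hz s t * phi (hz s t)) / hsd t ^+ 2.
Definition hF3 s t := (1 - hz s t ^+ 2) * phi (hz s t) / hsd t ^+ 3.
Definition hF2t s t := (3 * hz s t - hz s t ^+ 3) * phi (hz s t) / (2 * hsd t ^+ 4).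

Lemma hsd_gt0 t : 0 <= t -> 0 < hsd t.
Proof. by move=> t0; rewrite sqrtr_gt0 ltr_wpDr // exprn_gt0. Qed.

Lemma hsd_ge t : 0 <= t -> del <= hsd t.
Proof.
by move=> t0; rewrite -(gtr0_norm del0) -sqrtr_sqr ler_wsqrtr // lerDl.
Qed.

Lemma is_derive_hz s t : is_derive s 1 (hz^~ t) (- (hsd t)^-1).
Proof.
rewrite /hz; apply: is_derive_eq; rewrite /GRing.scale /=; ring.
Qed.

Lemma is_derive_hF s t : is_derive s 1 (hF^~ t) (hF1 s t).
Proof.
have d1 := is_derive_hz s t; have d2 := is_derive_Phi (hz s t).
by apply: is_derive_eq (@is_derive1_comp _ Phi (hz^~ t) _ _ _ d2 d1) _; rewrite /hF1 mulrN mulNr.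
Qed.

Lemma is_derive_phiz s t : is_derive s 1 (fun s => phi (hz s t)) (hz s t * phi (hz s t) / hsd t).
Proof.
have d1 := is_derive_hz s t; have d2 := is_derive_phi (hz s t).
apply: is_derive_eq (@is_derive1_comp _ phi (hz^~ t) _ _ _ d2 d1) _; ring.
Qed.

Lemma is_derive_hF1 s t : is_derive s 1 (hF1^~ t) (hF2 s t).
Proof.
have d1 := is_derive_phiz s t.
rewrite /hF1; apply: is_derive_eq; rewrite /GRing.scale /= /hF2.
rewrite -exprVn. set q := (hsd t)^-1. ring.
Qed.

Lemma is_derive_hF2 s t : is_derive s 1 (hF2^~ t) (hF3 s t).
Proof.
have d1 := is_derive_phiz s t.
have d2 := is_derive_hz s t.
rewrite /hF2; apply: is_derive_eq; rewrite /GRing.scale /= /hF3.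
rewrite -!exprVn. set q := (hsd t)^-1. ring.
Qed.

Lemma is_derive_hsd t : 0 <= t -> is_derive t 1 hsd (2 * hsd t)^-1.
Proof.
move=> t0; have p : 0 < del ^+ 2 + t by rewrite ltr_wpDr // exprn_gt0.
have d1 : is_derive t 1 (fun t => del ^+ 2 + t) 1.
  by apply: is_derive_eq; rewrite add0r mulr1.
have d2 := is_derive1_sqrt p.
by apply: is_derive_eq (@is_derive1_comp _ Num.sqrt (fun t => del ^+ 2 + t) _ _ _ d2 d1) _; rewrite mulr1.
Qed.

Lemma is_derive_hzt s t : 0 <= t -> is_derive t 1 (hz s) (- hz s t / (2 * hsd t ^+ 2)).
Proof.
move=> t0; have d1 := is_derive_hsd t0.
have h0 := lt0r_neq0 (hsd_gt0 t0).
rewrite /hz; apply: is_derive_eq; rewrite /GRing.scale /=; field => //.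
Qed.

(** The heat equation: spending variance from [t] compensates the second-order effect of a centred
    increment of [s]. *)
Lemma is_derive_hFt s t : 0 <= t -> is_derive t 1 (hF s) (hF2 s t / 2).
Proof.
move=> t0; have d1 := is_derive_hzt s t0; have d2 := is_derive_Phi (hz s t).
apply: is_derive_eq (@is_derive1_comp _ Phi (hz s) _ _ _ d2 d1) _.
have h0 := lt0r_neq0 (hsd_gt0 t0); rewrite /hF2; field => //.
Qed.

Lemma is_derive_hF2t s t : 0 <= t -> is_derive t 1 (hF2 s) (hF2t s t).
Proof.
move=> t0; have d1 := is_derive_hzt s t0; have d2 := is_derive_phi (hz s t).
have d3 := @is_derive1_comp _ phi (hz s) _ _ _ d2 d1.
have d4 := is_derive_hsd t0.
have h0 := lt0r_neq0 (hsd_gt0 t0).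
have h2 : hsd t ^+ 2 != 0 by rewrite expf_neq0.
have -> : hF2 s = (fun t => - (hz s t * (phi \o hz s) t) / hsd t ^+ 2) by [].
have d5 : is_derive t 1 (fun t => (hsd t ^+ 2)^-1) (- (hsd t ^+ 2) ^- 2 * (2 * hsd t * (2 * hsd t)^-1)).
  apply: is_deriveV => //; apply: is_derive_eq; rewrite /GRing.scale /=. ring.
apply: is_derive_eq; rewrite /GRing.scale /= /hF2t /=; field => //.
Qed.

Let M : R := 8 * normal_peak 1.

(** Every derivative of [hF] used below is a polynomial of degree at most 4 in [hz], times [phi],
    over a power of [hsd]; the Gaussian factor absorbs the polynomial and [del] bounds [hsd] from
    below. *)
Lemma hz_bound k (c : R) (p : R -> R) (s t : R) : 0 <= t -> 0 <= c ->
  `|p (hz s t)| <= c * (1 + hz s t ^+ 4) ->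
  `|p (hz s t) * phi (hz s t) / hsd t ^+ k| <= c * M / del ^+ k.
Proof.
move=> t0 c0 pz; rewrite normrM ler_pM // ?normr_ge0 //.
  rewrite normrM (ger0_norm (phi_ge0 _)); apply: le_trans (ler_wpM2r (phi_ge0 _) pz) _.
  by rewrite -mulrA ler_wpM2l // phi_poly4.
rewrite normfV normrX (gtr0_norm (hsd_gt0 t0)).
by rewrite lef_pV2 ?posrE ?exprn_gt0 ?hsd_gt0 // lerXn2r ?nnegrE ?hsd_ge // ltW // hsd_gt0.
Qed.

Lemma hF2_bound s t : 0 <= t -> `|hF2 s t| <= M / del ^+ 2.
Proof.
move=> t0; rewrite /hF2 mulNr normrN -[M]mul1r (@hz_bound 2 1 id) //.
by rewrite mul1r abs_le_1X4.
Qed.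

Lemma hF3_bound s t : 0 <= t -> `|hF3 s t| <= 2 * M / del ^+ 3.
Proof.
move=> t0; rewrite /hF3 (@hz_bound 3 2 (fun z => 1 - z ^+ 2)) //.
set z := hz s t; have h3 := sqr_ge0 (z ^+ 2 - 1); have h2 := sqr_ge0 z.
by have h4 := sqr_ge0 (z ^+ 2); rewrite ler_norml; apply/andP; split; lra.
Qed.

Lemma hF2t_bound s t : 0 <= t -> `|hF2t s t| <= 2 * M / del ^+ 4.
Proof.
move=> t0; rewrite /hF2t invfM mulrA [_ * phi _ / _]mulrAC.
rewrite (@hz_bound 4 2 (fun z => (3 * z - z ^+ 3) / 2)) //.
set z := hz s t; have h3 := sqr_ge0 (z ^+ 2 - 1); have h2 := sqr_ge0 (z - 1).
have h5 := sqr_ge0 (z * (z - 1)); have h6 := sqr_ge0 (z * (z + 1)).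
have h4 := sqr_ge0 (z ^+ 2); have h7 := sqr_ge0 (z + 1).
rewrite ler_norml; apply/andP; split; lra.
Qed.
End heat.

(* [F] solves the heat equation [dF/dt = F2 / 2] with [F1 = dF/ds] and [F2 = d^2F/ds^2]; only
   the resulting uniform Taylor estimates are recorded. *)
Definition heat_estimates {R : realType} (F F1 F2 : R -> R -> R) (C : R) : Prop :=
  [/\ forall s z t, 0 <= t ->
        `|F (s + z) t - F s t - z * F1 s t - z ^+ 2 / 2 * F2 s t| <= C * `|z| ^+ 3,
      forall s t t', 0 <= t -> 0 <= t' ->
        `|F s t' - F s t - (t' - t) / 2 * F2 s t| <= C * (t' - t) ^+ 2,
      forall s t, 0 <= t -> `|F2 s t| <= C,
      forall s z t, 0 <= t -> `|F2 (s + z) t - F2 s t| <= C * `|z| &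
      forall s t t', 0 <= t -> 0 <= t' -> `|F2 s t' - F2 s t| <= C * `|t' - t|].

(** All five estimates are invariant under a change of sign of [F] up to a constant, so an upper
    bound derived from them applies to the complementary event as well. *)
Lemma heat_estimates_compl {R : realType} (F F1 F2 : R -> R -> R) (C : R) :
  heat_estimates F F1 F2 C ->
  heat_estimates (fun s t => 1 - F s t) (fun s t => - F1 s t) (fun s t => - F2 s t) C.
Proof.
move=> [h1 h2 h3 h4 h5]; split => [s z t t0|s t t' t0 t'0|*|*|*].
- by have := h1 s z t t0; rewrite -normrN; apply: etrans; congr (`|_| <= _); ring.
- by have := h2 s t t' t0 t'0; rewrite -normrN; apply: etrans; congr (`|_| <= _); ring.
- by rewrite normrN h3.
- by rewrite -normrN opprB opprK addrC h4.
- by rewrite -normrN opprB opprK addrC h5.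
Qed.

Lemma hF_heat_estimates {R : realType} (a del : R) : 0 < del ->
  exists2 C, 0 <= C & heat_estimates (hF a del) (hF1 a del) (hF2 a del) C.
Proof.
move=> del0; set M : R := 8 * normal_peak 1.
have M0 : 0 <= M by rewrite mulr_ge0 // normal_peak_ge0.
have d0 := ltW del0; have p2 : 0 <= M / del ^+ 2 by apply: divr_ge0 => //; apply: exprn_ge0.
have p3 : 0 <= 2 * M / del ^+ 3 by apply: divr_ge0; [apply: mulr_ge0|apply: exprn_ge0].
have p4 : 0 <= 2 * M / del ^+ 4 by apply: divr_ge0; [apply: mulr_ge0|apply: exprn_ge0].
set C := M / del ^+ 2 + 2 * M / del ^+ 3 + 2 * M / del ^+ 4.
have C2 : M / del ^+ 2 <= C by rewrite /C; lra.
have C3 : 2 * M / del ^+ 3 <= C by rewrite /C; lra.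
have C4 : 2 * M / del ^+ 4 <= C by rewrite /C; lra.
have C0 : 0 <= C by lra.
have lip s z t : 0 <= t -> `|hF2 a del (s + z) t - hF2 a del s t| <= C * `|z|.
  move=> t0; have [c _ ->] := mvt_between (a := s) (b := s + z)
     (fun x _ => is_derive_hF2 a del x t).
  rewrite addrAC subrr add0r normrM ler_wpM2r //.
  exact: le_trans (hF3_bound _ _ _ _) _.
have lipt s t t' : 0 <= t -> 0 <= t' -> `|hF2 a del s t' - hF2 a del s t| <= C * `|t' - t|.
  move=> t0 t'0.
  have m0 u : Num.min t t' <= u -> 0 <= u by apply: le_trans; rewrite le_min t0.
  have [|c /andP[/m0 c0 _] ->] := @mvt_between _ (hF2 a del s) (hF2t a del s) t t'.
    by move=> x /andP[/m0 x0 _]; exact: is_derive_hF2t.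
  by rewrite normrM ler_wpM2r //; apply: le_trans (hF2t_bound _ _ _ _) _.
exists C => //; split => //.
- move=> s z t t0.
  (* [h0] is the remainder as a function of the increment, [h1] is its derivative, and the
     derivative of [h1] is a difference of [hF2], hence Lipschitz; two integrations give the
     cube. *)
  pose h1 (y : R) : R := hF1 a del (s + y) t - hF1 a del s t - y * hF2 a del s t.
  pose h0 (y : R) : R := hF a del (s + y) t - hF a del s t - y * hF1 a del s t - y ^+ 2 / 2 * hF2 a del s t.
  have dsh (f df : R -> R) (y : R) : is_derive (s + y) (1 : R) f (df (s + y)) ->
      is_derive y (1 : R) (fun y => f (s + y)) (df (s + y)).
    move=> d1; have d2 : is_derive y (1 : R) (fun y => s + y) 1.
      by apply: is_derive_eq; rewrite add0r mulr1.
    by apply: is_derive_eq (@is_derive1_comp _ f (fun y => s + y) _ _ _ d1 d2) _; rewrite mulr1.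
  have d1' (y : R) : is_derive y (1 : R) h1 (hF2 a del (s + y) t - hF2 a del s t).
    have e1 := dsh _ (hF2 a del ^~ t) y (is_derive_hF1 a del (s + y) t).
    by apply: is_derive_eq; rewrite /GRing.scale /=; ring.
  have d0' (y : R) : is_derive y (1 : R) h0 (h1 y).
    have e1 := dsh _ (hF1 a del ^~ t) y (is_derive_hF a del (s + y) t).
    by apply: is_derive_eq; rewrite /GRing.scale /= /h1; field.
  have b1 y : `|h1 y| <= C * `|y| ^+ 2.
    apply: (norm_le_of_derive d1') => //; first by rewrite /h1; rewrite addr0 subrr mul0r subrr.
    by move=> x; rewrite expr1 lip.
  apply: (norm_le_of_derive d0') => //.
  by rewrite /h0 addr0 subrr expr0n /= !mul0r !subrr.
- move=> s t t' t0 t'0.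
  have m0 u : Num.min t t' <= u -> 0 <= u by apply: le_trans; rewrite le_min t0.
  have [|c /andP[cl cr] ->] := @mvt_between _ (hF a del s) (fun t => hF2 a del s t / 2) t t'.
    by move=> x /andP[/m0 x0 _]; exact: is_derive_hFt.
  have c0 := m0 _ cl.
  rewrite (_ : _ - _ = (hF2 a del s c - hF2 a del s t) * ((t' - t) / 2)); last by field.
  rewrite normrM; apply: le_trans (ler_wpM2r _ (lipt _ _ _ _ _)) _ => //.
  have ct : `|c - t| <= `|t' - t|.
    move: cl cr; rewrite minEle maxEle; case: ifP => [x0 c1 c2|/negbT].
      by rewrite !ger0_norm ?subr_ge0 // lerD2r.
    rewrite -ltNge => /ltW x0 c1 c2; rewrite !ler0_norm ?subr_le0 //.
    by rewrite lerN2 lerD2r.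
  rewrite normrM (ger0_norm (_ : 0 <= 2^-1)) //.
  rewrite -mulrA ler_wpM2l // -[leRHS]real_normK ?num_real // expr2.
  have := normr_ge0 (t' - t); have := normr_ge0 (c - t); nra.
- by move=> s t t0; apply: le_trans (hF2_bound _ _ _ _) _.
Qed.

(** * Functions of cubic growth of discrete variables *)

Section discrete.
Context {d : measure_display} {T : measurableType d}.

Lemma discrete_preimage (I : countType) (X : T -> I) (B : set I) :
  (forall i, measurable [set w | X w = i]) -> measurable (X @^-1` B).
Proof.
move=> mX; pose G n := if unpickle n is Some i then (if `[< B i >] then [set w | X w = i] else set0) else set0 : set T.
rewrite (_ : X @^-1` B = \bigcup_n G n).
  by apply: bigcupT_measurable => n; rewrite /G; case: unpickle => // i; case: ifP.
apply/seteqP; split => [w Bw|w [n _]].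
  by exists (pickle (X w)) => //; rewrite /G pickleK; case: asboolP.
by rewrite /G; case: unpickle => // i; case: asboolP => // Bi /= Xi; rewrite /preimage /= Xi.
Qed.

Lemma discrete_measurable_fun (I : countType) (X : T -> I) d' (T' : measurableType d')
  (f : I -> T') D :
  measurable D -> (forall i, measurable [set w | X w = i]) -> measurable_fun D (fun w => f (X w)).
Proof.
move=> mD mX _ B mB; apply: measurableI => //.
exact: (@discrete_preimage _ X (f @^-1` B)).
Qed.
End discrete.

Section cubic.
Context {R : realType}.
Implicit Types f g : nat -> R.

(** The growth class that third moments make integrable. It is stable under the kernel, so
    integrability side conditions reduce to closure properties of this class. *)
Definition cubic f := exists2 C : R, 0 <= C & forall m, `|f m| <= C * (1 + m%:R ^+ 3).

Lemma cubic_ge1 (m : nat) : 1 <= 1 + m%:R ^+ 3 :> R.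
Proof. by rewrite lerDl exprn_ge0. Qed.

Lemma cubicW f g : cubic g -> (forall m, `|f m| <= g m) -> cubic f.
Proof.
move=> [C C0 gC] fg; exists C => // m; apply: le_trans (fg m) _.
exact: le_trans (ler_norm _) (gC m).
Qed.

Lemma cubicD f g : cubic f -> cubic g -> cubic (fun m => f m + g m).
Proof.
move=> [C C0 hf] [D D0 hg]; exists (C + D); first exact: addr_ge0.
by move=> m; rewrite mulrDl; apply: le_trans (ler_normD _ _) _; rewrite lerD.
Qed.

Lemma cubicZ (a : R) f : cubic f -> cubic (fun m => a * f m).
Proof.
move=> [C C0 hf]; exists (`|a| * C); first exact: mulr_ge0.
by move=> m; rewrite normrM -mulrA ler_wpM2l.
Qed.

Lemma cubicN f : cubic f -> cubic (fun m => - f m).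
Proof. by move=> /(cubicZ (-1)); under eq_fun do rewrite mulN1r. Qed.

Lemma cubicB f g : cubic f -> cubic g -> cubic (fun m => f m - g m).
Proof. by move=> hf /cubicN; exact: cubicD. Qed.

Lemma cubic_bounded f (B : R) : (forall m, `|f m| <= B) -> cubic f.
Proof.
move=> fB; exists B => [|m]; first by apply: le_trans (fB 0%N).
apply: le_trans (fB m) _; rewrite -[leLHS]mulr1 ler_wpM2l ?cubic_ge1 //.
exact: le_trans (fB 0%N).
Qed.

Lemma cubic_cst (c : R) : cubic (fun=> c).
Proof. exact: (@cubic_bounded _ `|c|). Qed.

Lemma natr_expr_le (m k l : nat) : (k <= l)%N -> m%:R ^+ k <= 1 + m%:R ^+ l :> R.
Proof.
move=> kl; case: m => [|m].
  by rewrite [X in X ^+ k](_ : _ = 0) // !expr0n; case: k kl => [|k]; case: l => [|l] //=; rewrite ?addr0 ?ler01 // lerDl.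
apply: (@le_trans _ _ (m.+1%:R ^+ l)); last by rewrite lerDr.
by rewrite ler_weXn2l // ler1n.
Qed.

Lemma cubic_exp (k : nat) : (k <= 3)%N -> cubic (fun m => m%:R ^+ k).
Proof.
by move=> k3; exists 1 => // m; rewrite mul1r ger0_norm ?exprn_ge0 // natr_expr_le.
Qed.

Lemma cubic_id : cubic (fun m => m%:R).
Proof. exact: (@cubic_exp 1). Qed.

Lemma cubic_shift f k : cubic f -> cubic (fun m => f (m + k)%N).
Proof.
move=> [C C0 hf]; pose g (m : nat) : R := C * (1 + (4 * m%:R ^+ 3 + 4 * k%:R ^+ 3)).
apply: (@cubicW _ g).
  apply: cubicZ; apply: cubicD; first exact: cubic_cst.
  apply: cubicD; first by apply: cubicZ; exact: cubic_exp.
  exact: cubic_cst.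
move=> m; apply: le_trans (hf _) _; rewrite /g ler_wpM2l // lerD2l natrD.
have := ler0n R m; have := ler0n R k; set a := m%:R; set b := k%:R => b0 a0.
(* The product equals [4 a^3 + 4 b^3 - (a + b)^3]. *)
suff : 0 <= 3 * (a + b) * (a - b) ^+ 2.
  by apply: contraTT; rewrite -!ltNge => H; lra.
by rewrite mulr_ge0 ?sqr_ge0 // mulr_ge0 // addr_ge0.
Qed.
End cubic.

(** * Binomial thinning and the INAR(1) kernel *)

Section thin.
Context {R : realType}.
Variable alpha : R.
Implicit Types f g : nat -> R.

(* [iter x thin1 f m] is the expectation of [f (m + B)] for [B] binomial with parameters [x] and
   [alpha]. *)
Definition thin1 f (m : nat) : R := (1 - alpha) * f m + alpha * f m.+1.

Definition ndiff f (m : nat) : R := f m.+1 - f m.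

Lemma thin_lin (a b : R) f g x m :
  iter x thin1 (fun y => a * f y + b * g y) m = a * iter x thin1 f m + b * iter x thin1 g m.
Proof. by elim: x m => // x IH m; rewrite !iterS {1}/thin1 !IH /thin1; ring. Qed.

Lemma thin_cst (c : R) x m : iter x thin1 (fun=> c) m = c.
Proof. by elim: x m => // x IH m; rewrite iterS {1}/thin1 !IH; ring. Qed.

Lemma thin_affine (a b : R) x m :
  iter x thin1 (fun y => a + b * y%:R) m = a + b * (m%:R + alpha * x%:R).
Proof.
elim: x m => [m|x IH m]; first by rewrite mulr0 addr0.
by rewrite iterS {1}/thin1 !IH -[m.+1]addn1 -[x.+1]addn1 !natrD; ring.
Qed.

Lemma thin_diff f x m : ndiff (iter x thin1 f) m = iter x thin1 (ndiff f) m.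
Proof.
elim: x m => // x IH m; rewrite !iterS [RHS]/thin1 -!IH /ndiff /thin1; ring.
Qed.

(** An extra Bernoulli trial changes the outcome only on success, which has probability [alpha];
    this is the source of the contraction factor. *)
Lemma thinS f x m : iter x.+1 thin1 f m - iter x thin1 f m = alpha * iter x thin1 (ndiff f) m.
Proof. by rewrite iterS {1}/thin1 -thin_diff /ndiff; ring. Qed.

(** Averaging over one trial turns the centre for [x.+1] into the centre for [x] and leaves behind
    its variance [alpha * (1 - alpha)]. *)
Lemma thin_square (c : R) x m :
  iter x thin1 (fun y => (y%:R - alpha * x%:R - c) ^+ 2) m
  = (m%:R - c) ^+ 2 + x%:R * (alpha * (1 - alpha)).
Proof.
elim: x c m => [c m|x IH c m]; first by rewrite /= mulr0 mul0r subr0 addr0.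
rewrite iterSr (_ : thin1 _ = fun y => 1 * (y%:R - alpha * x%:R - c) ^+ 2 + (alpha * (1 - alpha)) * 1).
  by rewrite (thin_lin _ _ _ (fun=> 1)) IH thin_cst -[x.+1]addn1 natrD; ring.
by apply/funext => y; rewrite /thin1 -[x.+1]addn1 -[y.+1]addn1 !natrD; ring.
Qed.

Hypothesis alpha01 : 0 < alpha < 1.
Let a0 : 0 <= alpha. Proof. by have /andP[/ltW] := alpha01. Qed.
Let a1 : 0 <= 1 - alpha. Proof. by have /andP[_ /ltW] := alpha01; rewrite subr_ge0. Qed.

Lemma thin_le_range f g x m : (forall y, (m <= y <= m + x)%N -> f y <= g y) ->
  iter x thin1 f m <= iter x thin1 g m.
Proof.
elim: x m => [m fg|x IH m fg]; first by apply: fg; rewrite addn0 leqnn.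
rewrite !iterS lerD // ler_wpM2l // IH // => y /andP[my yx]; apply: fg.
  by rewrite my /= (leq_trans yx) // leq_add2l.
by rewrite (ltnW my) /= (leq_trans yx) // addSnnS.
Qed.

Lemma cubic_thin f x : cubic f -> cubic (iter x thin1 f).
Proof.
move=> cf; elim: x => // x IH; rewrite iterS; apply: cubicD.
  exact: cubicZ.
apply: cubicZ; rewrite (_ : (fun m => _) = fun m => iter x thin1 f (m + 1)%N).
  exact: cubic_shift.
by apply/funext => m; rewrite addn1.
Qed.

(** The midpoint of [alpha] and 1. By the inequality of arithmetic and geometric means even
    [lam ^+ 2] exceeds [alpha], so [alpha / lam] and [alpha / lam ^+ 2] are both below 1. *)
Let lam : R := (1 + alpha) / 2.

Lemma lam_bounds : alpha < lam /\ lam < 1 /\ alpha < lam ^+ 2.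
Proof.
have /andP[h0 h1] := alpha01; rewrite /lam; split; first lra; split; first lra.
have : 0 < (1 - alpha) ^+ 2 by rewrite exprn_gt0 // subr_gt0.
by move=> h; lra.
Qed.

(** Jensen's inequality with weights [lam] and [1 - lam] at the points [b / lam] and
    [e / (1 - lam)]; the gap is an explicit square. The cubic version follows the same pattern. *)
Let convex2 (b e : R) : 0 <= b -> 0 <= e -> (b + e) ^+ 2 <= b ^+ 2 / lam + e ^+ 2 / (1 - lam).
Proof.
have [l0 [l1 _]] := lam_bounds; have /andP[h0 h1] := alpha01 => b0 e0.
have lp : 0 < lam by lra.
have lq : 0 < 1 - lam by lra.
rewrite -subr_ge0.
rewrite (_ : _ - _ = (b * (1 - lam) - e * lam) ^+ 2 / (lam * (1 - lam))); last first.
  by field; rewrite !lt0r_neq0.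
by rewrite divr_ge0 ?sqr_ge0 // mulr_ge0 // ltW.
Qed.

Let convex3 (b e : R) : 0 <= b -> 0 <= e -> (b + e) ^+ 3 <= b ^+ 3 / lam ^+ 2 + e ^+ 3 / (1 - lam) ^+ 2.
Proof.
have [l0 [l1 _]] := lam_bounds; have /andP[h0 h1] := alpha01 => b0 e0.
have lp : 0 < lam by lra.
have lq : 0 < 1 - lam by lra.
pose u := b / lam; pose v := e / (1 - lam).
have -> : b = u * lam by rewrite divfK // gt_eqF.
have -> : e = v * (1 - lam) by rewrite divfK // gt_eqF.
have u0 : 0 <= u by rewrite divr_ge0 // ltW.
have v0 : 0 <= v by rewrite divr_ge0 // ltW.
rewrite -subr_ge0.
rewrite (_ : _ - _ = lam * (1 - lam) * (u - v) ^+ 2 * (u * (1 + lam) + v * (2 - lam))); last first.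
  by field; rewrite !lt0r_neq0.
apply: mulr_ge0; first by rewrite mulr_ge0 ?sqr_ge0 // mulr_ge0 // ltW.
by rewrite addr_ge0 // mulr_ge0 //; lra.
Qed.

(* The binomial variable [B] satisfies [B <= x], hence [B^p <= x^(p-1) B]; splitting [(B + m)^p]
   by convexity keeps the contraction factor below 1. *)
Lemma thin_drift2 x m :
  iter x thin1 (fun y => y%:R ^+ 2) m <= alpha / lam * x%:R ^+ 2 + m%:R ^+ 2 / (1 - lam).
Proof.
have [l0 [l1 l2]] := lam_bounds; have /andP[h0 h1] := alpha01.
have lp : 0 < lam by lra.
(* The constant term of the affine majorant in [y] obtained from [(y - m) ^+ 2 <= x * (y - m)]. *)
pose a : R := m%:R ^+ 2 / (1 - lam) - x%:R * m%:R / lam.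
apply: (@le_trans _ _ (iter x thin1 (fun y => a + x%:R / lam * y%:R) m)); last first.
  rewrite thin_affine /a; rewrite le_eqVlt; apply/orP; left; apply/eqP; field; rewrite !lt0r_neq0 //; lra.
apply: thin_le_range => y /andP[my yx].
have -> : y%:R = (y - m)%:R + m%:R :> R by rewrite -natrD subnK.
apply: le_trans (convex2 _ _) _ => //.
rewrite /a (_ : _ + _ * (_ + _) = m%:R ^+ 2 / (1 - lam) + (x%:R * (y - m)%:R) / lam); last by field; rewrite !lt0r_neq0 //; lra.
rewrite addrC lerD2l; apply: ler_wpM2r; first by rewrite invr_ge0 ltW.
by rewrite expr2; apply: ler_wpM2r; rewrite // ler_nat leq_subLR.
Qed.

Lemma thin_drift3 x m :
  iter x thin1 (fun y => y%:R ^+ 3) m <= alpha / lam ^+ 2 * x%:R ^+ 3 + m%:R ^+ 3 / (1 - lam) ^+ 2.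
Proof.
have [l0 [l1 l2]] := lam_bounds; have /andP[h0 h1] := alpha01.
have lp : 0 < lam by lra.
pose a : R := m%:R ^+ 3 / (1 - lam) ^+ 2 - x%:R ^+ 2 * m%:R / lam ^+ 2.
apply: (@le_trans _ _ (iter x thin1 (fun y => a + x%:R ^+ 2 / lam ^+ 2 * y%:R) m)); last first.
  rewrite thin_affine /a; rewrite le_eqVlt; apply/orP; left; apply/eqP; field; rewrite !lt0r_neq0 //; lra.
apply: thin_le_range => y /andP[my yx].
have -> : y%:R = (y - m)%:R + m%:R :> R by rewrite -natrD subnK.
apply: le_trans (convex3 _ _) _ => //.
rewrite /a (_ : _ + _ * (_ + _) = m%:R ^+ 3 / (1 - lam) ^+ 2 + (x%:R ^+ 2 * (y - m)%:R) / lam ^+ 2); last by field; rewrite !lt0r_neq0 //; lra.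
rewrite addrC lerD2l; apply: ler_wpM2r; first by rewrite invr_ge0 exprn_ge0 // ltW.
by rewrite exprSr; apply: ler_wpM2r => //; rewrite lerXn2r ?nnegrE // ler_nat leq_subLR.
Qed.
End thin.

(** * The INAR(1) kernel as an operator: moments, drift and contraction *)

Section Qop.
Context {d : measure_display} {T : measurableType d} {R : realType}.
Variables (P : probability T R) (alpha : R) (e : T -> nat).
Implicit Types f g : nat -> R.

Definition Ee f : R := \int[P]_w (f (e w)).
(** The innovation is the starting value of the thinning, so the [x] trials are averaged out
    algebraically and a single integral, over the innovation, remains. *)
Definition Qop f (x : nat) : R := Ee (iter x (thin1 alpha) f).

Hypothesis alpha01 : 0 < alpha < 1.
Hypothesis me : nat_rv e.
Hypothesis e3 : (\int[P]_w (((e w)%:R : R) ^+ 3)%:E < +oo)%E.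
Let a0 : 0 <= alpha. Proof. by have /andP[/ltW] := alpha01. Qed.

Lemma measurable_e f : measurable_fun setT (fun w => f (e w)).
Proof. exact: discrete_measurable_fun. Qed.

Lemma Ee_integrable f : cubic f -> P.-integrable setT (fun w => (f (e w))%:E).
Proof.
move=> [C C0 fC].
apply: (@le_integrable _ _ _ P setT measurableT _ (fun w => (C * (1 + (e w)%:R ^+ 3))%:E)).
- by apply/measurable_EFinP; exact: measurable_e.
- move=> w _; rewrite lee_fin [leRHS]ger0_norm ?fC //.
  by rewrite mulr_ge0 // (le_trans _ (cubic_ge1 _)).
rewrite (_ : (fun w => _) = (fun w => C%:E * (1 + ((e w)%:R ^+ 3)%:E))%E) //.
apply: integrableZl => //; apply: integrableD => //.
  exact: finite_measure_integrable_cst.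
apply/integrableP; split.
  by apply/measurable_EFinP; exact: (measurable_e (fun m => m%:R ^+ 3)).
by under eq_integral do rewrite /= ger0_norm ?exprn_ge0 //.
Qed.

Lemma Ee_lin (a b : R) f g : cubic f -> cubic g ->
  Ee (fun m => a * f m + b * g m) = a * Ee f + b * Ee g.
Proof.
move=> cf cg; rewrite /Ee RintegralD // ?RintegralZl //.
- exact: Ee_integrable.
- exact: Ee_integrable.
- exact: (Ee_integrable (cubicZ a cf)).
- exact: (Ee_integrable (cubicZ b cg)).
Qed.

Lemma Ee_cst (c : R) : Ee (fun=> c) = c.
Proof.
rewrite /Ee Rintegral_cst // -[RHS]mulr1; congr (_ * _).
exact: (congr1 fine (probability_setT P)).
Qed.

Lemma Ee_le f g : cubic f -> cubic g -> (forall m, f m <= g m) -> Ee f <= Ee g.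
Proof.
move=> cf cg fg; apply: le_Rintegral => //; exact: Ee_integrable.
Qed.

Lemma Q_lin (a b : R) f g x : cubic f -> cubic g ->
  Qop (fun m => a * f m + b * g m) x = a * Qop f x + b * Qop g x.
Proof.
move=> cf cg; rewrite /Qop -Ee_lin; [|exact: cubic_thin..].
by congr Ee; apply/funext => m; rewrite thin_lin.
Qed.

Lemma Q_cst (c : R) x : Qop (fun=> c) x = c.
Proof.
rewrite /Qop (_ : iter _ _ _ = fun=> c) ?Ee_cst //.
by apply/funext => m; rewrite thin_cst.
Qed.

Lemma QD f g x : cubic f -> cubic g -> Qop (fun m => f m + g m) x = Qop f x + Qop g x.
Proof.
move=> cf cg; rewrite -[RHS]mul1r mulrDr -Q_lin //.
by congr Qop; apply/funext => m; rewrite !mul1r.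
Qed.

Lemma QZ a f x : cubic f -> Qop (fun m => a * f m) x = a * Qop f x.
Proof.
move=> cf; rewrite -[RHS]addr0 -[X in _ + X](mul0r (Qop (fun=> 0) x)) -Q_lin //.
  by congr Qop; apply/funext => m; rewrite mul0r addr0.
exact: cubic_cst.
Qed.

Lemma QN f x : cubic f -> Qop (fun m => - f m) x = - Qop f x.
Proof.
move=> cf; rewrite -mulN1r -QZ //; congr Qop; apply/funext => m.
by rewrite mulN1r.
Qed.

Lemma QB f g x : cubic f -> cubic g -> Qop (fun m => f m - g m) x = Qop f x - Qop g x.
Proof. by move=> cf cg; rewrite QD ?QN //; exact: cubicN. Qed.

Lemma Q_le f g x : cubic f -> cubic g -> (forall m, f m <= g m) -> Qop f x <= Qop g x.
Proof.
move=> cf cg fg; apply: Ee_le; [exact: cubic_thin..|].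
by move=> m; apply: thin_le_range.
Qed.

Lemma Q_ge0 f x : cubic f -> (forall m, 0 <= f m) -> 0 <= Qop f x.
Proof. by move=> cf f0; rewrite -(Q_cst 0 x); apply: Q_le => //; exact: cubic_cst. Qed.

Lemma Q_norm f g x : cubic g -> (forall m, `|f m| <= g m) -> `|Qop f x| <= Qop g x.
Proof.
move=> cg fg; have cf := cubicW cg fg.
rewrite ler_norml; apply/andP; split.
  rewrite -QN //; apply: Q_le => //; first exact: cubicN.
  by move=> m; have := fg m; rewrite ler_norml => /andP[].
by apply: Q_le => // m; apply: le_trans (fg m); exact: ler_norm.
Qed.

Lemma Q_bounded f (B : R) x : (forall m, `|f m| <= B) -> `|Qop f x| <= B.
Proof. by move=> fB; rewrite -(Q_cst B x); apply: Q_norm => //; exact: cubic_cst. Qed.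

(** Starts [x] and [x.+1] share the innovation and [x] trials; only the last trial tells them
    apart. *)
Lemma diff_Q f x : cubic f -> ndiff (Qop f) x = alpha * Qop (ndiff f) x.
Proof.
move=> cf; have cd : cubic (ndiff f).
  apply: cubicB => //; rewrite (_ : (fun m => _) = fun m => f (m + 1)%N).
    exact: cubic_shift.
  by apply/funext => m; rewrite addn1.
rewrite /ndiff /Qop -[X in _ - X]mul1r -[X in X - _]mul1r -mulNr -Ee_lin; [|exact: cubic_thin..].
rewrite -[RHS]addr0 -[X in _ + X](mul0r (Ee (fun=> 0))) -Ee_lin; [|exact: cubic_thin|exact: cubic_cst].
congr Ee; apply/funext => m.
by rewrite mul0r addr0 mul1r mulN1r thinS.
Qed.

Let lam : R := (1 + alpha) / 2.

Lemma Q_drift2 : exists rho C : R, [/\ 0 <= rho, rho < 1, 0 <= C &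
  forall x, Qop (fun y => y%:R ^+ 2) x <= rho * x%:R ^+ 2 + C].
Proof.
have [l0 [l1 l2]] := lam_bounds alpha01; rewrite -/lam in l0 l1 l2.
have lp : 0 < lam by apply: le_lt_trans l0.
have c2 : @cubic R (fun y => y%:R ^+ 2) by exact: cubic_exp.
exists (alpha / lam), ((1 - lam)^-1 * Ee (fun m => m%:R ^+ 2)); split.
- by rewrite divr_ge0 // ltW.
- by rewrite ltr_pdivrMr // mul1r.
- rewrite mulr_ge0 // ?invr_ge0 ?subr_ge0 ?(ltW l1) //.
  by apply: Rintegral_ge0 => w _; exact: exprn_ge0.
move=> x; rewrite -[X in X + _](Ee_cst) -[X in X + _]mul1r -Ee_lin //; last exact: cubic_cst.
apply: Ee_le; first exact: cubic_thin.
- by apply: cubicD; apply: cubicZ => //; exact: cubic_cst.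
- by move=> m; rewrite mul1r [_^-1 * _]mulrC; exact: thin_drift2.
Qed.

Lemma Q_drift3 : exists rho C : R, [/\ 0 <= rho, rho < 1, 0 <= C &
  forall x, Qop (fun y => y%:R ^+ 3) x <= rho * x%:R ^+ 3 + C].
Proof.
have [l0 [l1 l2]] := lam_bounds alpha01; rewrite -/lam in l0 l1 l2.
have lp : 0 < lam by apply: le_lt_trans l0.
have c2 : @cubic R (fun y => y%:R ^+ 3) by exact: cubic_exp.
exists (alpha / lam ^+ 2), ((1 - lam) ^- 2 * Ee (fun m => m%:R ^+ 3)); split.
- by rewrite divr_ge0 // exprn_ge0 // ltW.
- by rewrite ltr_pdivrMr ?exprn_gt0 // mul1r.
- rewrite mulr_ge0 // ?invr_ge0 ?sqr_ge0 //.
  by apply: Rintegral_ge0 => w _; exact: exprn_ge0.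
move=> x; rewrite -[X in X + _](Ee_cst) -[X in X + _]mul1r -Ee_lin //; last exact: cubic_cst.
apply: Ee_le; first exact: cubic_thin.
- by apply: cubicD; apply: cubicZ => //; exact: cubic_cst.
- by move=> m; rewrite mul1r [_^-1 * _]mulrC; exact: thin_drift3.
Qed.

Lemma cubic_Q f : cubic f -> cubic (Qop f).
Proof.
move=> [C C0 fC]; have [rho [D [r0 r1 D0 drift]]] := Q_drift3.
exists (C * (1 + D)) => [|x]; first by rewrite mulr_ge0 // addr_ge0.
have c3 : @cubic R (fun y => y%:R ^+ 3) by exact: cubic_exp.
have c1 : @cubic R (fun y => 1 + y%:R ^+ 3) by apply: cubicD => //; exact: cubic_cst.
apply: le_trans (Q_norm _ (cubicZ C c1) fC) _; rewrite QZ // -mulrA ler_wpM2l //.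
rewrite QD //; last exact: cubic_cst.
rewrite Q_cst; have := drift x; have : 0 <= x%:R ^+ 3 :> R by exact: exprn_ge0.
nra.
Qed.

Lemma cubic_Qiter f j : cubic f -> cubic (iter j Qop f).
Proof. by move=> cf; elim: j => // j IH; exact: cubic_Q. Qed.

Lemma Qiter_norm f g j x : cubic g -> (forall m, `|f m| <= g m) ->
  `|iter j Qop f x| <= iter j Qop g x.
Proof.
move=> cg fg; elim: j x => // j IH x; apply: Q_norm => //; exact: cubic_Qiter.
Qed.

Lemma Qiter_bounded f (B : R) j x : (forall m, `|f m| <= B) -> `|iter j Qop f x| <= B.
Proof. by move=> fB; elim: j x => // j IH x; apply: Q_bounded. Qed.

Lemma QiterZ (c : R) f j x : cubic f -> iter j Qop (fun m => c * f m) x = c * iter j Qop f x.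
Proof.
move=> cf; elim: j x => // j IH x; rewrite !iterS -QZ; last exact: cubic_Qiter.
by congr Qop; apply/funext.
Qed.

(** Iterating the drift inequality gives a geometric series; its sum is bounded uniformly in [j]. *)
Lemma Qiter_drift (V : nat -> R) (rho C : R) j x : cubic V -> (forall x, 0 <= V x) ->
  0 <= rho -> rho < 1 -> 0 <= C ->
  (forall x, Qop V x <= rho * V x + C) -> iter j Qop V x <= V x + C / (1 - rho).
Proof.
move=> cV V0 r0 r1 C0 dV.
have q0 : 0 < 1 - rho by rewrite subr_gt0.
have H i y : iter i Qop V y <= rho ^+ i * V y + C * (1 - rho ^+ i) / (1 - rho).
  elim: i y => [|i IH] y; first by rewrite !expr0 mul1r subrr mulr0 mul0r addr0.
  set k := C * (1 - rho ^+ i) / (1 - rho) in IH.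
  apply: (@le_trans _ _ (Qop (fun y => rho ^+ i * V y + k) y)).
    apply: Q_le => //; first exact: cubic_Qiter.
    apply: cubicD; [exact: cubicZ|exact: cubic_cst].
  rewrite QD ?Q_cst ?QZ //; [|exact: cubicZ|exact: cubic_cst].
  apply: le_trans (lerD (ler_wpM2l (exprn_ge0 i r0) (dV y)) (lexx k)) _.
  rewrite le_eqVlt; apply/orP; left; apply/eqP; rewrite /k exprSr; field.
  by rewrite gt_eqF.
apply: le_trans (H j x) _.
have ri0 : 0 <= rho ^+ j by exact: exprn_ge0.
have ri1 : rho ^+ j <= 1 by rewrite exprn_ile1 // ltW.
apply: lerD; first by rewrite ler_piMl.
by rewrite ler_wpM2r ?invr_ge0 ?(ltW q0) // ler_piMr // gerBl.
Qed.

Lemma Qiter_moment k : (k = 2 \/ k = 3)%N -> exists2 K : R, 0 <= K &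
  forall j x, iter j Qop (fun y => 1 + y%:R ^+ k) x <= K * (1 + x%:R ^+ k).
Proof.
move=> k23.
have : exists rho C : R, [/\ 0 <= rho, rho < 1, 0 <= C &
  forall x, Qop (fun y => y%:R ^+ k) x <= rho * x%:R ^+ k + C].
  by case: k23 => ->; [exact: Q_drift2|exact: Q_drift3].
move=> [rho [C [r0 r1 C0 dr]]].
have ck : @cubic R (fun y => y%:R ^+ k) by apply: cubic_exp; case: k23 => ->.
have q0 : 0 < 1 - rho by rewrite subr_gt0.
(* Adding 1 to the moment raises the drift constant to at most [1 + C]. *)
exists (1 + (1 + C) / (1 - rho)) => [|j x].
  by rewrite addr_ge0 // divr_ge0 ?(ltW q0) // addr_ge0.
have c1 : @cubic R (fun=> 1) by exact: cubic_cst.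
have Hd : iter j Qop (fun y => 1 + y%:R ^+ k) x <= 1 + x%:R ^+ k + (1 + C) / (1 - rho).
  apply: Qiter_drift => //.
  - exact: cubicD.
  - by rewrite addr_ge0.
  - by move=> y; rewrite QD // Q_cst; have := dr y; lra.
apply: le_trans Hd _.
have : 0 <= (1 + C) / (1 - rho) by rewrite divr_ge0 ?(ltW q0) // addr_ge0.
set c := (_ / _) => c0; rewrite mulrDl mul1r lerD2l ler_peMr //.
by rewrite lerDl exprn_ge0.
Qed.

Lemma diff_Qiter f j x : cubic f -> ndiff (iter j Qop f) x = alpha ^+ j * iter j Qop (ndiff f) x.
Proof.
move=> cf.
have cd : cubic (ndiff f).
  apply: cubicB => //; rewrite (_ : (fun m => _) = fun m => f (m + 1)%N).
    exact: cubic_shift.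
  by apply/funext => m; rewrite addn1.
elim: j x => [|j IH] x; first by rewrite expr0 mul1r.
rewrite !iterS diff_Q; last exact: cubic_Qiter.
rewrite exprS -mulrA; congr (_ * _); rewrite -QZ; last exact: cubic_Qiter.
by congr Qop; apply/funext.
Qed.

(* Coupling the chains started from [x] and [y] through common innovations makes [Q^j] contract
   increments by [alpha^j]. *)
Lemma Qiter_contract (L : R) : exists2 K : R, 0 <= K & forall f, cubic f -> 0 <= L ->
  (forall x, `|ndiff f x| <= L * (1 + x%:R ^+ 2)) ->
  forall j x y, `|iter j Qop f x - iter j Qop f y| <= alpha ^+ j * K * (2 + x%:R ^+ 3 + y%:R ^+ 3).
Proof.
have [K2 K20 hK2] := Qiter_moment (or_introl erefl).
pose K := 2 * (`|L| * K2).
have K0 : 0 <= K by rewrite mulr_ge0 // mulr_ge0.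
exists K => // f cf L0 dfL.
have c2 : @cubic R (fun y => 1 + y%:R ^+ 2).
  by apply: cubicD; [exact: cubic_cst|exact: cubic_exp].
have aj0 j : 0 <= alpha ^+ j by exact: exprn_ge0.
have step j x : `|ndiff (iter j Qop f) x| <= alpha ^+ j * (L * K2) * (1 + x%:R ^+ 2).
  rewrite diff_Qiter // normrM ger0_norm // -!mulrA ler_wpM2l //.
  apply: le_trans (Qiter_norm _ _ (cubicZ L c2) dfL) _.
  by rewrite QiterZ // ler_wpM2l.
have h0 j x : `|iter j Qop f x - iter j Qop f 0%N| <= alpha ^+ j * K * (1 + x%:R ^+ 3).
  (* Telescoping from 0 to [x] sums [x] increments of quadratic size, hence the cubic bound in the
     end. *)
  apply: (@le_trans _ _ (alpha ^+ j * (L * K2) * (x%:R * (1 + x%:R ^+ 2)))).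
    elim: x => [|x IH]; first by rewrite subrr normr0 mul0r mulr0.
    rewrite (_ : _ - _ = ndiff (iter j Qop f) x + (iter j Qop f x - iter j Qop f 0%N)); last first.
      by rewrite /ndiff addrA subrK.
    apply: le_trans (ler_normD _ _) _; apply: le_trans (lerD (step _ _) IH) _.
    rewrite -mulrDr ler_wpM2l //; first by rewrite mulr_ge0 // mulr_ge0.
    have x0 := ler0n R x; rewrite -[x.+1]addn1 natrD; nra.
  rewrite /K (ger0_norm L0) [leRHS](_ : _ = alpha ^+ j * (L * K2) * (2 * (1 + x%:R ^+ 3))); last by ring.
  apply: ler_wpM2l; first by rewrite mulr_ge0 // mulr_ge0.
  have := @natr_expr_le R x 1 3 isT; rewrite expr1 => h; have := h.
  by have : 0 <= x%:R ^+ 3 :> R := exprn_ge0 _ (ler0n _ _); lra.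
move=> j x y; rewrite (_ : _ - _ = (iter j Qop f x - iter j Qop f 0%N) - (iter j Qop f y - iter j Qop f 0%N)).
  apply: le_trans (ler_normB _ _) _; apply: le_trans (lerD (h0 _ _) (h0 _ _)) _.
  by rewrite -mulrDr le_eqVlt; apply/orP; left; apply/eqP; ring.
by rewrite opprB addrA subrK.
Qed.

Lemma Q_innov_mean x : Qop (fun y => y%:R - alpha * x%:R - Ee (fun m => m%:R)) x = 0.
Proof.
set mu := Ee _; rewrite /Qop (_ : iter _ _ _ = fun m => 1 * m%:R + (- mu) * 1).
  rewrite Ee_lin; [|exact: cubic_id|exact: cubic_cst].
  by rewrite Ee_cst mul1r mulr1 subrr.
apply/funext => m; rewrite (_ : (fun y => _) = fun y : nat => (- alpha * x%:R - mu) + 1 * y%:R).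
  by rewrite thin_affine; ring.
by apply/funext => y; ring.
Qed.

Lemma cubic_sqr_affine (a : R) : cubic (fun y => (y%:R - a) ^+ 2).
Proof.
rewrite (_ : (fun y => _) = fun y => (y%:R ^+ 2 + (- 2 * a) * y%:R) + a ^+ 2).
  apply: cubicD; last exact: cubic_cst.
  by apply: cubicD; [exact: cubic_exp|apply: cubicZ; exact: cubic_id].
by apply/funext => y; ring.
Qed.

Lemma Q_innov_var x : let mu := Ee (fun m => m%:R) in
  Qop (fun y => (y%:R - alpha * x%:R - mu) ^+ 2) x =
  alpha * (1 - alpha) * x%:R + Ee (fun m => (m%:R - mu) ^+ 2).
Proof.
move=> mu; rewrite /Qop (_ : iter _ _ _ = fun m => 1 * (m%:R - mu) ^+ 2 + (x%:R * (alpha * (1 - alpha))) * 1).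
  rewrite Ee_lin ?Ee_cst; [|exact: cubic_sqr_affine|exact: cubic_cst].
  by ring.
by apply/funext => m; rewrite thin_square; ring.
Qed.
End Qop.

Section partition.
Context {d : measure_display} {T : measurableType d} {R : realType}.
Variable P : probability T R.
Local Open Scope ereal_scope.

Lemma integral_partition (D : set T) (X : T -> nat) (f : T -> \bar R) :
  measurable D -> nat_rv X -> measurable_fun D f -> (forall w, D w -> 0 <= f w) ->
  \int[P]_(w in D) f w = \sum_(m <oo) \int[P]_(w in D `&` [set w | X w = m]) f w.
Proof.
move=> mD mX mf f0.
have DE : D = \bigcup_m (D `&` [set w | X w = m]).
  by apply/seteqP; split => [w Dw|w [m _ []//]]; exists (X w).
rewrite [in LHS]DE ge0_integral_bigcup //.
- by move=> m; apply: measurableI => //; exact: mX.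
- by rewrite -DE.
- by move=> w [m _ [Dw _]]; exact: f0.
- by apply/trivIsetP => i j _ _ ij; apply/seteqP; split => // w [[_ /= Xi] [_ /= Xj]]; move: ij; rewrite -Xi -Xj eqxx.
Qed.

Lemma integral_nat_rv (D : set T) (X : T -> nat) (f : nat -> R) :
  measurable D -> nat_rv X -> (forall m, 0 <= f m)%R ->
  \int[P]_(w in D) (f (X w))%:E = \sum_(m <oo) (f m)%:E * P (D `&` [set w | X w = m]).
Proof.
move=> mD mX f0; rewrite (@integral_partition _ X) //.
- apply: eq_eseriesr => m _.
  rewrite -integral_cst; last by apply: measurableI => //; exact: mX.
  by apply: eq_integral => w /[1!inE] -[_ /= ->].
- by apply/measurable_EFinP; exact: discrete_measurable_fun.
- by move=> w _; rewrite lee_fin.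
Qed.

End partition.

(** * Transition probabilities of the kernel *)

Section kernel.
Context {d : measure_display} {T : measurableType d} {R : realType}.
Variables (P : probability T R) (alpha : R) (e : T -> nat).
Hypothesis alpha01 : 0 < alpha < 1.
Hypothesis me : nat_rv e.
Hypothesis e3 : (\int[P]_w (((e w)%:R : R) ^+ 3)%:E < +oo)%E.
Implicit Types f g : nat -> R.
Let a0 : 0 <= alpha. Proof. by have /andP[/ltW] := alpha01. Qed.
Let a1 : 0 <= 1 - alpha. Proof. by have /andP[_ /ltW] := alpha01; rewrite subr_ge0. Qed.

Definition rker (x y : nat) : R := Qop P alpha e (fun z => (z == y)%:R) x.

Lemma cubic_eqb y : @cubic R (fun z => (z == y)%:R).
Proof. by apply: (@cubic_bounded _ _ 1) => m; case: eqP => _; rewrite ?normr1 ?normr0. Qed.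

Lemma rker_ge0 x y : 0 <= rker x y.
Proof. by apply: Q_ge0 => //; exact: cubic_eqb. Qed.

Lemma rker0 y : rker 0 y = fine (P [set w | e w = y]).
Proof.
rewrite /rker /Qop /Ee /Rintegral /= (@integral_nat_rv _ _ _ P setT e (fun z => (z == y)%:R)) //; congr fine.
rewrite (@nneseriesD1 _ _ y xpredT) //; last by move=> k _; rewrite mule_ge0 // lee_fin.
rewrite eqxx mul1e setTI eseries0 ?adde0 // => i _ /negbTE ->.
by rewrite mul0e.
Qed.

Lemma Q_succ f x : Qop P alpha e f x.+1 = Qop P alpha e (thin1 alpha f) x.
Proof. by rewrite /Qop iterSr. Qed.

Lemma rkerS x y : rker x.+1 y =
  (1 - alpha) * rker x y + alpha * (if y is y'.+1 then rker x y' else 0).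
Proof.
rewrite {1}/rker Q_succ.
transitivity ((1 - alpha) * rker x y + alpha * Qop P alpha e (fun z => (z.+1 == y)%:R) x).
  rewrite -Q_lin //; first exact: cubic_eqb.
  by apply: (@cubic_bounded _ _ 1) => m; case: eqP => _; rewrite ?normr1 ?normr0.
congr (_ + _ * _); case: y => [|y] //.
by rewrite (_ : (fun z => _) = fun=> 0) ?Q_cst.
Qed.

(** Induction on [x] peels off one trial: it acts on [f] through [thin1] and on the row of the
    kernel through [rkerS], and the two agree after a shift of the summation index. *)
Lemma Q_series f x : cubic f -> (forall m, 0 <= f m) ->
  (\sum_(y <oo) (rker x y * f y)%:E = (Qop P alpha e f x)%:E)%E.
Proof.
elim: x f => [|x IH] f cf f0.
  rewrite /Qop /= /Ee /Rintegral fineK; last first.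
    by apply: integrable_fin_num => //; exact: Ee_integrable.
  rewrite integral_nat_rv //; apply: eq_eseriesr => y _.
  rewrite rker0 setTI EFinM muleC fineK // fin_num_measure //; exact: me.
have ct : cubic (thin1 alpha f) by exact: (@cubic_thin _ _ _ 1).
have t0 m : 0 <= thin1 alpha f m by rewrite addr_ge0 // mulr_ge0.
rewrite Q_succ -IH //.
transitivity (\sum_(y <oo) (((1 - alpha) * rker x y * f y)%:E
    + (alpha * (if y is y'.+1 then rker x y' else 0) * f y)%:E))%E.
  by apply: eq_eseriesr => y _; rewrite rkerS mulrDl EFinD.
transitivity (\sum_(y <oo) (((1 - alpha) * rker x y * f y)%:E
    + (alpha * rker x y * f y.+1)%:E))%E; last first.
  by apply: eq_eseriesr => y _; rewrite -EFinD /thin1; congr EFin; ring.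
have r0 y : 0 <= rker x y by exact: rker_ge0.
rewrite !nneseriesD; do ?[by move=> [|y] _ _; rewrite lee_fin ?mulr0 ?mul0r // !mulr_ge0].
congr (_ + _)%E; rewrite nneseries_recl //; last first.
  by move=> [|y] _; rewrite lee_fin ?mulr0 ?mul0r // !mulr_ge0.
rewrite mulr0 mul0r add0e.
rewrite -(@nneseries_addn _ (fun y => (alpha * (if y is y'.+1 then rker x y' else 0) * f y)%:E) 1).
  by apply: eq_eseriesr => y _; rewrite addn1.
by move=> [|y]; rewrite lee_fin ?mulr0 ?mul0r // !mulr_ge0.
Qed.
End kernel.

(** * The stationary distribution *)

Section stationary.
Context {d : measure_display} {T : measurableType d} {R : realType}.
Variables (P : probability T R) (alpha : R) (e : T -> nat) (p : nat -> R).
Hypothesis alpha01 : 0 < alpha < 1.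
Hypothesis me : nat_rv e.
Hypothesis e3 : (\int[P]_w (((e w)%:R : R) ^+ 3)%:E < +oo)%E.
Hypothesis p0 : forall m, 0 <= p m.
Hypothesis p1 : (\sum_(m <oo) (p m)%:E = 1)%E.
Hypothesis pQ : forall y, (\sum_(x <oo) (p x * rker P alpha e x y)%:E)%E = (p y)%:E.
Implicit Types f g : nat -> R.
Let a0 : 0 <= alpha. Proof. by have /andP[/ltW] := alpha01. Qed.
Local Notation Q := (Qop P alpha e).

Definition Pi f : \bar R := (\sum_(m <oo) (f m * p m)%:E)%E.

Let t0 f m : (forall m, 0 <= f m) -> (0 <= (f m * p m)%:E)%E.
Proof. by move=> f0; rewrite lee_fin mulr_ge0. Qed.

Lemma Pi_le f g : (forall m, 0 <= f m) -> (forall m, f m <= g m) -> (Pi f <= Pi g)%E.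
Proof.
move=> f0 fg; apply: lee_nneseries => [i _ _|m _]; first exact: t0.
by rewrite lee_fin ler_wpM2r.
Qed.

Lemma PiD f g : (forall m, 0 <= f m) -> (forall m, 0 <= g m) ->
  Pi (fun m => f m + g m) = (Pi f + Pi g)%E.
Proof.
move=> f0 g0; rewrite /Pi -nneseriesD; [|by move=> *; exact: t0..].
by apply: eq_eseriesr => m _; rewrite mulrDl EFinD.
Qed.

Lemma PiZ (a : R) f : (forall m, 0 <= f m) -> Pi (fun m => a * f m) = (a%:E * Pi f)%E.
Proof.
move=> f0; rewrite /Pi -nneseriesZl; last by move=> *; exact: t0.
by apply: eq_eseriesr => m _; rewrite -mulrA.
Qed.

Lemma Pi_cst (c : R) : Pi (fun=> c) = c%:E.
Proof.
rewrite /Pi -[RHS]mule1 -p1 -nneseriesZl; last by move=> *; rewrite lee_fin.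
by apply: eq_eseriesr => m _.
Qed.

(** Stationarity is given for point masses; Tonelli's theorem extends it to nonnegative
    functions. *)
Lemma Pi_Q f : cubic f -> (forall m, 0 <= f m) -> Pi (Q f) = Pi f.
Proof.
move=> cf f0.
have r0 x y : 0 <= rker P alpha e x y by exact: rker_ge0.
transitivity (\sum_(x <oo) \sum_(y <oo) ((p x)%:E * (rker P alpha e x y * f y)%:E))%E.
  apply: eq_eseriesr => x _; rewrite nneseriesZl; last first.
    by move=> *; rewrite lee_fin mulr_ge0.
  by rewrite Q_series // -EFinM mulrC.
rewrite nneseries_interchange; last by move=> *; rewrite -EFinM lee_fin !mulr_ge0.
apply: eq_eseriesr => y _.
transitivity (\sum_(x <oo) ((f y)%:E * (p x * rker P alpha e x y)%:E))%E.
  by apply: eq_eseriesr => x _; rewrite -!EFinM; congr EFin; ring.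
rewrite nneseriesZl ?pQ //; by move=> *; rewrite lee_fin mulr_ge0.
Qed.

Lemma Pi_partial_le f (B : \bar R) : (forall m, 0 <= f m) ->
  (forall n, (Pi (fun m => if (m < n)%N then f m else 0%R) <= B)%E) -> (Pi f <= B)%E.
Proof.
move=> f0 fB; apply: lime_le; first by apply: is_cvg_nneseries => *; exact: t0.
apply: nearW => n; apply: le_trans (fB n).
rewrite (_ : (\sum_(0 <= i < n) _)%E = (\sum_(0 <= i < n) ((if (i < n)%N then f i else 0%R) * p i)%:E)%E).
  by apply: nneseries_lim_ge => i _ _; rewrite lee_fin mulr_ge0 //; case: ifP.
by apply: eq_big_nat => i /andP[_ ->].
Qed.

(* Applying stationarity to the bounded function [min(m^3, c)] avoids assuming that the third
   moment is finite. *)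
Lemma Pi_moment3 : exists C : R, (Pi (fun m => (m%:R ^+ 3)%R) <= C%:E)%E.
Proof.
have [rho [C [r0 r1 C0 drift]]] := Q_drift3 alpha01 me e3.
have q0 : 0 < 1 - rho by rewrite subr_gt0.
have c3 : @cubic R (fun y => y%:R ^+ 3) by exact: cubic_exp.
exists (C / (1 - rho)); apply: Pi_partial_le => [m|K]; first exact: exprn_ge0.
pose c : R := K%:R ^+ 3; have c0 : 0 <= c by exact: exprn_ge0.
pose fc (m : nat) : R := Num.min (m%:R ^+ 3) c.
have fc0 m : 0 <= fc m by rewrite le_min exprn_ge0.
have cfc : cubic fc by apply: (@cubic_bounded _ _ c) => m; rewrite ger0_norm // ge_min lexx orbT.
pose h (x : nat) : R := Num.min (rho * x%:R ^+ 3 + C) c.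
have h0 m : 0 <= h m by rewrite le_min c0 addr_ge0 // mulr_ge0 // exprn_ge0.
have Qfc x : Q fc x <= h x.
  rewrite le_min; apply/andP; split.
    apply: le_trans (drift x); apply: Q_le => // m; by rewrite ge_min lexx.
  rewrite -(Q_cst P alpha e c x); apply: Q_le => //; first exact: cubic_cst.
  by move=> m; rewrite ge_min lexx orbT.
pose g (m : nat) : R := if (m < K)%N then m%:R ^+ 3 else 0.
have g0 m : 0 <= g m by rewrite /g; case: ifP => // _; exact: exprn_ge0.
(* Below [K] the cap is inactive in [fc] and the drift leaves a gain of [(1 - rho) * m^3]; from [K]
   on, [g] vanishes and [fc] sits at the cap, which also bounds [h]. *)
have pt m : h m + (1 - rho) * g m <= fc m + C.
  rewrite /h /g /fc; case: ifPn => mK.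
    rewrite (min_l (x := m%:R ^+ 3)); last by rewrite lerXn2r ?nnegrE // ler_nat ltnW.
    have : Num.min (rho * m%:R ^+ 3 + C) c <= rho * m%:R ^+ 3 + C by rewrite ge_min lexx.
    by lra.
  rewrite mulr0 addr0 (min_r (x := m%:R ^+ 3)); last by rewrite lerXn2r ?nnegrE // ler_nat leqNgt.
  have : Num.min (rho * m%:R ^+ 3 + C) c <= c by rewrite ge_min lexx orbT.
  by lra.
(* The cap makes [Pi h] finite, so that it can be cancelled at the end. *)
have hfin : Pi h \is a fin_num.
  rewrite ge0_fin_numE; last by apply: nneseries_ge0 => *; exact: t0.
  apply: (@le_lt_trans _ _ (Pi (fun=> c))); last by rewrite Pi_cst ltry.
  by apply: Pi_le => // m; rewrite ge_min lexx orbT.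
have : (Pi h + (1 - rho)%:E * Pi g <= Pi h + C%:E)%E.
  rewrite -PiZ // -PiD //; last by move=> m; rewrite mulr_ge0 // ltW.
  apply: (@le_trans _ _ (Pi fc + C%:E)%E).
    rewrite -(Pi_cst C) -PiD //; apply: Pi_le => // m.
    by rewrite addr_ge0 // mulr_ge0 // ltW.
  rewrite leeD2r // -Pi_Q //; apply: Pi_le => // m; exact: Q_ge0.
rewrite leeD2lE // => H.
rewrite -(@lee_pmul2l _ (1 - rho)%:E) ?lte_fin //.
by rewrite -EFinM mulrCA divff ?mulr1 ?gt_eqF.
Qed.

Definition pir f : R := fine (Pi f).

Lemma Pi_fin f : cubic f -> (forall m, 0 <= f m) -> Pi f = (pir f)%:E.
Proof.
move=> [C C0 fC] f0; rewrite /pir fineK // ge0_fin_numE; last first.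
  by apply: nneseries_ge0 => *; exact: t0.
have [D hD] := Pi_moment3.
apply: (@le_lt_trans _ _ (Pi (fun m => C * (1 + m%:R ^+ 3)))).
  by apply: Pi_le => // m; apply: le_trans (fC m); exact: ler_norm.
have h0 (m : nat) : 0 <= m%:R ^+ 3 :> R by exact: exprn_ge0.
rewrite PiZ; last by move=> m; rewrite addr_ge0.
rewrite PiD // Pi_cst.
apply: (@le_lt_trans _ _ (C%:E * (1%:E + D%:E))%E); last by rewrite -EFinD -EFinM ltry.
by rewrite lee_wpmul2l ?lee_fin // leeD2l.
Qed.

Lemma pir_ge0 f : (forall m, 0 <= f m) -> 0 <= pir f.
Proof. by move=> f0; rewrite fine_ge0 // nneseries_ge0 // => *; exact: t0. Qed.

Lemma pir_cst (c : R) : pir (fun=> c) = c.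
Proof. by rewrite /pir Pi_cst. Qed.

Lemma pir_le f g : cubic f -> cubic g -> (forall m, 0 <= f m) -> (forall m, f m <= g m) ->
  pir f <= pir g.
Proof.
move=> cf cg f0 fg; rewrite -lee_fin -!Pi_fin //; first exact: Pi_le.
by move=> m; apply: le_trans (fg m).
Qed.

Lemma pirD f g : cubic f -> cubic g -> (forall m, 0 <= f m) -> (forall m, 0 <= g m) ->
  pir (fun m => f m + g m) = pir f + pir g.
Proof. by move=> cf cg f0 g0; rewrite /pir PiD // !Pi_fin. Qed.

Lemma pirZ (a : R) f : cubic f -> (forall m, 0 <= f m) -> pir (fun m => a * f m) = a * pir f.
Proof. by move=> cf f0; rewrite /pir PiZ // !Pi_fin. Qed.

Lemma pir_Qiter f j : cubic f -> (forall m, 0 <= f m) -> pir (iter j Q f) = pir f.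
Proof.
move=> cf f0; elim: j => // j IH; rewrite iterS -IH /pir Pi_Q //; first exact: cubic_Qiter.
elim: j {IH} => // j IH m; apply: Q_ge0 => //; exact: cubic_Qiter.
Qed.

(** Since [pir (Q^j f) = pir f], averaging the contraction bound over a second, stationary start
    measures the distance to the stationary mean; the third stationary moment keeps that average
    finite. *)
Lemma ergodic f (L : R) : cubic f -> (forall m, 0 <= f m) -> 0 <= L ->
  (forall x, `|ndiff f x| <= L * (1 + x%:R ^+ 2)) ->
  exists2 K : R, 0 <= K & forall j x, `|iter j Q f x - pir f| <= alpha ^+ j * K * (1 + x%:R ^+ 3).
Proof.
move=> cf f0 L0 dL; have [K K0 hK] := Qiter_contract alpha01 me e3 L.
pose m3 := pir (fun m => m%:R ^+ 3).
have c3 : @cubic R (fun y => y%:R ^+ 3) by exact: cubic_exp.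
have p3 (m : nat) : 0 <= m%:R ^+ 3 :> R by exact: exprn_ge0.
have m30 : 0 <= m3 by exact: pir_ge0.
have aj j : 0 <= alpha ^+ j by exact: exprn_ge0.
exists (K * (2 + m3)) => [|j x]; first by rewrite mulr_ge0 // addr_ge0.
have Qf0 m : 0 <= iter j Q f m.
  elim: j m => // j IH m; apply: Q_ge0 => //; exact: cubic_Qiter.
have cQ : cubic (iter j Q f) by exact: cubic_Qiter.
pose A := alpha ^+ j * K; have A0 : 0 <= A by rewrite mulr_ge0.
have kk y : `|iter j Q f x - iter j Q f y| <= A * (2 + x%:R ^+ 3) + A * y%:R ^+ 3.
  by rewrite -mulrDr; exact: hK.
have b0 : 0 <= A * (2 + x%:R ^+ 3) by rewrite mulr_ge0 // addr_ge0.
have pA y : 0 <= A * y%:R ^+ 3 :> R by rewrite mulr_ge0.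
have cA : cubic (fun y => A * y%:R ^+ 3) by exact: cubicZ.
have cB : cubic (fun y => A * (2 + x%:R ^+ 3) + A * y%:R ^+ 3).
  by apply: cubicD => //; exact: cubic_cst.
have pB : pir (fun y => A * (2 + x%:R ^+ 3) + A * y%:R ^+ 3) = A * (2 + x%:R ^+ 3) + A * m3.
  by rewrite pirD ?pir_cst ?pirZ //; exact: cubic_cst.
have bound : A * (2 + x%:R ^+ 3) + A * m3 <= alpha ^+ j * (K * (2 + m3)) * (1 + x%:R ^+ 3).
  have : 0 <= A * (1 + m3) * x%:R ^+ 3 by rewrite mulr_ge0 // mulr_ge0 // addr_ge0.
  by rewrite /A; lra.
apply: le_trans bound; rewrite -pB -(pir_Qiter j cf f0).
set B := fun y : nat => A * (2 + x%:R ^+ 3) + A * y%:R ^+ 3 in cB pB *.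
have kk' y : `|iter j Q f x - iter j Q f y| <= B y := kk y.
have B0 m : 0 <= B m by rewrite addr_ge0.
have cc : cubic (fun=> iter j Q f x) by exact: cubic_cst.
(* Monotonicity of [pir] is available for nonnegative functions, so the absolute value is split into
   two comparisons between nonnegative functions. *)
have U : pir (iter j Q f) <= pir (fun y => iter j Q f x + B y).
  apply: pir_le => //; first exact: cubicD.
  by move=> y; have /= := kk' y; rewrite ler_norml => /andP[]; lra.
have V : pir (fun=> iter j Q f x) <= pir (fun y => iter j Q f y + B y).
  apply: pir_le => //; first exact: cubicD.
  by move=> y; have /= := kk' y; rewrite ler_norml => /andP[_]; lra.
rewrite pirD // in U; rewrite pirD // in V; rewrite !pir_cst in U V.
by rewrite ler_norml; apply/andP; split; lra.
Qed.

Lemma pir_tail f (eps : R) : cubic f -> (forall m, 0 <= f m) -> 0 < eps ->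
  exists K0 : nat, forall K, (K0 <= K)%N -> pir (fun m => if (m <= K)%N then 0 else f m) <= eps.
Proof.
move=> cf f0 eps0.
have fin : (Pi f < +oo)%E by rewrite Pi_fin // ltry.
have := @nneseries_tail_cvg _ (fun m => (f m * p m)%:E) xpredT fin (fun m _ => t0 m f0).
move=> /fine_cvgP[_ /cvgr0_norm_le /(_ _ eps0)] [N _ HN]; exists N => K NK.
have := HN K.+1 (leq_trans NK (leqnSn K)); apply: le_trans.
rewrite ger0_norm; last by rewrite fine_ge0 // nneseries_ge0 // => *; exact: t0.
rewrite -lee_fin -Pi_fin; last by move=> m; case: ifP.
  rewrite fineK; last first.
    rewrite ge0_fin_numE; last by rewrite nneseries_ge0 // => *; exact: t0.
    apply: le_lt_trans fin; rewrite [leRHS](@nneseries_split _ _ 0 K.+1) //; last by move=> *; exact: t0.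
    by rewrite add0n leeDr // sume_ge0 // => *; exact: t0.
  rewrite /Pi (@nneseries_split _ _ 0 K.+1) //; last first.
    by move=> k _; rewrite lee_fin mulr_ge0 //; case: ifP.
  rewrite big_nat_cond big1 ?add0e ?add0n; last first.
    by move=> i; rewrite andbT => /andP[_]; rewrite ltnS => ->; rewrite mul0r.
  apply: lee_nneseries => [i _ _|m _]; first by rewrite lee_fin mulr_ge0 //; case: ifP.
  by rewrite lee_fin ler_wpM2r //; case: ifP.
apply: cubicW cf _ => m; case: ifP => _; rewrite ?normr0 // ger0_norm //.
Qed.

(** Otherwise the stationary law is the point mass at 0, and stationarity at 0 forces the innovation
    to vanish almost surely. *)
Lemma pir_gt0 f : cubic f -> (forall m, 0 <= f m) -> (forall m, (0 < m)%N -> 0 < f m) ->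
  (0 < P [set w | e w != 0%N])%E -> 0 < pir f.
Proof.
move=> cf f0 fp Pe.
have [[m m0 pm]|none] := pselect (exists2 m, (0 < m)%N & 0 < p m).
  rewrite -lte_fin -Pi_fin //; apply: (@lt_le_trans _ _ (f m * p m)%:E).
    by rewrite lte_fin mulr_gt0 // fp.
  rewrite /Pi (@nneseriesD1 _ _ m xpredT) //; last by move=> *; exact: t0.
  by rewrite leeDl // nneseries_ge0 // => *; exact: t0.
have pm0 m : (0 < m)%N -> p m = 0.
  move=> m0; apply/eqP; rewrite eq_le p0 andbT leNgt; apply/negP => pm.
  by apply: none; exists m.
have p01 : p 0%N = 1.
  apply/EFin_inj; rewrite -p1 (@nneseriesD1 _ _ 0%N xpredT) //; last by move=> *; rewrite lee_fin.
  by rewrite eseries0 ?adde0 // => i _ /=; rewrite -lt0n => /pm0 ->.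
have := pQ 0; rewrite (@nneseriesD1 _ _ 0%N xpredT) //; last first.
  by move=> k _; rewrite lee_fin mulr_ge0 // rker_ge0.
rewrite eseries0 ?adde0; last by move=> i _ /=; rewrite -lt0n => /pm0 ->; rewrite mul0r.
have pfin : P [set w | e w = 0%N] \is a fin_num by rewrite fin_num_measure //; exact: me.
rewrite p01 mul1r rker0 // fineK //.
move=> E0; move: Pe; rewrite (_ : [set w | e w != 0%N] = ~` [set w | e w = 0%N]).
  by rewrite probability_setC ?E0 ?subee ?ltxx //; exact: me.
by apply/seteqP; split => w /= /eqP.
Qed.
End stationary.

(** * The Markov property of the outlier process *)

Section markov.
Context {d : measure_display} {T : measurableType d} {R : realType}.
Variables (P : probability T R) (alpha : R).
Variables (Y0 : T -> nat) (eps : nat -> T -> nat) (xi : nat -> nat -> T -> nat) (s theta : nat).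
Hypothesis alpha01 : 0 < alpha < 1.
Hypothesis mY0 : nat_rv Y0.
Hypothesis meps : forall k, nat_rv (eps k).
Hypothesis mxi : forall k j, nat_rv (xi k j).
Hypothesis indep : mutually_independent P (inar_family Y0 eps xi).
Hypothesis eps_id : forall k m, (1 <= k)%N -> P [set w | eps k w = m] = P [set w | eps 1%N w = m].
Hypothesis xi_bern : forall k j, (1 <= k)%N -> (1 <= j)%N ->
  P [set w | xi k j w = 1%N] = alpha%:E /\ P [set w | xi k j w = 0%N] = (1 - alpha)%:E.
Hypothesis e3 : (\int[P]_w (((eps 1%N w)%:R : R) ^+ 3)%:E < +oo)%E.

Local Notation X := (inar_family Y0 eps xi).
Local Notation Y := (Yproc Y0 eps xi s theta).
Local Notation rk := (rker P alpha (eps 1%N)).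
Local Notation Q := (Qop P alpha (eps 1%N)).

Definition cyl (K : seq inar_idx) (v : inar_idx -> nat) : set T :=
  \big[setI/setT]_(j <- K) [set w | X j w = v j].

Lemma mX i : nat_rv (X i).
Proof. by case: i => [|k|k j] /=. Qed.

Lemma measurable_cyl K v : measurable (cyl K v).
Proof. by apply: bigsetI_measurable => i _; exact: mX. Qed.

Definition upd (v : inar_idx -> nat) (i : inar_idx) (a : nat) : inar_idx -> nat :=
  fun j => if j == i then a else v j.

Lemma cyl_upd K v i a : i \notin K -> cyl K (upd v i a) = cyl K v.
Proof.
move=> iK; rewrite /cyl; apply: eq_big_seq => j jK; rewrite /upd.
by case: eqP => // ji; move: iK; rewrite -ji jK.
Qed.

Lemma cyl_cons K v i a : i \notin K -> cyl (i :: K) (upd v i a) = [set w | X i w = a] `&` cyl K v.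
Proof. by move=> iK; rewrite -(cyl_upd v a iK) /cyl big_cons /upd eqxx. Qed.

Lemma P_cyl_cons K v i a : uniq K -> i \notin K ->
  P (cyl (i :: K) (upd v i a)) = (P [set w | X i w = a] * P (cyl K v))%E.
Proof.
move=> uK iK; rewrite -(cyl_upd v a iK) /cyl !indep //=; last by rewrite iK.
by rewrite big_cons /upd eqxx.
Qed.

Definition time_of (i : inar_idx) : nat :=
  match i with IY0 => 0%N | IEps k => k.+1 | IXi k _ => k.+1 end.

(** Independence of everything that enters after step [k]. It is tested on cylinders of point
    events, the form in which mutual independence is given. *)
Definition indep_after (k : nat) (A : set T) : Prop :=
  measurable A /\ forall K v, uniq K -> all (fun i => k < time_of i)%N K ->
    P (cyl K v `&` A) = (P (cyl K v) * P A)%E.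

(** The successor of a state frozen at [x], before any outlier. Freezing [x] makes it a function of
    the variables of step [k] alone. *)
Definition Zk (k x : nat) (w : T) : nat := (thinning xi k x w + eps k w)%N.

Lemma Zk0 k w : Zk k 0 w = eps k w.
Proof. by rewrite /Zk /thinning big_geq. Qed.

Lemma ZkS k x w : Zk k x.+1 w = (xi k x.+1 w + Zk k x w)%N.
Proof. by rewrite /Zk /thinning big_nat_recr //= addnAC addnC. Qed.

Lemma mZk k x : nat_rv (Zk k x).
Proof.
elim: x => [|x IH] m.
  rewrite (_ : [set w | _] = [set w | eps k w = m]); first exact: meps.
  by apply/seteqP; split => w /=; rewrite Zk0.
rewrite (_ : [set w | _] = (fun w => (xi k x.+1 w, Zk k x w)) @^-1` [set z | (z.1 + z.2)%N = m]).
  apply: discrete_preimage => -[a b].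
  rewrite (_ : [set w | _] = [set w | xi k x.+1 w = a] `&` [set w | Zk k x w = b]).
    by apply: measurableI; [exact: mxi|exact: IH].
  by apply/seteqP; split => w /= [-> ->].
by apply/seteqP; split => w /=; rewrite ZkS.
Qed.

(** The masses at 0 and 1 add up to 1, so all other values of the trial form a null set. *)
Lemma xi_split k j (E : set T) : (1 <= k)%N -> (1 <= j)%N -> measurable E ->
  P E = (P (E `&` [set w | xi k j w = 0%N]) + P (E `&` [set w | xi k j w = 1%N]))%E.
Proof.
move=> k1 j1 mE; have [h1 h0] := xi_bern k1 j1.
have m0 := mxi k j 0; have m1 := mxi k j 1.
have PU : P ([set w | xi k j w = 0%N] `|` [set w | xi k j w = 1%N]) = 1%E.
  rewrite (measureU P m0 m1); last by apply/seteqP; split => // w [/= -> ].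
  by transitivity ((1 - alpha)%:E + alpha%:E)%E; [congr (_ + _)%E|rewrite -EFinD subrK].
rewrite -(measureU P (measurableI _ _ mE m0) (measurableI _ _ mE m1)); last first.
  by apply/seteqP; split => // w [[_ /= ->] [_ /=]].
rewrite -setIUr; set U := (_ `|` _) in PU *.
have mU : measurable U by exact: measurableU.
rewrite (measureDI P mE mU) [X in (X + _)%E](_ : _ = 0%E) ?add0e //.
apply/eqP; rewrite eq_le measure_ge0 andbT.
apply: (@le_trans _ _ (P (~` U))).
  by apply: le_measure; rewrite ?inE; [exact: measurableD|exact: measurableC|move=> w []].
by rewrite probability_setC // PU subee.
Qed.

(** The induction on [x] peels off the last trial and moves it into the cylinder. For this the
    cylinder must be allowed to contain trials of the current step that are not yet used, those of
    code index at least [x]. *)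
Lemma indep_Zk k (A : set T) x y K v : indep_after k A -> uniq K ->
  all (fun i => (k.+1 < time_of i)%N || (if i is IXi k' j then (k' == k) && (x <= j)%N else false)) K ->
  P (cyl K v `&` (A `&` [set w | Zk k.+1 x w = y])) = (P (cyl K v) * (P A * (rk x y)%:E))%E.
Proof.
move=> [mA iA]; elim: x y K v => [|x IH] y K v uK aK.
  have nK : IEps k \notin K.
    by apply/negP => /(allP aK) /=; rewrite ltnn.
  rewrite (_ : _ `&` _ = cyl (IEps k :: K) (upd v (IEps k) y) `&` A); last first.
    rewrite cyl_cons // setICA setIC; congr (_ `&` _); rewrite setIC; congr (_ `&` _).
    by apply/seteqP; split => w /=; rewrite Zk0.
  rewrite iA.
  - rewrite P_cyl_cons // rker0 // fineK; last by rewrite fin_num_measure //; exact: meps.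
    by rewrite eps_id // -muleA muleCA; congr (_ * _)%E; rewrite muleC.
  - by rewrite /= nK.
  - rewrite /= ltnSn /=; apply: sub_all aK => i /orP[/ltnW //|].
    by case: i => // k' j /andP[/eqP -> _] /=.
have nK : IXi k x \notin K.
  by apply/negP => /(allP aK) /=; rewrite ltnn eqxx ltnn.
have mE : measurable (cyl K v `&` (A `&` [set w | Zk k.+1 x.+1 w = y])).
  by apply: measurableI; [exact: measurable_cyl|apply: measurableI => //; exact: mZk].
have aK' : all (fun i => (k.+1 < time_of i)%N || (if i is IXi k' j then (k' == k) && (x <= j)%N else false)) (IXi k x :: K).
  rewrite /= eqxx leqnn orbT /=; apply: sub_all aK => i /orP[->//|].
  by case: i => // k' j /andP[-> /ltnW ->]; rewrite orbT.
have uK' : uniq (IXi k x :: K) by rewrite /= nK.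
have [h1 h0] := xi_bern (isT : (1 <= k.+1)%N) (isT : (1 <= x.+1)%N).
have [a aE] : exists a, P (cyl K v) = a%:E.
  by exists (fine (P (cyl K v))); rewrite fineK // fin_num_measure //; exact: measurable_cyl.
have [b bE] : exists b, P A = b%:E by exists (fine (P A)); rewrite fineK // fin_num_measure.
rewrite (@xi_split k.+1 x.+1) //.
have E0 : cyl K v `&` (A `&` [set w | Zk k.+1 x.+1 w = y]) `&` [set w | xi k.+1 x.+1 w = 0%N] =
   cyl (IXi k x :: K) (upd v (IXi k x) 0%N) `&` (A `&` [set w | Zk k.+1 x w = y]).
  rewrite cyl_cons //; apply/seteqP; split => w /=; rewrite ZkS.
    by move=> [[? [? E]] xi0]; move: E; rewrite xi0.
  by move=> [[xi0 ?] [? <-]]; rewrite xi0.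
have E1 : cyl K v `&` (A `&` [set w | Zk k.+1 x.+1 w = y]) `&` [set w | xi k.+1 x.+1 w = 1%N] =
   if y is y'.+1 then cyl (IXi k x :: K) (upd v (IXi k x) 1%N) `&` (A `&` [set w | Zk k.+1 x w = y'])
   else set0.
  case: y {mE E0} => [|y].
    by apply/seteqP; split => w //=; rewrite ZkS => -[[? [? E]] xi0]; move: E; rewrite xi0.
  rewrite cyl_cons //; apply/seteqP; split => w /=; rewrite ZkS.
    by move=> [[? [? E]] xi0]; move: E; rewrite xi0 add1n => -[].
  by move=> [[xi0 ?] [? <-]]; rewrite xi0 add1n.
rewrite E0 E1 IH // P_cyl_cons //= h0 rkerS //.
rewrite aE bE.
case: y {mE E0 E1} => [|y].
  by rewrite measure0 adde0 mulr0 addr0 -!EFinM; congr EFin; ring.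
rewrite IH // P_cyl_cons //= h1 aE bE -!EFinM. by rewrite -EFinD; congr EFin; ring.
Qed.

Lemma P_indep_Zk k A x y : indep_after k A ->
  P (A `&` [set w | Zk k.+1 x w = y]) = (P A * (rk x y)%:E)%E.
Proof.
move=> iA; have := @indep_Zk k A x y [::] (fun=> 0%N) iA isT isT.
rewrite /cyl big_nil setTI => ->.
by rewrite (_ : P setT = 1%E) ?mul1e //; exact: probability_setT.
Qed.

Lemma indep_after_Zk k A x y : indep_after k A ->
  indep_after k.+1 (A `&` [set w | Zk k.+1 x w = y]).
Proof.
move=> iA; have [mA _] := iA; split.
  by apply: measurableI => //; exact: mZk.
move=> K v uK aK; rewrite indep_Zk ?P_indep_Zk //.
by apply: sub_all aK => i ->.
Qed.

Lemma indep_after_setT : indep_after 0 setT.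
Proof.
split=> // K v _ _; rewrite setIT (_ : P setT = 1%E) ?mule1 //; exact: probability_setT.
Qed.

(** Translates the stationarity hypothesis, stated with probabilities, into the operator; the full
    space plays the role of the past. *)
Lemma inar_trans_rker x y : inar_trans P eps xi x y = rk x y.
Proof.
rewrite /inar_trans; have := P_indep_Zk x y indep_after_setT.
rewrite setTI (_ : P setT = 1%E) ?mul1e; last exact: probability_setT.
by rewrite /Zk => ->.
Qed.

(** Histories take countably many values, so the past is generated by atoms and every conditional
    statement becomes one about a single history. *)
Fixpoint hist (k : nat) (w : T) : seq nat :=
  if k is k'.+1 then Y k w :: hist k' w else [:: Y0 w].

Definition shift_at (k : nat) : nat := if k == s then theta else 0%N.

Lemma head_hist k w : head 0%N (hist k w) = Y k w.
Proof. by case: k. Qed.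

Lemma hist_consE k w : hist k w = Y k w :: behead (hist k w).
Proof. by case: k. Qed.

Lemma indep_after_set0 k : indep_after k set0.
Proof. by split => // K v _ _; rewrite setI0 measure0 mule0. Qed.

Lemma indep_after_hist k h : indep_after k [set w | hist k w = h].
Proof.
elim: k h => [|k IH] h.
  case: h => [|y [|z h]]; last 2 first.
  - split; first by rewrite (_ : [set w | _] = [set w | Y0 w = y]); [exact: mY0|apply/seteqP; split => w /= [->]].
    move=> K v uK aK; have nK : IY0 \notin K by apply/negP => /(allP aK).
    rewrite (_ : _ `&` _ = cyl (IY0 :: K) (upd v IY0 y)); last first.
      by rewrite cyl_cons // setIC; congr (_ `&` _); apply/seteqP; split => w /= [->].
    rewrite P_cyl_cons // muleC; congr (_ * P _)%E.
    by apply/seteqP; split => w /= [->].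
  - by rewrite (_ : [set w | _] = set0); [exact: indep_after_set0|apply/seteqP; split].
  - by rewrite (_ : [set w | _] = set0); [exact: indep_after_set0|apply/seteqP; split].
case: h => [|y [|x h]].
- by rewrite (_ : [set w | _] = set0); [exact: indep_after_set0|apply/seteqP; split].
- rewrite (_ : [set w | _] = set0); first exact: indep_after_set0.
  by apply/seteqP; split => // w /= [_]; rewrite hist_consE.
(* The new state contains the outlier shift, so thinning and innovation account for
   [y - shift_at k.+1]; a smaller [y] gives an empty atom. *)
have [ty|ty] := leqP (shift_at k.+1) y.
  rewrite (_ : [set w | _] = [set w | hist k w = x :: h] `&` [set w | Zk k.+1 x w = (y - shift_at k.+1)%N]).
    exact: indep_after_Zk.
  apply/seteqP; split => w; rewrite /= -/(Zk _ _ _) -/(shift_at _).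
    move=> [yE hE]; split=> //; rewrite -yE addnK.
    by rewrite -(head_hist k) hE.
  move=> [hE zE]; rewrite hE; congr (_ :: _).
  by rewrite -(head_hist k) hE /= zE subnK.
rewrite (_ : [set w | _] = set0); first exact: indep_after_set0.
apply/seteqP; split => // w /= [yE _]; move: ty; rewrite -yE -/(shift_at _).
by rewrite ltnNge leq_addl.
Qed.

(** Stands for measurability with respect to the past: such a set is a union of atoms. *)
Definition hist_det (k : nat) (A : set T) : Prop :=
  forall w w', hist k w = hist k w' -> A w -> A w'.

Lemma hist_det_setT k : hist_det k setT. Proof. by []. Qed.

Lemma hist_det_Y k j m : (j <= k)%N -> hist_det k [set w | Y j w = m].
Proof.
elim: k => [|k IH] jk w w'.
  by move: jk; rewrite leqn0 => /eqP -> /= [->].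
move: jk; rewrite leq_eqVlt => /predU1P[->|]; first by move=> /= [-> _].
by rewrite ltnS => /IH hd /= [_]; exact: hd.
Qed.

Lemma hist_detS k A : hist_det k A -> hist_det k.+1 A.
Proof. by move=> hA w w' /= [_ /hA]. Qed.

Definition hist_step (k : nat) (f : seq nat -> R) (h : seq nat) : R :=
  Q (fun y => f ((y + shift_at k.+1)%N :: h)) (head 0%N h).

Lemma mhist k h : measurable [set w | hist k w = h].
Proof. by have [] := indep_after_hist k h. Qed.

Lemma measurable_hist_fun k (f : seq nat -> R) D : measurable D ->
  measurable_fun D (fun w => (f (hist k w))%:E).
Proof.
by move=> mD; apply/measurable_EFinP; apply: discrete_measurable_fun => // h; exact: mhist.
Qed.

(** The Markov property in integrated form. On an atom of the history the current state is constant,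
    so the next state is independent of the atom and has a row of the kernel as its law. *)
Lemma integral_hist_step k A (f : seq nat -> R) : measurable A -> hist_det k A ->
  (forall h, 0 <= f h) -> (forall h, cubic (fun y => f (y :: h))) ->
  (\int[P]_(w in A) (f (hist k.+1 w))%:E = \int[P]_(w in A) (hist_step k f (hist k w))%:E)%E.
Proof.
move=> mA hA f0 cf.
have cf' h : cubic (fun y => f ((y + shift_at k.+1)%N :: h)) by exact: (cubic_shift _ (cf h)).
have Qf0 h : 0 <= hist_step k f h by apply: Q_ge0.
(* Coding histories by natural numbers lets the partition lemma be used for the atoms. *)
have mpk : nat_rv (fun w => pickle (hist k w)).
  move=> m; apply: (@discrete_preimage _ _ _ (hist k) [set h | pickle h = m]) => h; exact: mhist.
rewrite (integral_partition P mA mpk); [|exact: measurable_hist_fun|by move=> *; rewrite lee_fin].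
rewrite [RHS](integral_partition P mA mpk); [|exact: measurable_hist_fun|by move=> *; rewrite lee_fin].
apply: eq_eseriesr => n _; set D := (A `&` _).
have [[w0 Dw0]|D0] := pselect (exists w0, D w0); last first.
  rewrite (_ : D = set0) ?integral_set0 //.
  by apply/seteqP; split => // w Dw; apply: D0; exists w.
pose h := hist k w0; pose x := Y k w0.
have DE : D = [set w | hist k w = h].
  case: Dw0 => Aw0 /= pw0; apply/seteqP; split => w /=.
    by move=> [Aw]; rewrite -pw0 => /(pcan_inj pickleK).
  by move=> hw; split; [apply: hA Aw0; rewrite hw|rewrite /= hw -pw0].
have mD : measurable D by rewrite DE; exact: mhist.
have Yx w : D w -> Y k w = x by rewrite DE /= -head_hist => ->; rewrite head_hist.
transitivity (\int[P]_(w in D) (f ((Zk k.+1 x w + shift_at k.+1)%N :: h))%:E)%E.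
  by apply: eq_integral => w /[1!inE] Dw; move: (Dw); rewrite [in X in X -> _]DE /= -/(Zk _ _ _) Yx // => ->.
transitivity (\int[P]_(w in D) (hist_step k f h)%:E)%E; last first.
  by apply: eq_integral => w /[1!inE]; rewrite DE /= => ->.
rewrite (@integral_nat_rv _ _ _ P D (Zk k.+1 x) (fun y => f ((y + shift_at k.+1)%N :: h))) //; last exact: mZk.
rewrite integral_cst // /hist_step head_hist -/x -Q_series //.
have pDf : P D \is a fin_num by rewrite fin_num_measure.
transitivity ((fine (P D))%:E * \sum_(y <oo) (rk x y * f ((y + shift_at k.+1)%N :: h))%:E)%E; last first.
  by rewrite fineK // muleC.
rewrite -nneseriesZl; last first.
  by move=> i _; rewrite lee_fin mulr_ge0 // rker_ge0.
apply: eq_eseriesr => y _.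
have := P_indep_Zk x y (indep_after_hist k h); rewrite -DE => PZ.
transitivity ((f ((y + shift_at k.+1)%N :: h))%:E * ((fine (P D))%:E * (rk x y)%:E))%E.
  by congr (_ * _)%E; rewrite fineK.
by rewrite -!EFinM; congr EFin; ring.
Qed.
End markov.

(** * Limit theorems for the chain *)

Section sums.
Context {R : realType}.

(* Histories list the most recent state first: [psum u n h] adds [u] over the last [n] transitions
   recorded in [h], and [fsum f n h] adds [f] over their starting points. *)
Fixpoint psum (u : nat -> nat -> R) (n : nat) (h : seq nat) : R :=
  if n is n'.+1 then u (head 0%N (behead h)) (head 0%N h) + psum u n' (behead h) else 0.

Fixpoint fsum (f : nat -> R) (n : nat) (h : seq nat) : R :=
  if n is n'.+1 then f (head 0%N (behead h)) + fsum f n' (behead h) else 0.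

Lemma fsum_ge0 f n h : (forall x, 0 <= f x) -> 0 <= fsum f n h.
Proof. by move=> f0; elim: n h => //= n IH h; rewrite addr_ge0. Qed.

Lemma fsumD f g n h : fsum (fun x => f x + g x) n h = fsum f n h + fsum g n h.
Proof. by elim: n h => [|n IH] h /=; rewrite ?addr0 // IH addrACA. Qed.

Lemma fsum_cst c n h : fsum (fun=> c) n h = n%:R * c.
Proof. by elim: n h => [|n IH] h /=; rewrite ?mul0r // IH -[n.+1]addn1 natrD mulrDl mul1r addrC. Qed.

Lemma fsum_norm f n h : `|fsum f n h| <= fsum (fun x => `|f x|) n h.
Proof.
elim: n h => [|n IH] h /=; rewrite ?normr0 //.
by apply: le_trans (ler_normD _ _) _; rewrite lerD2l.
Qed.

(** Evaluating [g] at the end of each transition instead of its start costs two boundary terms. With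
    [q = Q g] the remaining [psum] is a martingale. *)
Lemma fsum_telescope (g q : nat -> R) n h :
  fsum (fun x => g x - q x) n h =
  psum (fun x y => g y - q x) n h + g (head 0%N (iter n behead h)) - g (head 0%N h).
Proof.
elim: n h => [|n IH] h; first by rewrite /= add0r subrr.
rewrite iterSr /= IH; ring.
Qed.

Lemma lee_sum_cst n (x : 'I_n -> \bar R) (c : R) : (forall i, x i <= c%:E)%E ->
  (\sum_(i < n) x i <= (n%:R * c)%:E)%E.
Proof.
move=> xc; apply: (@le_trans _ _ (\sum_(i < n) c%:E)%E); first by apply: lee_sum => i _.
by rewrite sumEFin sumr_const card_ord mulr_natl.
Qed.
End sums.

(** * Truncation in the state, and increments of quadratic growth *)

Section trunc.
Context {R : realType}.
Implicit Types f : nat -> R.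

(** The growth condition under which [Q^j] converges. On a discrete state space bounded functions
    satisfy it too, so a sharp cut-off preserves it. *)
Definition dlip (phi : nat -> R) : Prop :=
  exists2 L : R, 0 <= L & forall x, `|ndiff phi x| <= L * (1 + x%:R ^+ 2).

Definition trunc (K : nat) f (m : nat) : R := if (m <= K)%N then f m else 0.
Definition tail (K : nat) f (m : nat) : R := if (m <= K)%N then 0 else f m.

Lemma trunc_tail K f m : trunc K f m + tail K f m = f m.
Proof. by rewrite /trunc /tail; case: ifP => _; rewrite ?addr0 ?add0r. Qed.

Lemma trunc_ge0 K f : (forall m, 0 <= f m) -> forall m, 0 <= trunc K f m.
Proof. by move=> f0 m; rewrite /trunc; case: ifP. Qed.

Lemma tail_ge0 K f : (forall m, 0 <= f m) -> forall m, 0 <= tail K f m.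
Proof. by move=> f0 m; rewrite /tail; case: ifP. Qed.

Lemma trunc_bounded K f : exists2 G : R, 0 <= G & forall m, `|trunc K f m| <= G.
Proof.
exists (\sum_(i < K.+1) `|f i|) => [|m]; first by apply: sumr_ge0.
rewrite /trunc; case: ifPn => mK; last by rewrite normr0 sumr_ge0.
rewrite -ltnS in mK; rewrite (bigD1 (Ordinal mK)) //= lerDl.
by apply: sumr_ge0.
Qed.

Lemma cubic_trunc K f : cubic (trunc K f).
Proof. by have [G _ hG] := trunc_bounded K f; exact: cubic_bounded hG. Qed.

Lemma cubic_tail K f : cubic f -> cubic (tail K f).
Proof.
move=> cf; rewrite (_ : tail K f = fun m => f m - trunc K f m).
  by apply: cubicB => //; exact: cubic_trunc.
by apply/funext => m; rewrite -(trunc_tail K f m) addrAC subrr add0r.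
Qed.

Lemma dlip_exp k : (k <= 3)%N -> dlip (fun x => x%:R ^+ k : R).
Proof.
move=> k3; exists 7 => // x; rewrite /ndiff -[x.+1]addn1 natrD.
have x0 := ler0n R x; set y := x%:R in x0 *; have y2 : 0 <= y ^+ 2 by exact: sqr_ge0.
have h := sqr_ge0 (y - 1).
case: k k3 => [|[|[|[|//]]]] _; rewrite ?expr0 ?expr1 ?subrr ?normr0.
- lra.
- by rewrite addrC addKr normr1; lra.
- by rewrite (_ : _ - _ = 2 * y + 1) ?ger0_norm; [lra|lra|ring].
- by rewrite (_ : _ - _ = 3 * y ^+ 2 + 3 * y + 1) ?ger0_norm; [lra|lra|ring].
Qed.

Lemma dlipD (f g : nat -> R) : dlip f -> dlip g -> dlip (fun x => f x + g x).
Proof.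
move=> [L1 L10 h1] [L2 L20 h2]; exists (L1 + L2) => [|x]; first exact: addr_ge0.
rewrite /ndiff opprD addrACA mulrDl; apply: le_trans (ler_normD _ _) _.
by apply: lerD; [exact: h1|exact: h2].
Qed.

Lemma dlipZ (a : R) (f : nat -> R) : dlip f -> dlip (fun x => a * f x).
Proof.
move=> [L L0 h]; exists (`|a| * L) => [|x]; first exact: mulr_ge0.
by rewrite /ndiff -mulrBr normrM -mulrA ler_wpM2l //; exact: h.
Qed.

Lemma dlip_bounded (f : nat -> R) (G : R) : (forall x, `|f x| <= G) -> dlip f.
Proof.
move=> fG; have G0 : 0 <= G by apply: le_trans (fG 0%N).
exists (2 * G) => [|x]; first exact: mulr_ge0.
apply: le_trans (ler_normB _ _) _; apply: le_trans (lerD (fG _) (fG _)) _.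
by have : 0 <= G * x%:R ^+ 2; [rewrite mulr_ge0 // exprn_ge0|lra].
Qed.

Lemma dlip_tail K f : dlip f -> dlip (tail K f).
Proof.
have [G _ hG] := trunc_bounded K f; have [L2 L20 h2] := dlip_bounded hG.
move=> [L1 L10 h1]; exists (L1 + L2) => [|x]; first exact: addr_ge0.
rewrite (_ : ndiff (tail K f) x = ndiff f x - ndiff (trunc K f) x); last first.
  by rewrite /ndiff -(trunc_tail K f x) -(trunc_tail K f x.+1); ring.
by apply: le_trans (ler_normB _ _) _; rewrite mulrDl lerD.
Qed.

Lemma sum_geom_le (a : R) n : 0 <= a -> a < 1 -> \sum_(i < n) a ^+ i <= (1 - a)^-1.
Proof.
move=> a0 a1; have q0 : 0 < 1 - a by rewrite subr_gt0.
rewrite -(ler_pM2l q0) divff ?gt_eqF //.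
have := subrX1 a n; set s := \sum_(i < n) _ => E.
have an : 0 <= a ^+ n by exact: exprn_ge0.
by lra.
Qed.
End trunc.

(** * Limit theorems for a homogeneous chain restricted to an event *)

Section chain.
Context {d : measure_display} {T : measurableType d} {R : realType}.
Variables (P : probability T R) (alpha : R) (e : T -> nat) (p : nat -> R).
Hypothesis alpha01 : 0 < alpha < 1.
Hypothesis me : nat_rv e.
Hypothesis e3 : (\int[P]_w (((e w)%:R : R) ^+ 3)%:E < +oo)%E.
Hypothesis p0 : forall m, 0 <= p m.
Hypothesis p1 : (\sum_(m <oo) (p m)%:E = 1)%E.
Hypothesis pQ : forall y, (\sum_(x <oo) (p x * rker P alpha e x y)%:E)%E = (p y)%:E.
Local Notation Q := (Qop P alpha e).
Local Notation pirp := (pir p).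

Variables (A : set T) (H : nat -> T -> seq nat) (B0 : R).
Hypothesis mA : measurable A.
Hypothesis mH : forall j h, measurable [set w | H j w = h].
Hypothesis Hbehead : forall j w, behead (H j.+1 w) = H j w.
Hypothesis Hstep : forall j (f : seq nat -> R), (forall h, 0 <= f h) ->
  (forall h, cubic (fun y => f (y :: h))) ->
  (\int[P]_(w in A) (f (H j.+1 w))%:E =
   \int[P]_(w in A) (Q (fun y => f (y :: H j w)) (head 0%N (H j w)))%:E)%E.
Hypothesis HB0 : (\int[P]_(w in A) (1 + (head 0%N (H 0 w))%:R ^+ 3)%:E <= B0%:E)%E.

Implicit Types f g : seq nat -> R.
Let a0 : 0 <= alpha. Proof. by have /andP[/ltW] := alpha01. Qed.
Let ai j : 0 <= alpha ^+ j. Proof. exact: exprn_ge0. Qed.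

(** Not divided by [P A], and extended-real valued: for nonnegative integrands, monotonicity and
    additivity then need no integrability conditions. *)
Definition EA (j : nat) f : \bar R := (\int[P]_(w in A) (f (H j w))%:E)%E.

Lemma EA_measurable j f : measurable_fun A (fun w => (f (H j w))%:E).
Proof. by apply/measurable_EFinP; exact: discrete_measurable_fun. Qed.

Lemma EA_le j f g : (forall h, 0 <= f h) -> (forall h, f h <= g h) -> (EA j f <= EA j g)%E.
Proof.
move=> f0 fg; apply: ge0_le_integral => //; do ?[exact: EA_measurable].
- by move=> w _; rewrite lee_fin.
- by move=> w _; rewrite lee_fin.
Qed.

Lemma EAD j f g : (forall h, 0 <= f h) -> (forall h, 0 <= g h) ->
  EA j (fun h => (f h + g h)%R) = (EA j f + EA j g)%E.
Proof.
move=> f0 g0; rewrite /EA -ge0_integralD //; do ?[exact: EA_measurable]; try by move=> w _; rewrite lee_fin.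
Qed.

Lemma EAZ j (a : R) f : 0 <= a -> (forall h, 0 <= f h) ->
  EA j (fun h => (a * f h)%R) = (a%:E * EA j f)%E.
Proof.
move=> a00 f0; rewrite /EA -ge0_integralZl_EFin //; [by move=> w _; rewrite lee_fin|exact: EA_measurable].
Qed.

Lemma PA_fin : P A = (fine (P A))%:E.
Proof. by rewrite fineK // fin_num_measure. Qed.

Lemma PA_le1 : fine (P A) <= 1.
Proof. by rewrite -lee_fin -PA_fin; exact: probability_le1. Qed.

Lemma EA_cst j (c : R) : EA j (fun=> c) = (c * fine (P A))%:E.
Proof. by rewrite /EA integral_cst // EFinM -PA_fin. Qed.

Lemma EA_cst_le j (c : R) : 0 <= c -> (EA j (fun=> c) <= c%:E)%E.
Proof. by move=> c0; rewrite EA_cst lee_fin ler_piMr // PA_le1. Qed.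

Lemma EA_behead j f : EA j.+1 (fun h => f (behead h)) = EA j f.
Proof. by apply: eq_integral => w _; rewrite Hbehead. Qed.

Lemma EA_step j f : (forall h, 0 <= f h) -> (forall h, cubic (fun y => f (y :: h))) ->
  EA j.+1 f = EA j (fun h => Q (fun y => f (y :: h)) (head 0%N h)).
Proof. exact: Hstep. Qed.

Lemma EA_head_iter j (phi : nat -> R) : cubic phi -> (forall x, 0 <= phi x) ->
  EA j (fun h => phi (head 0%N h)) = EA 0 (fun h => iter j Q phi (head 0%N h)).
Proof.
elim: j phi => // j IH phi cphi phi0.
apply: etrans (@EA_step j (fun h => phi (head 0%N h)) (fun h => phi0 _) (fun=> cphi)) _ => /=.
rewrite (IH (Q phi)); [|exact: cubic_Q|by move=> x; exact: Q_ge0].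
by rewrite -/(iter j.+1 Q phi) iterSr.
Qed.

Lemma EA_moment3 : exists2 M : R, 0 <= M & forall j, (EA j (fun h => (1 + (head 0%N h)%:R ^+ 3)%R) <= M%:E)%E.
Proof.
have [K K0 hK] := Qiter_moment alpha01 me e3 (or_intror erefl).
have B00 : 0 <= B0.
  rewrite -lee_fin; apply: le_trans HB0; apply: integral_ge0 => w _.
  by rewrite lee_fin addr_ge0 // exprn_ge0.
have pos (x : nat) : 0 <= 1 + x%:R ^+ 3 :> R by rewrite addr_ge0 // exprn_ge0.
exists (K * B0) => [|j]; first exact: mulr_ge0.
rewrite (@EA_head_iter j (fun y => 1 + y%:R ^+ 3)) //; last first.
  by apply: cubicD; [exact: cubic_cst|exact: cubic_exp].
apply: (@le_trans _ _ (EA 0 (fun h => (K * (1 + (head 0%N h)%:R ^+ 3))%R))).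
  apply: EA_le => // h; elim: j (head 0%N h) {hK} => // j IH x; apply: Q_ge0 => //.
  by apply: cubic_Qiter => //; apply: cubicD; [exact: cubic_cst|exact: cubic_exp].
rewrite EAZ // EFinM; apply: lee_wpmul2l; rewrite ?lee_fin //; exact: HB0.
Qed.

Lemma EA_ergodic (phi : nat -> R) : cubic phi -> (forall x, 0 <= phi x) -> dlip phi ->
  exists2 C : R, 0 <= C &
    (forall j, (EA j (fun h => phi (head 0%N h)) <= (pirp phi + alpha ^+ j * C)%:E)%E) /\
    (forall N j, (EA j (fun h => (`|iter N Q phi (head 0%N h) - pirp phi|)%R) <= (alpha ^+ N * C)%:E)%E).
Proof.
move=> cphi phi0 [L L0 dphi].
have [K K0 hK] := ergodic alpha01 me e3 p0 p1 pQ cphi phi0 L0 dphi.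
have [M M0 hM] := EA_moment3.
have pos (x : nat) : 0 <= 1 + x%:R ^+ 3 :> R by rewrite addr_ge0 // exprn_ge0.
have part2 N j : (EA j (fun h => (`|iter N Q phi (head 0%N h) - pirp phi|)%R) <= (alpha ^+ N * (K * M))%:E)%E.
  apply: (@le_trans _ _ (EA j (fun h => ((alpha ^+ N * K) * (1 + (head 0%N h)%:R ^+ 3))%R))).
    exact: EA_le.
  rewrite EAZ ?mulr_ge0 // [in leRHS]mulrA [leRHS]EFinM; apply: lee_wpmul2l; rewrite ?lee_fin ?mulr_ge0 //.
exists (K * M); first exact: mulr_ge0.
split=> // j.
rewrite EA_head_iter // EFinD.
apply: (@le_trans _ _ (EA 0 (fun h => (pirp phi + `|iter j Q phi (head 0%N h) - pirp phi|)%R))).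
  apply: EA_le => h; last by rewrite -lerBlDl ler_norm.
  elim: j (head 0%N h) => // j IH x; apply: Q_ge0 => //; exact: cubic_Qiter.
rewrite EAD //; last by move=> _; exact: pir_ge0.
by apply: leeD; [apply: EA_cst_le; exact: pir_ge0|exact: part2].
Qed.

Lemma EA_fsum n (phi : nat -> R) : (forall x, 0 <= phi x) ->
  EA n (fsum phi n) = (\sum_(i < n) EA i (fun h => phi (head 0%N h)))%E.
Proof.
move=> phi0; elim: n => [|n IH].
  by rewrite big_ord0 /= EA_cst mul0r.
rewrite big_ord_recr /= -IH addeC -EAD //; last by move=> h; exact: fsum_ge0.
exact: (EA_behead n (fun h => phi (head 0%N h) + fsum phi n h)).
Qed.

(** Martingale increments are orthogonal: given the past [S], the cross term [2 * S * u] has mean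
    zero under [Q]. *)
Lemma EA_psum_sqr (u : nat -> nat -> R) n :
  (forall x, cubic (u x)) -> (forall x, cubic (fun y => u x y ^+ 2)) ->
  (forall x, Q (u x) x = 0) ->
  EA n (fun h => (psum u n h ^+ 2)%R) =
  (\sum_(i < n) EA i (fun h => (Q (fun y => u (head 0%N h) y ^+ 2) (head 0%N h))%R))%E.
Proof.
move=> cu cu2 Qu0; elim: n => [|n IH].
  by rewrite big_ord0 /= EA_cst expr0n /= mul0r.
rewrite big_ord_recr /= -IH EA_step.
- rewrite -EAD; [|by move=> h; exact: sqr_ge0|by move=> h; apply: Q_ge0 => // y; exact: sqr_ge0].
  congr EA; apply/funext => h /=; set x := head 0%N h; set S := psum u n h.
  rewrite (_ : (fun y => _) = fun y => (2 * S * u x y + u x y ^+ 2) + S ^+ 2).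
    rewrite QD //; [|by apply: cubicD => //; exact: cubicZ|exact: cubic_cst].
    rewrite QD //; last exact: cubicZ.
    by rewrite Q_cst QZ // Qu0; ring.
  by apply/funext => y; ring.
- by move=> h; exact: sqr_ge0.
- move=> h /=; set x := head 0%N h; set S := psum u n h.
  rewrite (_ : (fun y => _) = fun y => (2 * S * u x y + u x y ^+ 2) + S ^+ 2).
    apply: cubicD; last exact: cubic_cst.
    by apply: cubicD => //; exact: cubicZ.
  by apply/funext => y; ring.
Qed.

(* [poisson N phi] solves [g - Q g = phi - Q^N phi], an approximate Poisson equation. *)
Definition poisson (N : nat) (phi : nat -> R) (x : nat) : R := \sum_(i < N) iter i Q phi x.

Lemma poisson_bounded N (phi : nat -> R) (G : R) x : (forall x, `|phi x| <= G) ->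
  `|poisson N phi x| <= N%:R * G.
Proof.
move=> phiG; apply: le_trans (ler_norm_sum _ _ _) _.
apply: (@le_trans _ _ (\sum_(i < N) G)); last by rewrite sumr_const card_ord mulr_natl.
by apply: ler_sum => i _; exact: Qiter_bounded.
Qed.

Lemma poissonE N (phi : nat -> R) (G : R) x : (forall x, `|phi x| <= G) ->
  poisson N phi x - Q (poisson N phi) x = phi x - iter N Q phi x.
Proof.
move=> phiG; elim: N => [|N IH].
  rewrite /poisson big_ord0 (_ : (fun x => _) = fun=> 0) ?Q_cst ?subrr //.
  by apply/funext => y; rewrite big_ord0.
have cp : cubic (poisson N phi) by apply: (@cubic_bounded _ _ (N%:R * G)) => y; exact: poisson_bounded.
have ci : cubic (iter N Q phi) by apply: (@cubic_bounded _ _ G) => y; exact: Qiter_bounded.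
have -> : poisson N.+1 phi = fun y => poisson N phi y + iter N Q phi y.
  by apply/funext => y; rewrite /poisson big_ord_recr.
rewrite QD // opprD addrACA IH -/(iter N.+1 Q phi) /=; ring.
Qed.

(** The approximate Poisson equation splits the centred sum into a martingale of order [sqrt n],
    bounded boundary terms, and a rest whose mean per step is small once [N] is large. *)
Lemma LLN_bounded (phi : nat -> R) (G : R) : (forall x, 0 <= phi x) -> (forall x, `|phi x| <= G) ->
  forall eps, 0 < eps -> exists2 C : R, 0 <= C & forall n,
  (EA n (fun h => (`|fsum phi n h - n%:R * pirp phi|)%R) <= (C * (1 + Num.sqrt n%:R) + eps * n%:R)%:E)%E.
Proof.
move=> phi0 phiG eps eps0.
have G0 : 0 <= G by apply: le_trans (phiG 0%N).
have cphi : cubic phi by exact: (cubic_bounded phiG).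
have dphi : dlip phi.
  exists (2 * G) => [|x]; first exact: mulr_ge0.
  apply: le_trans (ler_normB _ _) _; apply: le_trans (lerD (phiG _) (phiG _)) _.
  by have : 0 <= G * x%:R ^+ 2; [rewrite mulr_ge0 // exprn_ge0|lra].
have [C C0 [_ hC]] := EA_ergodic cphi phi0 dphi.
have [N hN] : exists N, alpha ^+ N * C <= eps.
  have /andP[al0 al1] := alpha01.
  have an : `|alpha| < 1 by rewrite gtr0_norm.
  have := @cvg_expr _ _ an => /cvgr0_norm_le.
  have e0 : 0 < eps / (C + 1) by rewrite divr_gt0 // ltr_wpDl.
  move=> /(_ _ e0)[N _ /(_ N (leqnn N))]; rewrite ger0_norm ?exprn_ge0 // => hN.
  exists N; apply: (@le_trans _ _ (alpha ^+ N * (C + 1))); first by rewrite ler_wpM2l // lerDl.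
  by rewrite -ler_pdivlMr // ltr_wpDl.
pose g := poisson N phi; pose G' := N%:R * G.
have gG x : `|g x| <= G' by exact: poisson_bounded.
have G'0 : 0 <= G' by rewrite mulr_ge0.
have cg : cubic g by exact: (cubic_bounded gG).
pose u x y := g y - Q g x.
have uG x y : `|u x y| <= 2 * G'.
  by apply: le_trans (ler_normB _ _) _; rewrite [2 * _]mulr_natl mulr2n lerD // Q_bounded.
have cu x : cubic (u x) by exact: (cubic_bounded (uG x)).
have u2G x y : `|u x y ^+ 2| <= (2 * G') ^+ 2.
  by rewrite normrX lerXn2r ?nnegrE // mulr_ge0.
have cu2 x : cubic (fun y => u x y ^+ 2) by exact: (cubic_bounded (u2G x)).
have Qu x : Q (u x) x = 0 by rewrite QB // ?Q_cst ?subrr //; exact: cubic_cst.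
exists (2 * G' + (1 + (2 * G') ^+ 2)) => [|n]; first by rewrite !addr_ge0 ?mulr_ge0 // sqr_ge0.
have [->|n0] := eqVneq n 0%N.
  rewrite (_ : (fun h => _) = fun=> 0) ?EA_cst ?mul0r; last first.
    by apply/funext => h /=; rewrite subrr normr0.
  by rewrite lee_fin mulr0 addr0 sqrtr0 addr0 mulr1 !addr_ge0 ?mulr_ge0 // sqr_ge0.
pose r : R := Num.sqrt n%:R.
have n0R : 0 < n%:R :> R by rewrite ltr0n lt0n.
have r0 : 0 < r by rewrite sqrtr_gt0.
have rr : r * r = n%:R by rewrite -expr2 sqr_sqrtr // ltW.
have Epsi : (EA n (fun h => (psum u n h ^+ 2)%R) <= (n%:R * (2 * G') ^+ 2)%:E)%E.
  rewrite EA_psum_sqr //; apply: lee_sum_cst => i; apply: le_trans (EA_cst_le i (sqr_ge0 _)).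
  apply: EA_le => h; first by apply: Q_ge0 => // y; exact: sqr_ge0.
  by apply: le_trans (ler_norm _) _; exact: Q_bounded.
pose psi x := `|iter N Q phi x - pirp phi|.
have Epsum : (EA n (fsum psi n) <= (eps * n%:R)%:E)%E.
  rewrite EA_fsum; last by move=> x; exact: normr_ge0.
  rewrite [eps * _]mulrC; apply: lee_sum_cst => i.
  by apply: le_trans (hC N i) _; rewrite lee_fin.
(* The bound [|q| <= r + q^2 / r] with [r = sqrt n] replaces the Cauchy-Schwarz inequality. *)
apply: (@le_trans _ _ (EA n (fun h => ((r + r^-1 * psum u n h ^+ 2) + (2 * G' + fsum psi n h))%R))).
  apply: EA_le => // h.
  have -> : fsum phi n h - n%:R * pirp phi =
     psum u n h + (g (head 0%N (iter n behead h)) - g (head 0%N h)) + fsum (fun x => iter N Q phi x - pirp phi) n h.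
    have E1 := fsum_telescope g (Q g) n h.
    have -> : fsum phi n h = fsum (fun x => g x - Q g x) n h
        + fsum (fun x => iter N Q phi x - pirp phi) n h + n%:R * pirp phi.
      rewrite -(fsum_cst (pirp phi) n h) -!fsumD; congr fsum; apply/funext => x.
      by rewrite addrA subrK (poissonE N x phiG) subrK.
    by rewrite E1 /u; ring.
  apply: le_trans (ler_normD _ _) _; rewrite [leRHS]addrA; apply: lerD; last exact: fsum_norm.
  apply: le_trans (ler_normD _ _) _; apply: lerD; last first.
    by apply: le_trans (ler_normB _ _) _; rewrite [2 * _]mulr_natl mulr2n lerD.
  set q := psum u n h; rewrite -(ler_pM2l r0) mulrDr mulrA divff ?gt_eqF // mul1r.
  have : 0 <= (r - `|q|) ^+ 2 by exact: sqr_ge0.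
  have := real_normK (num_real q); nra.
have r0' : 0 <= r := ltW r0.
have nn1 h : 0 <= fsum psi n h by apply: fsum_ge0 => x; exact: normr_ge0.
have nn2 h : 0 <= r^-1 * psum u n h ^+ 2 by rewrite mulr_ge0 ?sqr_ge0 // invr_ge0.
have nn3 h : 0 <= r + r^-1 * psum u n h ^+ 2 by rewrite addr_ge0.
have nn4 : 0 <= 2 * G' by rewrite mulr_ge0.
have nn5 h : 0 <= 2 * G' + fsum psi n h by rewrite addr_ge0.
rewrite !EAD //.
have -> : EA n (fun h => (r^-1 * psum u n h ^+ 2)%R) = (r^-1%:E * EA n (fun h => (psum u n h ^+ 2)%R))%E.
  by apply: EAZ => [|h]; [rewrite invr_ge0|exact: sqr_ge0].
apply: (@le_trans _ _ ((r%:E + (r^-1)%:E * (n%:R * (2 * G') ^+ 2)%:E) + ((2 * G')%:E + (eps * n%:R)%:E))%E).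
  apply: leeD; apply: leeD => //.
  - by apply: EA_cst_le; exact: ltW.
  - by apply: lee_wpmul2l => //; rewrite lee_fin invr_ge0 ltW.
  - by apply: EA_cst_le; exact: mulr_ge0.
rewrite -EFinM -!EFinD lee_fin -/r -rr.
have -> : r^-1 * (r * r * (2 * G') ^+ 2) = r * (2 * G') ^+ 2 by field; rewrite gt_eqF.
have : 0 <= r * G' by rewrite mulr_ge0 // ltW.
have : 0 <= (2 * G') ^+ 2 by exact: sqr_ge0.
by lra.
Qed.

Lemma pir_trunc_tail K (phi : nat -> R) : cubic phi -> (forall x, 0 <= phi x) ->
  pirp (trunc K phi) + pirp (tail K phi) = pirp phi.
Proof.
move=> cphi phi0.
rewrite -(pirD alpha01 me e3 p0 p1 pQ); [|exact: cubic_trunc|exact: cubic_tail|exact: trunc_ge0|exact: tail_ge0].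
by congr (pir p _); apply/funext => m; rewrite trunc_tail.
Qed.

Lemma EA_fsum_le (phi : nat -> R) : cubic phi -> (forall x, 0 <= phi x) -> dlip phi ->
  exists2 C : R, 0 <= C & forall n,
    (\sum_(i < n) EA i (fun h => phi (head 0%N h)) <= (n%:R * pirp phi + C)%:E)%E.
Proof.
move=> cphi phi0 dphi.
have [C C0 [hC _]] := EA_ergodic cphi phi0 dphi.
have /andP[al0 al1] := alpha01.
exists (C / (1 - alpha)) => [|n]; first by rewrite divr_ge0 // subr_ge0 ltW.
apply: (@le_trans _ _ (\sum_(i < n) (pirp phi + alpha ^+ i * C)%:E)%E).
  by apply: lee_sum => i _.
rewrite sumEFin lee_fin big_split /= sumr_const card_ord mulr_natl lerD2l.
by rewrite -mulr_suml mulrC ler_wpM2l // sum_geom_le // ltW.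
Qed.

Lemma LLN (phi : nat -> R) : cubic phi -> (forall x, 0 <= phi x) -> dlip phi ->
  forall eps, 0 < eps -> exists2 C : R, 0 <= C & forall n,
  (EA n (fun h => (`|fsum phi n h - n%:R * pirp phi|)%R) <= (C * (1 + Num.sqrt n%:R) + eps * n%:R)%:E)%E.
Proof.
move=> cphi phi0 dphi eps eps0.
(* One third for the truncated part and two for the tail, which enters through its sum and through
   its stationary mean. *)
have e30 : 0 < eps / 3 by rewrite divr_gt0.
have [K hK] := pir_tail alpha01 me e3 p0 p1 pQ cphi phi0 e30.
have {}hK := hK K (leqnn K); rewrite -/(tail K phi) in hK.
have [G G0 hG] := trunc_bounded K phi.
have [C1 C10 h1] := LLN_bounded (trunc_ge0 K phi0) hG e30.
have [C2 C20 h2] := EA_fsum_le (cubic_tail K cphi) (tail_ge0 K phi0) (dlip_tail K dphi).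
have t0 := tail_ge0 K phi0.
have pt0 : 0 <= pirp (tail K phi) by exact: pir_ge0.
exists (C1 + C2) => [|n]; first exact: addr_ge0.
have f0 h : 0 <= fsum (tail K phi) n h by exact: fsum_ge0.
have c0 : 0 <= n%:R * pirp (tail K phi) by rewrite mulr_ge0.
apply: (@le_trans _ _ (EA n (fun h => (`|fsum (trunc K phi) n h - n%:R * pirp (trunc K phi)|
   + (fsum (tail K phi) n h + n%:R * pirp (tail K phi)))%R))).
  apply: EA_le => // h; rewrite -(pir_trunc_tail K cphi phi0).
  have -> : fsum phi n h = fsum (trunc K phi) n h + fsum (tail K phi) n h.
    by rewrite -fsumD; congr fsum; apply/funext => m; rewrite trunc_tail.
  set a := fsum _ n h; set b := fsum _ n h.
  rewrite (_ : _ - _ = (a - n%:R * pirp (trunc K phi)) + (b - n%:R * pirp (tail K phi))); last by ring.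
  apply: le_trans (ler_normD _ _) _; rewrite lerD2l; apply: le_trans (ler_normB _ _) _.
  by rewrite !ger0_norm // /b.
rewrite !EAD //; last by move=> h; exact: addr_ge0.
rewrite EA_fsum //.
apply: (@le_trans _ _ ((C1 * (1 + Num.sqrt n%:R) + eps / 3 * n%:R)%:E
    + ((n%:R * pirp (tail K phi) + C2)%:E + (n%:R * pirp (tail K phi))%:E))%E).
  by apply: leeD => //; apply: leeD => //; exact: EA_cst_le.
rewrite -!EFinD lee_fin.
have : n%:R * pirp (tail K phi) <= n%:R * (eps / 3) by rewrite ler_wpM2l.
have : 0 <= C2 * Num.sqrt n%:R by rewrite mulr_ge0 // sqrtr_ge0.
by lra.
Qed.

(** * Lindeberg replacement *)

Section clt.
Variables (F F1 F2 : R -> R -> R) (CF : R).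
Hypothesis hF : heat_estimates F F1 F2 CF.
Hypothesis F01 : forall x t, 0 <= F x t <= 1.
Hypothesis CF0 : 0 <= CF.
Variables (u : nat -> nat -> R) (q : nat -> R) (C3 G v : R).
Hypothesis cu : forall x, cubic (u x).
Hypothesis cu2 : forall x, cubic (fun y => u x y ^+ 2).
Hypothesis cu3 : forall x, cubic (fun y => `|u x y| ^+ 3).
Hypothesis Qu : forall x, Q (u x) x = 0.
Hypothesis Qu2 : forall x, Q (fun y => u x y ^+ 2) x = q x.
Hypothesis Qu3 : forall x, Q (fun y => `|u x y| ^+ 3) x <= C3.
Hypothesis C30 : 0 <= C3.
Hypothesis v0 : 0 <= v.

(* The corrector [F2 * g * b^2 / 2] replaces the conditional variance [q x] by [qN x = Q^N q x],
   which ergodicity makes close to [v]. *)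
Lemma clt_step (g qN : nat -> R) (Gg b t t' : R) (x : nat) (S k : R) :
  cubic g -> (forall y, `|g y| <= Gg) -> 0 <= Gg -> q x + Q g x = qN x + g x ->
  0 <= b -> b <= 1 -> 0 <= t -> 0 <= t' -> t' = t - v * b ^+ 2 ->
  Q (fun y => F (b * (u x y + S)) t' + F2 (b * (u x y + S)) t' * g y * b ^+ 2 / 2 + k) x <=
  F (b * S) t + F2 (b * S) t * g x * b ^+ 2 / 2 + k
  + (CF * b ^+ 2 / 2 * `|qN x - v|
     + (CF * v ^+ 2 + CF * Gg / 2 + (CF + CF * Gg / 2) * C3 + CF * v * Gg / 2) * b ^+ 3).
Proof.
move=> cg gG Gg0 qE b0 b1 t0 t'0 tE; have [h1 h2 h3 h4 h5] := hF.
set s := b * S; set D1 := F1 s t'; set D2 := F2 s t'.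
have b2 : 0 <= b ^+ 2 by exact: sqr_ge0.
have b3 : 0 <= b ^+ 3 by exact: exprn_ge0.
have b43 : b ^+ 4 <= b ^+ 3 by rewrite exprS ler_piMl.
pose c0 := F s t + CF * (v * b ^+ 2) ^+ 2 - v * b ^+ 2 / 2 * D2 + k + CF * Gg * b ^+ 3 / 2.
pose c4 := CF * b ^+ 3 + CF * Gg * b ^+ 3 / 2.
(* A majorant with explicit image under [Q]: its linear term vanishes, the quadratic term gives
   [q x], the corrector gives [Q g x], and the cubic term is an error. *)
pose M y := c0 + (b * D1 * u x y + (b ^+ 2 / 2 * D2 * u x y ^+ 2 + (b ^+ 2 / 2 * D2 * g y + c4 * `|u x y| ^+ 3))).
have cM1 := cubicD (cubicZ (b ^+ 2 / 2 * D2) cg) (cubicZ c4 (cu3 x)).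
have cM2 := cubicD (cubicZ (b ^+ 2 / 2 * D2) (cu2 x)) cM1.
have cM3 := cubicD (cubicZ (b * D1) (cu x)) cM2.
have cM : cubic M by apply: cubicD => //; exact: cubic_cst.
have QM : Q M x = c0 + (b ^+ 2 / 2 * D2 * q x + (b ^+ 2 / 2 * D2 * Q g x + c4 * Q (fun y => `|u x y| ^+ 3) x)).
  rewrite /M QD //; last exact: cubic_cst.
  rewrite Q_cst QD //; last exact: cubicZ.
  rewrite QZ // Qu mulr0 add0r QD //; last exact: cubicZ.
  by rewrite QZ // Qu2 QD ?QZ //; exact: cubicZ.
have D2C : `|D2| <= CF by exact: h3.
have pt y : F (b * (u x y + S)) t' + F2 (b * (u x y + S)) t' * g y * b ^+ 2 / 2 + k <= M y.
  set z := b * u x y; have -> : b * (u x y + S) = s + z by rewrite mulrDr addrC.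
  have hz3 : `|z| ^+ 3 = b ^+ 3 * `|u x y| ^+ 3 by rewrite /z normrM exprMn (ger0_norm b0).
  (* The corrector's error is linear in the increment; the majorant has a cubic term only, so the
     linear bound is traded for 1 plus a cube. *)
  have hz1 : `|z| <= b * (1 + `|u x y| ^+ 3).
    rewrite /z normrM (ger0_norm b0) ler_wpM2l //.
    have [l1|/ltW l1] := leP `|u x y| 1; first by rewrite (le_trans l1) // lerDl exprn_ge0.
    apply: (@le_trans _ _ (`|u x y| ^+ 3)); last by rewrite lerDr.
    by rewrite exprS ler_peMr // exprn_ege1.
  have hA : F (s + z) t' <= F s t' + z * D1 + z ^+ 2 / 2 * D2 + CF * `|z| ^+ 3.
    by have /(le_trans (ler_norm _)) := h1 s z t' t'0; rewrite -/D1 -/D2; lra.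
  have hB : F s t' <= F s t - v * b ^+ 2 / 2 * D2 + CF * (v * b ^+ 2) ^+ 2.
    have := h2 s t' t t'0 t0; rewrite -/D2 (_ : t - t' = v * b ^+ 2); last by rewrite tE; ring.
    by rewrite ler_norml => /andP[]; lra.
  have hC : F2 (s + z) t' * g y <= D2 * g y + CF * `|z| * Gg.
    rewrite -lerBlDl -mulrBl; apply: le_trans (ler_norm _) _; rewrite normrM.
    by rewrite ler_pM // h4.
  have hC' : F2 (s + z) t' * g y * b ^+ 2 / 2 <= D2 * g y * b ^+ 2 / 2 + CF * Gg * b ^+ 3 / 2 * (1 + `|u x y| ^+ 3).
    have : F2 (s + z) t' * g y <= D2 * g y + CF * Gg * (b * (1 + `|u x y| ^+ 3)).
      apply: le_trans hC _; rewrite lerD2l mulrAC ler_wpM2l // mulr_ge0 //.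
    by move=> /(ler_wpM2l b2); lra.
  rewrite /M /c0 /c4; move: hA hB hC'; rewrite hz3 /z; lra.
apply: (@le_trans _ _ (Q M x)).
  apply: Q_le => //; apply: (@cubic_bounded _ _ (1 + CF * Gg * b ^+ 2 / 2 + `|k|)) => y.
  apply: le_trans (ler_normD _ _) _; rewrite lerD2r; apply: le_trans (ler_normD _ _) _.
  apply: lerD; first by have /andP[f0 f1] := F01 (b * (u x y + S)) t'; rewrite ger0_norm.
  have hb : 0 <= b ^+ 2 / 2 by rewrite divr_ge0.
  rewrite -[X in `|X| <= _]mulrA -[leRHS]mulrA normrM (ger0_norm hb) ler_wpM2r //.
  by rewrite normrM ler_pM // h3.
rewrite QM.
have e1 : D2 * (q x + Q g x - v) <= D2 * g x + CF * `|qN x - v|.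
  rewrite qE (_ : D2 * _ = D2 * g x + D2 * (qN x - v)); last by ring.
  by rewrite lerD2l; apply: le_trans (ler_norm _) _; rewrite normrM ler_wpM2r.
have e2 : D2 * g x <= F2 s t * g x + CF * (v * b ^+ 2) * Gg.
  rewrite -lerBlDl -mulrBl; apply: le_trans (ler_norm _) _; rewrite normrM ler_pM //.
  apply: le_trans (h5 s t t' t0 t'0) _; rewrite ler_wpM2l // tE.
  by rewrite (_ : t - _ - t = - (v * b ^+ 2)) ?normrN ?ger0_norm //; [rewrite mulr_ge0|ring].
have c40 : 0 <= c4 by rewrite addr_ge0 // ?mulr_ge0.
have e3' : c4 * Q (fun y => `|u x y| ^+ 3) x <= c4 * C3 by rewrite ler_wpM2l.
have e4 : CF * v ^+ 2 * b ^+ 4 <= CF * v ^+ 2 * b ^+ 3 by rewrite ler_wpM2l // mulr_ge0 // sqr_ge0.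
have e5 : CF * v * Gg * b ^+ 4 <= CF * v * Gg * b ^+ 3 by rewrite ler_wpM2l // !mulr_ge0.
have e6 := ler_wpM2l b2 e1; have e7 := ler_wpM2l b2 e2.
rewrite /c0; move: e3' e4 e5 e6 e7; rewrite /c4; lra.
Qed.

Hypothesis q0 : forall x, 0 <= q x.
Hypothesis qG : forall x, `|q x| <= G.

(** The normalisation [r] is separate from the number [n] of increments, because the estimator is
    scaled by the total time [s + N] while only [N] transitions follow the outlier. *)
Lemma chain_clt (eps : R) : 0 < eps -> exists2 C : R, 0 <= C &
  forall (n : nat) (r : R), 1 <= r -> n%:R <= r ->
  (EA n (fun h => F ((Num.sqrt r)^-1 * psum u n h)%R 0%R) <=
   (fine (P A) * F 0 (v * n%:R / r) + CF * `|pirp q - v| + eps + C / Num.sqrt r)%:E)%E.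
Proof.
move=> eps0; have [h1 h2 h3 h4 h5] := hF; have /andP[al0 al1] := alpha01.
have G0 : 0 <= G by apply: le_trans (qG 0%N).
have cq : cubic q by exact: cubic_bounded qG.
have [Ce Ce0 [_ hCe]] := EA_ergodic cq q0 (dlip_bounded qG).
have [N hN] : exists N, CF * (alpha ^+ N * Ce) <= eps.
  have an : `|alpha| < 1 by rewrite gtr0_norm.
  have := @cvg_expr _ _ an => /cvgr0_norm_le.
  have d0 : 0 < CF * Ce + 1 by rewrite ltr_wpDl // mulr_ge0.
  have e0 : 0 < eps / (CF * Ce + 1) by rewrite divr_gt0.
  move=> /(_ _ e0)[N _ /(_ N (leqnn N))]; rewrite ger0_norm ?exprn_ge0 ?(ltW al0) // => hN.
  exists N; apply: (@le_trans _ _ (alpha ^+ N * (CF * Ce + 1))).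
    by have := exprn_ge0 N (ltW al0); lra.
  by rewrite -ler_pdivlMr.
pose g := poisson N q; pose Gg := N%:R * G.
have gG x : `|g x| <= Gg by exact: poisson_bounded.
have Gg0 : 0 <= Gg by rewrite mulr_ge0.
have cg : cubic g by exact: cubic_bounded gG.
have qE x : q x + Q g x = iter N Q q x + g x.
  by have := poissonE N x qG; rewrite -/g; lra.
pose C2 := CF * v ^+ 2 + CF * Gg / 2 + (CF + CF * Gg / 2) * C3 + CF * v * Gg / 2.
have C20 : 0 <= C2.
  have i2 : 0 <= 2^-1 :> R by [].
  by rewrite /C2 !addr_ge0 ?mulr_ge0 ?addr_ge0 ?mulr_ge0 ?sqr_ge0.
exists (CF * Gg + C2) => [|n r r1 nr]; first by rewrite addr_ge0 // mulr_ge0.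
have r0 : 0 < r by apply: lt_le_trans r1.
have sr1 : 1 <= Num.sqrt r by rewrite -(sqrtr1 R) ler_wsqrtr.
have sr0 : 0 < Num.sqrt r by apply: lt_le_trans sr1.
set b := (Num.sqrt r)^-1.
have b0 : 0 <= b by rewrite invr_ge0 ltW.
have b1 : b <= 1 by rewrite invf_le1.
have b2 : 0 <= b ^+ 2 by exact: sqr_ge0.
have b3 : 0 <= b ^+ 3 by exact: exprn_ge0.
have bb : b ^+ 2 = r^-1 by rewrite /b exprVn sqr_sqrtr // ltW.
have nb : n%:R * b ^+ 2 <= 1 by rewrite bb ler_pdivrMr // mul1r.
(* Variance still to be spent after [i] steps: all of it at the start, none at time [n], where [F]
   is left with its smoothing alone. *)
pose tt (i : nat) : R := v * b ^+ 2 * (n%:R - i%:R).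
have tt0 i : (i <= n)%N -> 0 <= tt i by move=> ilen; apply: mulr_ge0; [exact: mulr_ge0|rewrite subr_ge0 ler_nat].
(* Bounds the corrector; adding it keeps [W] nonnegative, as the one-step identity requires. *)
pose k := CF * Gg * b ^+ 2 / 2.
have k0 : 0 <= k by apply: divr_ge0 => //; apply: mulr_ge0 => //; exact: mulr_ge0.
have Fk x s t : 0 <= t -> `|F2 s t * g x * b ^+ 2 / 2| <= k.
  move=> t0; have hb : 0 <= b ^+ 2 / 2 by rewrite divr_ge0.
  rewrite /k -[X in `|X| <= _]mulrA -[leRHS]mulrA normrM (ger0_norm hb) ler_wpM2r //.
  by rewrite normrM ler_pM // h3.
pose W i h := F (b * psum u i h) (tt i) + F2 (b * psum u i h) (tt i) * g (head 0%N h) * b ^+ 2 / 2 + k.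
have W0 i h : (i <= n)%N -> 0 <= W i h.
  move=> ilen; have := Fk (head 0%N h) (b * psum u i h) _ (tt0 _ ilen).
  have /andP[f0 _] := F01 (b * psum u i h) (tt i).
  by rewrite ler_norml /W => /andP[]; lra.
pose dl := CF * b ^+ 2 / 2 * (alpha ^+ N * Ce + `|pirp q - v|) + C2 * b ^+ 3.
have step i : (i < n)%N -> (EA i.+1 (W i.+1) <= EA i (W i) + dl%:E)%E.
  move=> ilen; have ilen' := ltnW ilen.
  rewrite EA_step; last 2 first.
  - by move=> h; exact: W0.
  - move=> h; apply: (@cubic_bounded _ _ (1 + k + k)) => y.
    apply: le_trans (ler_normD _ _) _; rewrite (ger0_norm k0) lerD2r.
    apply: le_trans (ler_normD _ _) _; apply: lerD; last by apply: Fk; exact: tt0.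
    by have /andP[f0 f1] := F01 (b * psum u i.+1 (y :: h)) (tt i.+1); rewrite ger0_norm.
  pose er x := CF * b ^+ 2 / 2 * (`|iter N Q q x - pirp q| + `|pirp q - v|) + C2 * b ^+ 3.
  have cb : 0 <= CF * b ^+ 2 / 2 by rewrite divr_ge0 // mulr_ge0.
  have er0 x : 0 <= er x by rewrite addr_ge0 ?mulr_ge0 // addr_ge0.
  apply: (@le_trans _ _ (EA i (fun h => (W i h + er (head 0%N h))%R))).
    apply: EA_le => // h.
      apply: Q_ge0 => //; last by move=> y; exact: W0.
      apply: (@cubic_bounded _ _ (1 + k + k)) => y.
      apply: le_trans (ler_normD _ _) _; rewrite (ger0_norm k0) lerD2r.
      apply: le_trans (ler_normD _ _) _; apply: lerD; last by apply: Fk; exact: tt0.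
      by have /andP[f0 f1] := F01 (b * psum u i.+1 (y :: h)) (tt i.+1); rewrite ger0_norm.
    have tE : tt i.+1 = tt i - v * b ^+ 2 by rewrite /tt -[i.+1]addn1 natrD; ring.
    apply: le_trans (clt_step (psum u i h) k cg gG Gg0 (qE (head 0%N h)) b0 b1 (tt0 _ ilen') (tt0 _ ilen) tE) _.
    rewrite -/C2 lerD2l /er lerD2r ler_wpM2l //.
    rewrite (_ : _ - v = (iter N Q q (head 0%N h) - pirp q) + (pirp q - v)); last by ring.
    exact: ler_normD.
  rewrite EAD //; last by move=> h; exact: W0.
  apply: leeD2l => //; rewrite /er /dl.
  have -> : EA i (fun h => (CF * b ^+ 2 / 2 * (`|iter N Q q (head 0%N h) - pirp q| + `|pirp q - v|) + C2 * b ^+ 3)%R) =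
    ((CF * b ^+ 2 / 2)%:E * (EA i (fun h => (`|iter N Q q (head 0%N h) - pirp q|)%R) + EA i (fun=> (`|pirp q - v|)%R)) + EA i (fun=> (C2 * b ^+ 3)%R))%E.
    rewrite -EAD // -EAZ // -EAD // => h; apply: mulr_ge0 => //; exact: addr_ge0.
  rewrite [leRHS]EFinD [X in (_ <= X + _)%E]EFinM [X in (_ <= _ * X + _)%E]EFinD; apply: leeD; last by apply: EA_cst_le => //; exact: mulr_ge0.
  by apply: lee_wpmul2l; rewrite ?lee_fin //; apply: leeD; [exact: hCe|exact: EA_cst_le].
have tot i : (i <= n)%N -> (EA i (W i) <= EA 0 (W 0%N) + (i%:R * dl)%:E)%E.
  elim: i => [_|i IH ilen]; first by rewrite mul0r adde0.
  apply: le_trans (step _ ilen) _.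
  have -> : (i.+1%:R * dl)%:E = ((i%:R * dl)%:E + dl%:E)%E.
    by rewrite -EFinD -[i.+1]addn1 natrD mulrDl mul1r.
  by rewrite addeA leeD2r // IH // ltnW.
have start : (EA 0 (W 0%N) <= (fine (P A) * F 0 (v * n%:R / r) + 2 * k)%:E)%E.
  have /andP[f0 f1] := F01 0 (v * n%:R / r).
  apply: (@le_trans _ _ (EA 0 (fun=> (F 0 (v * n%:R / r) + 2 * k)%R))).
    apply: EA_le => // h; first exact: W0.
    rewrite /W /= mulr0 (_ : tt 0 = v * n%:R / r); last by rewrite /tt bb subr0; ring.
    have t0 : 0 <= v * n%:R / r by rewrite divr_ge0 ?mulr_ge0 // ltW.
    by have := Fk (head 0%N h) 0 _ t0; rewrite ler_norml => /andP[]; lra.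
  rewrite EA_cst // lee_fin mulrDl [F _ _ * _]mulrC lerD2l ler_piMr ?mulr_ge0 //.
  exact: PA_le1.
apply: (@le_trans _ _ (EA n (W n))).
  apply: EA_le => // h; first by have /andP[] := F01 (b * psum u n h) 0.
  rewrite /W (_ : tt n = 0); last by rewrite /tt subrr mulr0.
  by have := Fk (head 0%N h) (b * psum u n h) _ (lexx 0); rewrite ler_norml => /andP[]; lra.
apply: le_trans (tot n (leqnn n)) _.
apply: le_trans (leeD start (lexx _)) _.
rewrite -EFinD lee_fin -/b -[leRHS]addrA -!addrA lerD2l.
have aN : 0 <= alpha ^+ N by rewrite exprn_ge0 // ltW.
(* [dl] equals [b ^+ 2 * X], so summing [n] errors costs [n * b ^+ 2 <= 1] times [X]. *)
set X := CF * (alpha ^+ N * Ce + `|pirp q - v|) / 2 + C2 * b.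
have X0 : 0 <= X.
  apply: addr_ge0; last exact: mulr_ge0.
  by apply: divr_ge0 => //; apply: mulr_ge0 => //; apply: addr_ge0 => //; exact: mulr_ge0.
have e1 : n%:R * b ^+ 2 * X <= X by rewrite ler_piMl.
have e2 : CF * Gg * b ^+ 2 <= CF * Gg * b by rewrite ler_wpM2l ?mulr_ge0 // expr2 ler_piMl.
have e3' : 0 <= CF * `|pirp q - v| by rewrite mulr_ge0.
have e4 : 0 <= CF * (alpha ^+ N * Ce) by rewrite !mulr_ge0.
by move: e1; rewrite /X /k /dl; lra.
Qed.
End clt.

Variable c : R.
Local Notation mu := (Ee P e (fun m => m%:R)).
Local Notation sig2e := (Ee P e (fun m => (m%:R - mu) ^+ 2)).

Definition innov (x y : nat) : R := c * ((y%:R - alpha * x%:R - mu) * x%:R).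
(** The conditional variance of [innov x]: [(c * x) ^+ 2] times the one-step variance, which is
    affine in [x]. Its cubic order is where the third moment is spent. *)
Definition qvar (x : nat) : R :=
  c ^+ 2 * (alpha * (1 - alpha)) * x%:R ^+ 3 + c ^+ 2 * sig2e * x%:R ^+ 2.
Definition innov_le (K x y : nat) : R := if (x <= K)%N then innov x y else 0.
Definition innov_gt (K x y : nat) : R := if (x <= K)%N then 0 else innov x y.

Lemma sig2e_ge0 : 0 <= sig2e.
Proof. by apply: Rintegral_ge0 => w _; exact: sqr_ge0. Qed.

Lemma cubic_innov x : cubic (innov x).
Proof.
apply: cubicZ; rewrite (_ : (fun m => _) = fun m => x%:R * (m%:R + (- alpha * x%:R - mu))).
  by apply: cubicZ; apply: cubicD; [exact: cubic_id|exact: cubic_cst].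
by apply/funext => m; ring.
Qed.

Lemma innov_sqrE x : (fun y => innov x y ^+ 2) = (fun y => (c * x%:R) ^+ 2 * (y%:R - (alpha * x%:R + mu)) ^+ 2).
Proof. by apply/funext => y; rewrite /innov; ring. Qed.

Lemma cubic_innov2 x : cubic (fun y => innov x y ^+ 2).
Proof. by rewrite innov_sqrE; apply: cubicZ; exact: cubic_sqr_affine. Qed.

Lemma cubic_innov3 x : cubic (fun y => `|innov x y| ^+ 3).
Proof.
have a0' : 0 <= alpha by have /andP[/ltW] := alpha01.
pose B := alpha * x%:R + `|mu|; have Bge0 : 0 <= B by rewrite addr_ge0 // mulr_ge0.
apply: (@cubicW _ _ (fun y => (`|c| * x%:R) ^+ 3 * (4 * y%:R ^+ 3 + 4 * B ^+ 3))).
  apply: cubicZ; apply: cubicD; last exact: cubic_cst.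
  by apply: cubicZ; exact: cubic_exp.
move=> y; rewrite normrX normr_id /innov !normrM (ger0_norm (ler0n _ x)).
rewrite [X in X ^+ 3](_ : _ = (`|c| * x%:R) * `|y%:R - alpha * x%:R - mu|); last by ring.
rewrite exprMn ler_wpM2l ?exprn_ge0 // ?mulr_ge0 //.
have y0 := ler0n R y.
apply: (@le_trans _ _ ((y%:R + B) ^+ 3)).
  have hb : `|y%:R - alpha * x%:R - mu| <= y%:R + B.
    rewrite -addrA -opprD; apply: le_trans (ler_normB _ _) _; rewrite ger0_norm // lerD2l.
    by apply: le_trans (ler_normD _ _) _; rewrite ger0_norm // mulr_ge0.
  by rewrite lerXn2r ?nnegrE // addr_ge0.
have : 0 <= 3 * (y%:R + B) * (y%:R - B) ^+ 2.
  by rewrite mulr_ge0 ?sqr_ge0 // mulr_ge0 // addr_ge0.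
by lra.
Qed.

Lemma Q_innov x : Q (innov x) x = 0.
Proof.
rewrite (_ : innov x = fun y => (c * x%:R) * (y%:R - alpha * x%:R - mu)).
  rewrite QZ // ?Q_innov_mean ?mulr0 //.
  rewrite (_ : (fun m => _) = fun m => m%:R + (- alpha * x%:R - mu)).
    by apply: cubicD; [exact: cubic_id|exact: cubic_cst].
  by apply/funext => m; ring.
by apply/funext => y; rewrite /innov; ring.
Qed.

Lemma Q_innov2 x : Q (fun y => innov x y ^+ 2) x = qvar x.
Proof.
rewrite innov_sqrE QZ //; last exact: cubic_sqr_affine.
rewrite (_ : (fun y => _) = fun y => (y%:R - alpha * x%:R - mu) ^+ 2).
  by rewrite Q_innov_var // /qvar; ring.
by apply/funext => y; ring.
Qed.

Lemma qvar_ge0 x : 0 <= qvar x.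
Proof. by rewrite -Q_innov2; apply: Q_ge0 => // [|y]; [exact: cubic_innov2|exact: sqr_ge0]. Qed.

Lemma cubic_qvar : cubic qvar.
Proof. by apply: cubicD; apply: cubicZ; exact: cubic_exp. Qed.

Lemma dlip_qvar : dlip qvar.
Proof. by apply: dlipD; apply: dlipZ; exact: dlip_exp. Qed.

Lemma psum_innov_split K n h : psum innov n h = psum (innov_le K) n h + psum (innov_gt K) n h.
Proof.
elim: n h => [|n IH] h /=; rewrite ?addr0 // IH addrACA; congr (_ + _).
by rewrite /innov_le /innov_gt; case: ifP => _; rewrite ?addr0 ?add0r.
Qed.

(** Truncation on the starting state keeps the discarded increments centred, so orthogonality
    reduces their [L^2] size to the tail of the conditional variance. *)
Lemma EA_psum_innov_gt K : exists2 C : R, 0 <= C & forall n,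
  (EA n (fun h => (psum (innov_gt K) n h ^+ 2)%R) <= (n%:R * pirp (tail K qvar) + C)%:E)%E.
Proof.
have [C C0 hC] := EA_fsum_le (cubic_tail K cubic_qvar) (tail_ge0 K qvar_ge0) (dlip_tail K dlip_qvar).
exists C => // n; apply: le_trans (hC n).
rewrite (EA_psum_sqr) //.
- rewrite le_eqVlt; apply/orP; left; apply/eqP; apply: eq_bigr => i _.
  congr (EA _ _); apply/funext => h; rewrite /innov_gt /tail; case: (head 0%N h <= K)%N.
    by rewrite Q_cst expr0n.
  by rewrite Q_innov2.
- by move=> x; rewrite /innov_gt; case: (x <= K)%N; [exact: cubic_cst|exact: cubic_innov].
- move=> x; rewrite /innov_gt; case: (x <= K)%N; last exact: cubic_innov2.
  by exact: cubic_cst.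
- by move=> x; rewrite /innov_gt; case: (x <= K)%N; [rewrite Q_cst|exact: Q_innov].
Qed.

(** The target variance is the full [pirp qvar]; its gap to the truncated one is the stationary
    tail, hence the term with [CF]. *)
Lemma clt_innov_le (F F1 F2 : R -> R -> R) (CF : R) K :
  heat_estimates F F1 F2 CF -> (forall x t, 0 <= F x t <= 1) -> 0 <= CF ->
  forall eps, 0 < eps -> exists2 C : R, 0 <= C & forall (n : nat) (r : R), 1 <= r -> n%:R <= r ->
  (EA n (fun h => F ((Num.sqrt r)^-1 * psum (innov_le K) n h)%R 0%R) <=
   (fine (P A) * F 0 (pirp qvar * n%:R / r) + CF * pirp (tail K qvar) + eps + C / Num.sqrt r)%:E)%E.
Proof.
move=> hF F01 CF0 eps eps0.
have [G G0 hG] := trunc_bounded K qvar.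
(* Only the states up to [K] contribute, so the sum of their third moments is a uniform bound. *)
pose C3 := \sum_(x < K.+1) Q (fun y => `|innov x y| ^+ 3) x.
have t30 x : 0 <= Q (fun y => `|innov x y| ^+ 3) x.
  apply: Q_ge0 => //; exact: cubic_innov3.
have C30 : 0 <= C3 by exact: sumr_ge0.
have cu x : cubic (innov_le K x).
  by rewrite /innov_le; case: (x <= K)%N; [exact: cubic_innov|exact: cubic_cst].
have cu2 x : cubic (fun y => innov_le K x y ^+ 2).
  by rewrite /innov_le; case: (x <= K)%N; [exact: cubic_innov2|exact: cubic_cst].
have cu3 x : cubic (fun y => `|innov_le K x y| ^+ 3).
  by rewrite /innov_le; case: (x <= K)%N; [exact: cubic_innov3|exact: cubic_cst].
have Qu x : Q (innov_le K x) x = 0.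
  by rewrite /innov_le; case: (x <= K)%N; [exact: Q_innov|rewrite Q_cst].
have Qu2 x : Q (fun y => innov_le K x y ^+ 2) x = trunc K qvar x.
  rewrite /innov_le /trunc; case: (x <= K)%N; first exact: Q_innov2.
  by rewrite Q_cst expr0n.
have Qu3 x : Q (fun y => `|innov_le K x y| ^+ 3) x <= C3.
  rewrite /innov_le; case: (boolP (x <= K)%N) => xK.
    by rewrite -ltnS in xK; rewrite /C3 (bigD1 (Ordinal xK)) //= lerDl sumr_ge0.
  by rewrite Q_cst normr0 expr0n.
have v0 : 0 <= pirp qvar by apply: pir_ge0 => // x; exact: qvar_ge0.
have [C C0 hC] := chain_clt hF F01 CF0 cu cu2 cu3 Qu Qu2 Qu3 C30 v0
  (trunc_ge0 K qvar_ge0) hG eps0.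
exists C => // n r r1 nr; apply: le_trans (hC n r r1 nr) _.
rewrite lee_fin lerD2r lerD2r lerD2l ler_wpM2l //.
rewrite -(pir_trunc_tail K cubic_qvar qvar_ge0) opprD addrA subrr add0r normrN ger0_norm //.
by apply: pir_ge0 => //; exact: tail_ge0 qvar_ge0.
Qed.

Variable s : nat.
Hypothesis s1 : (1 <= s)%N.
Local Notation rs N := ((s + N)%:R : R).
Local Notation m2 := (pirp (fun x => x%:R ^+ 2)).

(* One-sided; used with [F] for an event and with [1 - F] for its complement. *)
Lemma chain_upper (F F1 F2 : R -> R -> R) (CF e1 eta lam : R) (B : nat -> set T) :
  heat_estimates F F1 F2 CF -> (forall x t, 0 <= F x t <= 1) -> 0 <= CF -> 0 <= e1 ->
  0 < eta -> 0 < lam ->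
  (forall N, measurable (B N)) -> (forall N, B N `<=` A) ->
  (forall K N w, B N w ->
    [\/ 1 - e1 <= F ((Num.sqrt (rs N))^-1 * psum (innov_le K) N (H N w)) 0,
        eta <= `|(Num.sqrt (rs N))^-1 * psum (innov_gt K) N (H N w)| |
        eta <= lam * `|fsum (fun x => x%:R ^+ 2) N (H N w) - N%:R * m2| / rs N]) ->
  forall eps, 0 < eps -> exists2 C : R, 0 <= C & forall N,
    fine (P (B N)) <= fine (P A) * F 0 (pirp qvar) + e1 + eps + C / Num.sqrt (rs N).
Proof.
move=> hF F01 CF0 e10 eta0 lam0 mB BA hB eps eps0.
have e4 : 0 < eps / 4 by rewrite divr_gt0.
have d0 : 0 < CF + (eta ^+ 2)^-1 + 1 by rewrite ltr_wpDl // addr_ge0 // invr_ge0 sqr_ge0.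
(* The truncation level must control the tail twice: in the variance mismatch, with factor [CF], and
   in Chebyshev's inequality, with factor [1 / eta^2]. *)
have eK : 0 < eps / 4 / (CF + (eta ^+ 2)^-1 + 1) by rewrite divr_gt0.
have [K0 hK0] := pir_tail alpha01 me e3 p0 p1 pQ cubic_qvar qvar_ge0 eK.
set K := K0; have {hK0} hK := hK0 K (leqnn K); rewrite -/(tail K qvar) in hK.
have tp0 : 0 <= pirp (tail K qvar) by apply: pir_ge0 => //; exact: tail_ge0 qvar_ge0.
have i0 : 0 <= (eta ^+ 2)^-1 by rewrite invr_ge0 sqr_ge0.
have hKs : (CF + (eta ^+ 2)^-1 + 1) * pirp (tail K qvar) <= eps / 4.
  by rewrite mulrC -ler_pdivlMr.
have hK1 : CF * pirp (tail K qvar) + (eta ^+ 2)^-1 * pirp (tail K qvar) <= eps / 4 by lra.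
have [C1 C10 h1] := clt_innov_le K hF F01 CF0 e4.
have [C2 C20 h2] := EA_psum_innov_gt K.
have e5 : 0 < eps / 4 * eta / lam by rewrite !divr_gt0 // mulr_gt0.
have sq0 (x : nat) : 0 <= x%:R ^+ 2 :> R by exact: sqr_ge0.
have [C3 C30 h3] := LLN
  (@cubic_exp R 2 isT) sq0 (@dlip_exp R 2 isT) e5.
have v0 : 0 <= pirp qvar by apply: pir_ge0 => // x; exact: qvar_ge0.
have [_ hFt hF2 _ _] := hF.
(* Pays for replacing the accumulated variance [V * N / (s + N)], with [V = pirp qvar], by [V]. *)
pose C4 := CF * (pirp qvar * s%:R) / 2 + CF * (pirp qvar * s%:R) ^+ 2.
have C40 : 0 <= C4 by rewrite addr_ge0 // ?divr_ge0 ?mulr_ge0 ?sqr_ge0.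
have le0 : 0 <= lam / eta by rewrite divr_ge0 // ltW.
exists (C1 + (eta ^+ 2)^-1 * C2 + lam / eta * (2 * C3) + C4) => [|N].
  apply: addr_ge0 => //; apply: addr_ge0; last by apply: mulr_ge0 => //; exact: mulr_ge0.
  by apply: addr_ge0 => //; exact: mulr_ge0.
set r := rs N; set b := (Num.sqrt r)^-1.
have r1 : 1 <= r by rewrite /r ler1n (leq_trans s1) // leq_addr.
have r0 : 0 < r by apply: lt_le_trans r1.
have nr : N%:R <= r by rewrite ler_nat leq_addl.
have sr1 : 1 <= Num.sqrt r by rewrite -(sqrtr1 R) ler_wsqrtr.
have sr0 : 0 < Num.sqrt r by apply: lt_le_trans sr1.
have b0 : 0 <= b by rewrite invr_ge0 ltW.
have b1 : b <= 1 by rewrite invf_le1.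
have b2 : 0 <= b ^+ 2 by exact: sqr_ge0.
have bb : r^-1 = b ^+ 2 by rewrite /b exprVn sqr_sqrtr // ltW.
have b2b : b ^+ 2 <= b by rewrite expr2 ler_piMl.
have nb : N%:R * b ^+ 2 <= 1 by rewrite -bb ler_pdivrMr // mul1r.
have sNb : Num.sqrt N%:R * b <= 1 by rewrite ler_pdivrMr // mul1r ler_wsqrtr.
pose f1 h := F (b * psum (innov_le K) N h) 0.
pose f2 h := psum (innov_gt K) N h ^+ 2.
pose f3 h := `|fsum (fun x => x%:R ^+ 2) N h - N%:R * m2|.
pose k2 := (eta ^+ 2)^-1 * b ^+ 2; pose k3 := lam / eta * b ^+ 2.
have k20 : 0 <= k2 by rewrite mulr_ge0.
have k30 : 0 <= k3 by rewrite mulr_ge0 // divr_ge0 // ltW.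
have f10 h : 0 <= f1 h by have /andP[] := F01 (b * psum (innov_le K) N h) 0.
have f20 h : 0 <= f2 h by exact: sqr_ge0.
have f30 h : 0 <= f3 h by exact: normr_ge0.
(* Each of the three alternatives makes one summand, [e1] included in the first, at least 1, so [f]
   dominates the indicator of [B N]: Markov's and Chebyshev's inequalities in one integral. *)
pose f h := (f1 h + e1) + (k2 * f2 h + k3 * f3 h).
have f0 h : 0 <= f h by rewrite /f !addr_ge0 // mulr_ge0.
have fB w : B N w -> 1 <= f (H N w).
  move=> Bw; have q2 : 0 <= k2 * f2 (H N w) by rewrite mulr_ge0.
  have q3 : 0 <= k3 * f3 (H N w) by rewrite mulr_ge0.
  have q1 := f10 (H N w).
  case: (hB K N w Bw); rewrite -/r -/b => hh.
  - by move: hh; rewrite -/(f1 (H N w)) /f; lra.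
  - suff : 1 <= k2 * f2 (H N w) by rewrite /f; lra.
    rewrite /k2 /f2 -mulrA -exprMn mulrC ler_pdivlMr ?exprn_gt0 // mul1r.
    by rewrite -[leRHS]real_normK ?num_real // lerXn2r ?nnegrE // ltW.
  - suff : 1 <= k3 * f3 (H N w) by rewrite /f; lra.
    rewrite /k3 -bb /f3 (_ : _ * _ = lam * `|fsum (fun x => x%:R ^+ 2) N (H N w) - N%:R * m2| / r / eta); last by ring.
    by rewrite ler_pdivlMr // mul1r.
have PB : (P (B N) <= EA N f)%E.
  rewrite -[P (B N)]mul1e -integral_cst //.
  apply: (@le_trans _ _ (\int[P]_(w in B N) (f (H N w))%:E)%E).
    apply: ge0_le_integral => //.
    by apply/measurable_EFinP; exact: discrete_measurable_fun.
  by apply: ge0_subset_integral => //; [exact: EA_measurable|move=> w _; rewrite lee_fin].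
have Ef : (EA N f <= ((fine (P A) * F 0 (pirp qvar * N%:R / r) + CF * pirp (tail K qvar) + eps / 4 + C1 * b) + e1
    + (k2 * (N%:R * pirp (tail K qvar) + C2) + k3 * (C3 * (1 + Num.sqrt N%:R) + eps / 4 * eta / lam * N%:R)))%:E)%E.
  have p1' h : 0 <= f1 h + e1 by rewrite addr_ge0.
  have p2' h : 0 <= k2 * f2 h by rewrite mulr_ge0.
  have p3' h : 0 <= k3 * f3 h by rewrite mulr_ge0.
  have p4' h : 0 <= k2 * f2 h + k3 * f3 h by rewrite addr_ge0.
  rewrite /f !EAD // !EFinD; apply: leeD; apply: leeD.
  - by rewrite -!EFinD; exact: h1.
  - exact: EA_cst_le.
  - by rewrite EAZ // [leRHS]EFinM; apply: lee_wpmul2l; [rewrite lee_fin|exact: h2].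
  - by rewrite EAZ // [leRHS]EFinM; apply: lee_wpmul2l; [rewrite lee_fin|exact: h3].
have fin : P (B N) \is a fin_num by rewrite fin_num_measure.
have {PB Ef} := le_trans PB Ef; rewrite -(fineK fin) lee_fin => main.
apply: le_trans main _.
have g1 : F 0 (pirp qvar * N%:R / r) <= F 0 (pirp qvar) + C4 * b.
  have t'0 : 0 <= pirp qvar * N%:R / r by rewrite divr_ge0 ?mulr_ge0 // ltW.
  have := hFt 0 _ _ v0 t'0; rewrite (_ : _ / r - pirp qvar = - (pirp qvar * s%:R * b ^+ 2)); last first.
    by rewrite -bb /r natrD; field; rewrite -natrD gt_eqF.
  have := hF2 0 _ v0; set D := F2 _ _ => D1; set z := pirp qvar * s%:R.
  have z0 : 0 <= z by rewrite mulr_ge0.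
  have zb : 0 <= z * b ^+ 2 by rewrite mulr_ge0.
  have u1 : - D * (z * b ^+ 2) <= CF * (z * b ^+ 2).
    by rewrite ler_wpM2r //; apply: le_trans D1; rewrite -normrN ler_norm.
  have u2 : CF * z * b ^+ 2 <= CF * z * b by rewrite ler_wpM2l // mulr_ge0.
  have u3 : CF * z ^+ 2 * b ^+ 4 <= CF * z ^+ 2 * b.
    rewrite ler_wpM2l ?mulr_ge0 ?sqr_ge0 //; apply: le_trans b2b.
    by rewrite (_ : 4 = 2 + 2)%N // exprD ler_piMl // expr_le1.
  by move=> /(le_trans (ler_norm _)); rewrite /C4 -/z; lra.
have g2 : fine (P A) * F 0 (pirp qvar * N%:R / r) <= fine (P A) * F 0 (pirp qvar) + C4 * b.
  apply: le_trans (ler_wpM2l _ g1) _; first by rewrite fine_ge0.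
  by rewrite mulrDr lerD2l ler_piMl ?PA_le1 // mulr_ge0.
have g3 : k2 * (N%:R * pirp (tail K qvar) + C2) <= (eta ^+ 2)^-1 * pirp (tail K qvar) + (eta ^+ 2)^-1 * C2 * b.
  rewrite /k2 (_ : _ * _ = (eta ^+ 2)^-1 * pirp (tail K qvar) * (N%:R * b ^+ 2) + (eta ^+ 2)^-1 * C2 * b ^+ 2); last by ring.
  by apply: lerD; [rewrite ler_piMr // mulr_ge0|rewrite ler_wpM2l // mulr_ge0].
have g4 : k3 * (C3 * (1 + Num.sqrt N%:R) + eps / 4 * eta / lam * N%:R) <= lam / eta * (2 * C3) * b + eps / 4.
  rewrite /k3 (_ : _ * _ = lam / eta * C3 * b ^+ 2 + lam / eta * C3 * b * (Num.sqrt N%:R * b) + eps / 4 * (N%:R * b ^+ 2)); last first.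
    by field; rewrite !gt_eqF.
  have w1 : lam / eta * C3 * b ^+ 2 <= lam / eta * C3 * b by rewrite ler_wpM2l // mulr_ge0.
  have w2 : lam / eta * C3 * b * (Num.sqrt N%:R * b) <= lam / eta * C3 * b.
    by rewrite ler_piMr //; apply: mulr_ge0 => //; exact: mulr_ge0.
  have w3 : eps / 4 * (N%:R * b ^+ 2) <= eps / 4 by rewrite ler_piMr // ltW.
  by lra.
rewrite -/b; lra.
Qed.
End chain.

(** * The estimators *)

(** Deterministic form of Slutsky's theorem: [U] is the truncated martingale, [G] the discarded
    part, [cR] and [D] the contributions before the outlier. The weight [|x| + 1] controls at once
    the error [x * q] in the threshold and [q] itself, which secures a positive denominator. *)
Lemma slutsky_arith {R : realFieldType} (x m2 b eta cR U G D f sm Nm den cres : R) :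
  0 < b -> b <= 1 -> 0 <= D -> 0 <= sm -> 2 * eta <= m2 -> (sm + Nm) * b ^+ 2 = m2 ->
  den = D + f -> cres = cR + (U + G) ->
  `|b * G| < eta -> (`|x| + 1) * `|f - Nm| * b ^+ 2 < eta ->
  b * (`|cR| + (`|x| + 1) * (D + sm)) <= eta ->
  [/\ 0 < den, b * cres <= x * den * b ^+ 2 -> b * U <= x * m2 + 3 * eta
    & x * den * b ^+ 2 < b * cres -> x * m2 - 3 * eta <= b * U].
Proof.
move=> b0 b1 D0 sm0 em mE denE cresE hG hf hZ.
have b20 : 0 < b ^+ 2 by rewrite exprn_gt0.
have lam1 : 1 <= `|x| + 1 by rewrite lerDr.
set lam := `|x| + 1 in lam1 hf hZ *.
have lam0 : 0 <= lam by apply: le_trans lam1.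
pose q := den * b ^+ 2 - m2.
have qE : q = (D - sm) * b ^+ 2 + (f - Nm) * b ^+ 2 by rewrite /q -mE denE; ring.
have DS0 : 0 <= D + sm by rewrite addr_ge0.
have qle : lam * `|q| <= lam * (D + sm) * b + lam * `|f - Nm| * b ^+ 2.
  rewrite -!mulrA -mulrDr ler_wpM2l // qE; apply: le_trans (ler_normD _ _) _.
  rewrite (normrM (D - sm)) (normrM (f - Nm)) (gtr0_norm b20); apply: lerD => //.
  apply: (@le_trans _ _ ((D + sm) * b ^+ 2)).
    rewrite ler_wpM2r ?(ltW b20) //; apply: le_trans (ler_normB _ _) _.
    by rewrite !ger0_norm.
  by rewrite ler_wpM2l // expr2 ler_piMr // ltW.
have xq : `|x * q| <= lam * `|q| by rewrite normrM ler_wpM2r // lerDl.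
have q1 : `|q| <= lam * `|q| by rewrite ler_peMl.
have bcR : `|b * cR| = b * `|cR| by rewrite normrM gtr0_norm.
have tot : `|b * cR| + lam * `|q| < 2 * eta by rewrite bcR; lra.
have cR0 : 0 <= `|b * cR| by exact: normr_ge0.
have dE : x * den * b ^+ 2 = x * m2 + x * q by rewrite /q; ring.
have rE : b * cres = b * U + b * G + b * cR by rewrite cresE; ring.
have /andP[g1 g2] : - eta < b * G < eta by rewrite -ltr_norml.
have /andP[x1 x2] : - (lam * `|q|) <= x * q <= lam * `|q| by rewrite -ler_norml.
have /andP[c1 c2] : - `|b * cR| <= b * cR <= `|b * cR| by rewrite -ler_norml.
have q2 : - `|q| <= q by have := lexx `|q|; rewrite {1}ler_norml => /andP[].
split.
- rewrite -(pmulr_lgt0 _ b20) (_ : den * b ^+ 2 = q + m2); last by rewrite /q; ring.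
  lra.
- rewrite dE rE; lra.
- rewrite dE rE; lra.
Qed.

(** The lower bound is the upper bound for the complement [pD]. Each side collects five errors: two
    from the one-sided estimate, one from its rate, one from the exceptional event, one from
    continuity. *)
Lemma sandwich_arith {R : realFieldType} (pA pE pD bp bm pT ph fp fm e cp cm : R) :
  pA = pD + pE -> pE <= bp + pT -> pD <= bm + pT ->
  bp <= pA * fp + e + e + cp -> bm <= pA * (1 - fm) + e + e + cm ->
  cp <= e -> cm <= e -> pT <= e -> pA * fp <= pA * ph + e -> pA * ph - e <= pA * fm ->
  `|pE - pA * ph| <= 5 * e.
Proof. by move=> *; rewrite ler_norml; apply/andP; split; lra. Qed.

Lemma event_arith {R : realFieldType} (c x b r res den : R) : b = r^-1 -> 0 < r -> 0 < den ->
  (c * (r * (res / den)) <= x) = (b * (c * res) <= x * den * b ^+ 2).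
Proof.
move=> -> r0 den0; rewrite -[in LHS](ler_pM2r den0) -(ler_pM2r (_ : 0 < r ^- 2)); last first.
  by rewrite invr_gt0 exprn_gt0.
congr (_ <= _); last by rewrite exprVn.
by field; rewrite !gt_eqF.
Qed.

(** The test function for parameter [eta] has its threshold moved by [4 * eta] and smoothing
    variance [eta^4]; both effects vanish as [eta] tends to 0 because [V > 0]. Either sign of [eta]
    is allowed, to cover both thresholds. *)
Lemma sandwich_continuous {R : realType} (V a e : R) : 0 < V -> 0 < e -> exists2 del, 0 < del & forall eta, `|eta| < del ->
  `|Phi ((a + 4 * eta) / Num.sqrt ((eta ^+ 2) ^+ 2 + V)) - Phi (a / Num.sqrt V)| <= e.
Proof.
move=> V0 e0.
have h1 : (fun eta : R => (eta ^+ 2) ^+ 2 + V) @ (0 : R) --> V.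
  rewrite (_ : (fun eta : R => _) = fun eta => eta ^+ 4 + V); last first.
    by apply/funext => eta; rewrite -exprM.
  rewrite -[X in _ --> X](_ : 0 ^+ 4 + V = V); last by rewrite expr0n add0r.
  by apply: (@cvgD _ R^o); [exact: exprn_continuous|exact: cvg_cst].
have h2 : (fun eta : R => Num.sqrt ((eta ^+ 2) ^+ 2 + V)) @ (0 : R) --> Num.sqrt V.
  apply: (cvg_comp (fun eta : R => (eta ^+ 2) ^+ 2 + V) (@Num.sqrt R) h1).
  exact: sqrt_continuous.
have h3 : (fun eta : R => a + 4 * eta) @ (0 : R) --> a.
  rewrite -[X in _ --> X]addr0; apply: (@cvgD _ R^o); first exact: cvg_cst.
  by rewrite -[X in _ --> X](mulr0 4); apply: cvgM; [exact: cvg_cst|exact: cvg_id].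
have h4 : (fun eta : R => (a + 4 * eta) / Num.sqrt ((eta ^+ 2) ^+ 2 + V)) @ (0 : R) --> a / Num.sqrt V.
  by apply: cvgM => //; apply: cvgV => //; rewrite gt_eqF // sqrtr_gt0.
have h : (fun eta : R => Phi ((a + 4 * eta) / Num.sqrt ((eta ^+ 2) ^+ 2 + V))) @ (0 : R) --> Phi (a / Num.sqrt V).
  apply: (cvg_comp _ Phi h4); exact: Phi_continuous.
move/cvgrPdist_le : h => /(_ _ e0) [del /= del0 hdel]; exists del => // eta he.
by rewrite distrC; apply: hdel; rewrite /= sub0r normrN.
Qed.

(** Tightness of one real variable; it makes the part before the outlier negligible after division
    by [sqrt n]. *)
Lemma tail_prob {d : measure_display} {T : measurableType d} {R : realType}
  (P : probability T R) (Z : T -> R) : (forall M : R, measurable [set w | M < Z w]) ->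
  forall e, 0 < e -> exists M : R, fine (P [set w | M < Z w]) <= e.
Proof.
move=> mZ e e0; pose F n := [set w | n%:R < Z w].
have : P (F n) @[n --> \oo] --> P (\bigcap_n F n).
  apply: nonincreasing_cvg_mu => //.
  - by apply: le_lt_trans (probability_le1 _ _) (ltry 1); exact: mZ.
  - by move=> n; exact: mZ.
  - by apply: bigcap_measurable => // n _; exact: mZ.
  - move=> m n mn; apply/subsetPset => w /=; apply: le_lt_trans.
    by rewrite ler_nat.
rewrite (_ : \bigcap_n F n = set0); last first.
  apply/seteqP; split => // w /(_ (Num.truncn (Z w)).+1 I).
  rewrite /F /= ltNge => /negP; apply.
  by rewrite ltW // truncnS_gt.
rewrite measure0 => /fine_cvgP[_ /cvgr0_norm_le /(_ _ e0)] [N _ /(_ N (leqnn N))] h.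
by exists N%:R; apply: le_trans (ler_norm _) h.
Qed.

(** * The conditional least squares estimators of the outlier process *)

Section outlier.
Context {d : measure_display} {T : measurableType d} {R : realType}.
Variables (P : probability T R) (alpha : R).
Variables (Y0 : T -> nat) (eps : nat -> T -> nat) (xi : nat -> nat -> T -> nat) (s theta : nat) (p : nat -> R).
Hypothesis alpha01 : 0 < alpha < 1.
Hypothesis mY0 : nat_rv Y0.
Hypothesis meps : forall k, nat_rv (eps k).
Hypothesis mxi : forall k j, nat_rv (xi k j).
Hypothesis indep : mutually_independent P (inar_family Y0 eps xi).
Hypothesis eps_id : forall k m, (1 <= k)%N -> P [set w | eps k w = m] = P [set w | eps 1%N w = m].
Hypothesis xi_bern : forall k j, (1 <= k)%N -> (1 <= j)%N ->
  P [set w | xi k j w = 1%N] = alpha%:E /\ P [set w | xi k j w = 0%N] = (1 - alpha)%:E.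
Hypothesis eps_ne0 : (0 < P [set w | eps 1%N w != 0%N])%E.
Hypothesis Y03 : (\int[P]_w (((Y0 w)%:R : R) ^+ 3)%:E < +oo)%E.
Hypothesis e3 : (\int[P]_w (((eps 1%N w)%:R : R) ^+ 3)%:E < +oo)%E.
Hypothesis s1 : (1 <= s)%N.
Hypothesis stat : is_stationary P eps xi p.

Local Notation Y := (Yproc Y0 eps xi s theta).
Local Notation hist := (hist Y0 eps xi s theta).
Local Notation Q := (Qop P alpha (eps 1%N)).
Local Notation pir := (pir p).
Local Notation mu := (mean_eps P eps).
Let me1 : nat_rv (eps 1%N). Proof. exact: meps. Qed.
Let p0 : forall m, 0 <= p m. Proof. by case: stat. Qed.
Let p1 : (\sum_(m <oo) (p m)%:E = 1)%E. Proof. by case: stat => _ []. Qed.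
Let pQ : forall y, (\sum_(x <oo) (p x * rker P alpha (eps 1%N) x y)%:E)%E = (p y)%:E.
Proof.
case: stat => _ [_ h] y; rewrite -h; apply: eq_eseriesr => x _.
by rewrite (inar_trans_rker mY0 meps mxi indep eps_id xi_bern e3).
Qed.

Let mh := mhist s theta mY0 meps mxi indep eps_id xi_bern e3.

Lemma hist_det_measurable k (B : set T) : hist_det Y0 eps xi s theta k B -> measurable B.
Proof.
move=> hB; rewrite (_ : B = hist k @^-1` (hist k @` B)); first exact: (discrete_preimage _ (mh k)).
apply/seteqP; split => [w Bw|w [w' Bw' E]]; first by exists w.
exact: hB E Bw'.
Qed.

Lemma hist_Y k j w w' : hist k w = hist k w' -> (j <= k)%N -> Y j w = Y j w'.
Proof.
move=> E jk; have /(_ w' w (esym E) erefl) := @hist_det_Y _ T Y0 eps xi s theta k j (Y j w') jk.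
by [].
Qed.

(** Propagated step by step through the outlier: the shift by [theta] preserves cubic growth. This
    supplies the moment of the starting state [Y s]. *)
Lemma Y_moment3 k : exists B : R, (\int[P]_w (1 + (Y k w)%:R ^+ 3)%:E <= B%:E)%E.
Proof.
elim: k => [|k [B hB]].
  have mY03 : measurable_fun setT (fun w => (((Y0 w)%:R : R) ^+ 3)%:E).
    by apply/measurable_EFinP; exact: (@discrete_measurable_fun _ _ _ Y0 _ _ (fun m => m%:R ^+ 3 : R) _ measurableT mY0).
  exists (1 + fine (\int[P]_w (((Y0 w)%:R : R) ^+ 3)%:E)).
  have i0 : (0 <= \int[P]_w (((Y0 w)%:R : R) ^+ 3)%:E)%E.
    by apply: integral_ge0 => w _; rewrite lee_fin exprn_ge0.
  under eq_integral do rewrite EFinD.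
  rewrite ge0_integralD //.
  rewrite integral_cst // mul1e EFinD fineK; last by rewrite ge0_fin_numE.
  by apply: leeD => //; exact: probability_le1.
pose f (h : seq nat) : R := 1 + (head 0%N h)%:R ^+ 3.
have f0 h : 0 <= f h by rewrite addr_ge0 // exprn_ge0.
have cf h : cubic (fun y => f (y :: h)).
  by apply: cubicD; [exact: cubic_cst|exact: cubic_exp].
have := integral_hist_step alpha01 mY0 meps mxi indep eps_id xi_bern e3 measurableT
  (@hist_det_setT _ T Y0 eps xi s theta k) f0 cf.
under eq_integral do rewrite /f head_hist.
move=> ->.
have [C C0 hC] := cubic_Q alpha01 me1 e3 (cubic_shift (shift_at s theta k.+1) (cf [::])).
exists (C * B).
apply: (@le_trans _ _ (\int[P]_w (C%:E * (1 + (Y k w)%:R ^+ 3)%:E))%E).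
  apply: ge0_le_integral => //.
  - by move=> w _; rewrite lee_fin; apply: Q_ge0 => //; exact: (cubic_shift _ (cf _)).
  - exact: (measurable_hist_fun s theta mY0 meps mxi indep eps_id xi_bern e3).
  - under eq_fun do rewrite -EFinM -head_hist.
    exact: (measurable_hist_fun s theta mY0 meps mxi indep eps_id xi_bern e3 k (fun h => C * (1 + (head 0%N h)%:R ^+ 3)) measurableT).
  move=> w _; rewrite -EFinM lee_fin -head_hist.
  exact: le_trans (ler_norm _) (hC (head 0%N (hist k w))).
have mg : measurable_fun setT (fun w => (1 + (Y k w)%:R ^+ 3 : R)%:E).
  under eq_fun do rewrite -head_hist.
  exact: (measurable_hist_fun s theta mY0 meps mxi indep eps_id xi_bern e3 k (fun h => 1 + (head 0%N h)%:R ^+ 3) measurableT).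
have g0 w : setT w -> (0 <= (1 + (Y k w)%:R ^+ 3 : R)%:E)%E by move=> _; rewrite lee_fin addr_ge0 // exprn_ge0.
rewrite (@ge0_integralZl_EFin _ _ _ P _ measurableT _ g0 mg C C0) EFinM.
by apply: lee_wpmul2l.
Qed.

(** Omitting the index [s] removes the only irregular transition, so the second sum runs over a
    homogeneous chain started at [Y s]. *)
Lemma sum_skip (G : nat -> R) N :
  \sum_(1 <= k < (s + N).+1 | k != s) G k = \sum_(1 <= k < s) G k + \sum_(i < N) G (s + i).+1.
Proof.
rewrite big_mkcond; elim: N => [|N IH].
  rewrite addn0 big_ord0 addr0 big_nat_recr //= eqxx addr0.
  by apply: eq_big_nat => k /andP[_ ks]; rewrite ltn_eqF.
rewrite addnS big_nat_recr //= IH big_ord_recr /= addrA; congr (_ + _).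
by rewrite gtn_eqF // ltnS leq_addr.
Qed.

Lemma psum_hist (u : nat -> nat -> R) N w :
  psum u N (hist (s + N) w) = \sum_(i < N) u (Y (s + i) w) (Y (s + i).+1 w).
Proof.
elim: N => [|N IH]; first by rewrite big_ord0.
by rewrite addnS big_ord_recr /= head_hist IH addrC.
Qed.

Lemma fsum_hist (f : nat -> R) N w :
  fsum f N (hist (s + N) w) = \sum_(i < N) f (Y (s + i) w).
Proof.
elim: N => [|N IH]; first by rewrite big_ord0.
by rewrite addnS big_ord_recr /= head_hist IH addrC.
Qed.

Definition cls_den n w : R := \sum_(1 <= k < n.+1 | k != s) (Y k.-1 w)%:R ^+ 2.
Definition cls_res n w : R :=
  \sum_(1 <= k < n.+1 | k != s) ((Y k w)%:R - alpha * (Y k.-1 w)%:R - mu) * (Y k.-1 w)%:R.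
Definition pre_den w : R := \sum_(1 <= k < s) (Y k.-1 w)%:R ^+ 2.
Definition pre_res w : R :=
  \sum_(1 <= k < s) ((Y k w)%:R - alpha * (Y k.-1 w)%:R - mu) * (Y k.-1 w)%:R.

Lemma cls_denE N w : cls_den (s + N) w = pre_den w + fsum (fun x => x%:R ^+ 2) N (hist (s + N) w).
Proof. by rewrite /cls_den sum_skip fsum_hist. Qed.

Lemma cls_resE c N w : c * cls_res (s + N) w =
  c * pre_res w + psum (innov P alpha (eps 1%N) c) N (hist (s + N) w).
Proof. by rewrite /cls_res sum_skip psum_hist mulrDr; congr (_ + _); rewrite mulr_sumr. Qed.

Lemma alpha_tildeE n w : 0 < cls_den n w ->
  alpha_tilde Y mu s n w - alpha = cls_res n w / cls_den n w.
Proof.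
move=> den0; rewrite /alpha_tilde -/(cls_den n w) den0.
rewrite -[X in _ - X](mulfK (lt0r_neq0 den0)) -mulrBl; congr (_ / _).
rewrite /cls_den mulr_sumr -sumrB; apply: eq_bigr => k _; ring.
Qed.

Lemma alpha_tilde_hist n w w' : hist n w = hist n w' ->
  alpha_tilde Y mu s n w = alpha_tilde Y mu s n w'.
Proof.
move=> E; have YE k : (k <= n)%N -> Y k w = Y k w' by exact: hist_Y.
rewrite /alpha_tilde.
have -> : \sum_(1 <= k < n.+1 | k != s) (Y k.-1 w)%:R ^+ 2 =
          \sum_(1 <= k < n.+1 | k != s) (Y k.-1 w')%:R ^+ 2 :> R.
  rewrite big_nat_cond [RHS]big_nat_cond; apply: eq_bigr => k /andP[/andP[k1 kn] _].
  by rewrite YE // (leq_trans (leq_pred k)).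
suff -> : \sum_(1 <= k < n.+1 | k != s) ((Y k w)%:R - mu) * (Y k.-1 w)%:R =
          \sum_(1 <= k < n.+1 | k != s) ((Y k w')%:R - mu) * (Y k.-1 w')%:R by [].
rewrite big_nat_cond [RHS]big_nat_cond; apply: eq_bigr => k /andP[/andP[k1 kn] _].
by rewrite !YE // (leq_trans (leq_pred k)).
Qed.

Section limit.
Variable c : R.
Hypothesis c0 : c != 0.
Variable A : set T.
Hypothesis hA : hist_det Y0 eps xi s theta s A.
Local Notation m2 := (pir (fun x => x%:R ^+ 2)).
Local Notation V := (pir (qvar P alpha (eps 1%N) c)).

Lemma m2_gt0 : 0 < m2.
Proof.
apply: (pir_gt0 alpha01 me1 e3 p0 p1 pQ (@cubic_exp R 2 isT)) => // m m0.
by rewrite exprn_gt0 // ltr0n.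
Qed.

Lemma V_gt0 : 0 < V.
Proof.
have /andP[al0 al1] := alpha01.
apply: (pir_gt0 alpha01 me1 e3 p0 p1 pQ (cubic_qvar _ _ _ _)) => // m.
  exact: qvar_ge0.
move=> m0; have mR : 0 < m%:R :> R by rewrite ltr0n.
rewrite /qvar; apply: ltr_pwDl.
  apply: mulr_gt0; last exact: exprn_gt0.
  by apply: mulr_gt0; [rewrite exprn_even_gt0|apply: mulr_gt0; rewrite ?subr_gt0].
by apply: mulr_ge0; [apply: mulr_ge0; [exact: sqr_ge0|exact: sig2e_ge0]|exact: sqr_ge0].
Qed.

Lemma hist_detW k : (s <= k)%N -> hist_det Y0 eps xi s theta k A.
Proof.
move=> /subnKC <-; elim: (k - s)%N => [|j IH]; first by rewrite addn0.
by rewrite addnS; exact: hist_detS.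
Qed.

Definition cls_event (x : R) (n : nat) : set T :=
  [set w | c * (Num.sqrt n%:R * (alpha_tilde Y mu s n w - alpha)) <= x].

Lemma cls_event_det x n : hist_det Y0 eps xi s theta n (cls_event x n).
Proof. by move=> w w' E; rewrite /cls_event /= (alpha_tilde_hist E). Qed.

Lemma cls_event_limit (x e : R) : 0 < e -> exists N0 : nat, forall N, (N0 <= N)%N ->
  `|fine (P (A `&` cls_event x (s + N))) - fine (P A) * Phi (x * m2 / Num.sqrt V)| <= 5 * e.
Proof.
move=> e0; set a := x * m2.
pose H j := hist (s + j).
have mH j h : measurable [set w | H j w = h] by exact: mh.
have mA : measurable A by exact: hist_det_measurable hA.
have Hbehead j w : behead (H j.+1 w) = H j w by rewrite /H addnS.
have Hstep j (f : seq nat -> R) : (forall h, 0 <= f h) -> (forall h, cubic (fun y => f (y :: h))) ->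
  (\int[P]_(w in A) (f (H j.+1 w))%:E =
   \int[P]_(w in A) (Q (fun y => f (y :: H j w)) (head 0%N (H j w)))%:E)%E.
  move=> f0 cf; rewrite /H addnS.
  rewrite (integral_hist_step alpha01 mY0 meps mxi indep eps_id xi_bern e3 mA (hist_detW (leq_addr j s)) f0 cf).
  (* Strictly after [s] the shift is 0, so the step is [Q] itself. *)
  apply: eq_integral => w _; congr (_%:E); rewrite /hist_step /shift_at gtn_eqF ?ltnS ?leq_addr //.
  by congr Qop; apply/funext => y; rewrite addn0.
have [B0 hB0] := Y_moment3 s.
have HB0 : (\int[P]_(w in A) (1 + (head 0%N (H 0 w))%:R ^+ 3)%:E <= B0%:E)%E.
  apply: le_trans hB0.
  apply: (@le_trans _ _ (\int[P]_w (1 + (head 0%N (H 0 w))%:R ^+ 3)%:E)%E).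
    apply: ge0_subset_integral => //.
      apply: (measurable_hist_fun s theta mY0 meps mxi indep eps_id xi_bern e3 (s + 0)
        (fun h => 1 + (head 0%N h)%:R ^+ 3)) => //.
  by rewrite le_eqVlt; apply/orP; left; apply/eqP; apply: eq_integral => w _; rewrite /H addn0 head_hist.
have m20 := m2_gt0; have V0 := V_gt0.
have [del del0 hdel] := sandwich_continuous a V0 e0.
have [Bs Bs0 hBs] := @Phi_small R e e0; have [Bl Bl0 hBl] := @Phi_large R e e0.
(* Four demands: continuity of the limit, saturation of [Phi] near 0 and near 1 at distance
   [1 / eta], and [2 * eta <= m2] for the denominator. *)
pose eta := Num.min (del / 2) (Num.min (Num.min Bs^-1 Bl^-1) (m2 / 2)).
have eta0 : 0 < eta by rewrite !lt_min !divr_gt0 // !invr_gt0 Bs0 Bl0.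
have etad : `|eta| < del.
  rewrite gtr0_norm //; apply: (@le_lt_trans _ _ (del / 2)); first by rewrite ge_min lexx.
  lra.
have etaBs : Bs <= eta^-1.
  rewrite -(invrK Bs) lef_pV2 ?posrE ?invr_gt0 //; apply: (@le_trans _ _ (Num.min Bs^-1 Bl^-1)).
    by rewrite ge_min; apply/orP; right; rewrite ge_min lexx.
  by rewrite ge_min lexx.
have etaBl : Bl <= eta^-1.
  rewrite -(invrK Bl) lef_pV2 ?posrE ?invr_gt0 //; apply: (@le_trans _ _ (Num.min Bs^-1 Bl^-1)).
    by rewrite ge_min; apply/orP; right; rewrite ge_min lexx.
  by rewrite ge_min lexx orbT.
have etam : 2 * eta <= m2.
  have : eta <= m2 / 2 by rewrite ge_min; apply/orP; right; rewrite ge_min lexx orbT.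
  lra.
have del20 : 0 < eta ^+ 2 by rewrite exprn_gt0.
pose lam := `|x| + 1; have lam0 : 0 < lam by rewrite ltr_wpDl.
have pd0 w : 0 <= pre_den w :> R by apply: sumr_ge0 => k _; exact: sqr_ge0.
pose Z w : R := `|c * pre_res w| + lam * (pre_den w + s%:R * m2).
have Zdet w w' : hist s w = hist s w' -> Z w = Z w'.
  move=> E; have YE k : (k <= s)%N -> Y k w = Y k w' by exact: hist_Y.
  rewrite /Z /pre_res /pre_den.
  have -> : \sum_(1 <= k < s) (Y k.-1 w)%:R ^+ 2 = \sum_(1 <= k < s) (Y k.-1 w')%:R ^+ 2 :> R.
    by apply: eq_big_nat => k /andP[k1 ks]; rewrite YE // (leq_trans (leq_pred k)) // ltnW.
  congr (`|c * _| + _); apply: eq_big_nat => k /andP[k1 ks].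
  by rewrite (YE k (ltnW ks)) (YE k.-1 (leq_trans (leq_pred k) (ltnW ks))).
have Zd M : hist_det Y0 eps xi s theta s [set w | M < Z w].
  by move=> w w' E /=; rewrite (Zdet _ _ E).
have mZ M : measurable [set w | M < Z w] by exact: hist_det_measurable (Zd M).
have [M hM] := tail_prob P mZ e0.
pose r N : R := Num.sqrt (s + N)%:R.
have r0 N : 0 < r N by rewrite sqrtr_gt0 ltr0n addn_gt0 s1.
pose TN N := [set w | eta * r N < Z w].
have mTN N : measurable (TN N) by exact: mZ.
have mE N : measurable (cls_event x (s + N)) by exact: hist_det_measurable (@cls_event_det x (s + N)).
(* The comparison loses [3 * eta]; the remaining [eta], divided by the smoothing width [eta ^+ 2],
   is [1 / eta], where [Phi] is already within [e] of its limit. *)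
pose Fp := hF (a + 4 * eta) (eta ^+ 2); pose Fm := hF (a - 4 * eta) (eta ^+ 2).
have Fp01 y t : 0 <= Fp y t <= 1 by rewrite Phi_ge0 Phi_le1.
have Fm01 y t : 0 <= 1 - Fm y t <= 1.
  by have := Phi_ge0 (hz (a - 4 * eta) (eta ^+ 2) y t); have := Phi_le1 (hz (a - 4 * eta) (eta ^+ 2) y t);
    rewrite /Fm /hF; lra.
have [Cp Cp0 hFp] := hF_heat_estimates (a + 4 * eta) del20.
have [Cm Cm0 /heat_estimates_compl hFm] := hF_heat_estimates (a - 4 * eta) del20.
have sdE : Num.sqrt ((eta ^+ 2) ^+ 2 + 0) = eta ^+ 2 by rewrite addr0 sqrtr_sqr gtr0_norm.
have base K N w : ~ TN N w ->
  `|(r N)^-1 * psum (innov_gt P alpha (eps 1%N) c K) N (H N w)| < eta ->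
  lam * `|fsum (fun x => x%:R ^+ 2) N (H N w) - N%:R * m2| / (s + N)%:R < eta ->
  (cls_event x (s + N) w -> (r N)^-1 * psum (innov_le P alpha (eps 1%N) c K) N (H N w) <= a + 3 * eta) /\
  (~ cls_event x (s + N) w -> a - 3 * eta <= (r N)^-1 * psum (innov_le P alpha (eps 1%N) c K) N (H N w)).
  move=> /negP; rewrite -leNgt => hZ hG hf.
  have bb : (r N)^-1 ^+ 2 = ((s + N)%:R)^-1 by rewrite exprVn sqr_sqrtr.
  have [] := @slutsky_arith R x m2 (r N)^-1 eta (c * pre_res w)
    (psum (innov_le P alpha (eps 1%N) c K) N (H N w)) (psum (innov_gt P alpha (eps 1%N) c K) N (H N w))
    (pre_den w) (fsum (fun x => x%:R ^+ 2) N (H N w)) (s%:R * m2) (N%:R * m2)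
    (cls_den (s + N) w) (c * cls_res (s + N) w).
  - by rewrite invr_gt0.
  - by rewrite invf_le1 // -(sqrtr1 R) ler_wsqrtr // ler1n addn_gt0 s1.
  - exact: pd0.
  - by rewrite mulr_ge0 // ltW.
  - exact: etam.
  - by rewrite bb -mulrDl -natrD mulrC mulKf // gt_eqF // ltr0n addn_gt0 s1.
  - exact: cls_denE.
  - by rewrite cls_resE // (psum_innov_split _ _ _ _ K).
  - exact: hG.
  - by rewrite bb.
  - by rewrite -/lam mulrC ler_pdivrMr.
  move=> den0 up lo.
  rewrite /cls_event /= alpha_tildeE // (event_arith _ _ _ (erefl _) (r0 N) den0).
  by split=> // /negP; rewrite -ltNge.
have PTN N : M <= eta * r N -> fine (P (TN N)) <= e.
  move=> h; apply: le_trans hM; rewrite fine_le ?fin_num_measure //.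
  by apply: le_measure; rewrite ?inE // => w; apply: le_lt_trans.
have PhiBl : 1 - e <= Phi eta^-1 by exact: hBl.
have PhiBs : Phi (- eta^-1) <= e by apply: hBs; rewrite lerN2.
have quot : eta / eta ^+ 2 = eta^-1 by rewrite expr2 invfM mulrA divff ?mul1r // gt_eqF.
have rN1 N : 1 <= r N by rewrite -(sqrtr1 R) ler_wsqrtr // ler1n addn_gt0 s1.
have ptp K N w : ((A `&` cls_event x (s + N)) `\` TN N) w ->
  [\/ 1 - e <= Fp ((r N)^-1 * psum (innov_le P alpha (eps 1%N) c K) N (H N w)) 0,
      eta <= `|(r N)^-1 * psum (innov_gt P alpha (eps 1%N) c K) N (H N w)| |
      eta <= lam * `|fsum (fun x => x%:R ^+ 2) N (H N w) - N%:R * m2| / (s + N)%:R].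
  move=> [[Aw Ew] nT].
  have [hG|hG] := leP eta `|(r N)^-1 * psum (innov_gt P alpha (eps 1%N) c K) N (H N w)|; first by constructor 2.
  have [hf|hf] := leP eta (lam * `|fsum (fun x => x%:R ^+ 2) N (H N w) - N%:R * m2| / (s + N)%:R); first by constructor 3.
  have [/(_ Ew) up _] := base K N w nT hG hf.
  constructor 1; apply: le_trans PhiBl _; rewrite /Fp /hF; apply: Phi_nd.
  by rewrite /hz /hsd sdE -quot ler_wpM2r ?invr_ge0 ?(ltW del20) //; lra.
have ptm K N w : ((A `\` cls_event x (s + N)) `\` TN N) w ->
  [\/ 1 - e <= 1 - Fm ((r N)^-1 * psum (innov_le P alpha (eps 1%N) c K) N (H N w)) 0,
      eta <= `|(r N)^-1 * psum (innov_gt P alpha (eps 1%N) c K) N (H N w)| |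
      eta <= lam * `|fsum (fun x => x%:R ^+ 2) N (H N w) - N%:R * m2| / (s + N)%:R].
  move=> [[Aw Ew] nT].
  have [hG|hG] := leP eta `|(r N)^-1 * psum (innov_gt P alpha (eps 1%N) c K) N (H N w)|; first by constructor 2.
  have [hf|hf] := leP eta (lam * `|fsum (fun x => x%:R ^+ 2) N (H N w) - N%:R * m2| / (s + N)%:R); first by constructor 3.
  have [_ /(_ Ew) lo] := base K N w nT hG hf.
  constructor 1; rewrite lerD2l lerN2; apply: le_trans PhiBs; rewrite /Fm /hF; apply: Phi_nd.
  by rewrite /hz /hsd sdE -quot -[leRHS]mulNr ler_wpM2r ?invr_ge0 ?(ltW del20) //; lra.
have mBp N : measurable ((A `&` cls_event x (s + N)) `\` TN N).
  by apply: measurableD => //; exact: measurableI.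
have mBm N : measurable ((A `\` cls_event x (s + N)) `\` TN N).
  by apply: measurableD => //; exact: measurableD.
have sBp N : (A `&` cls_event x (s + N)) `\` TN N `<=` A by move=> w [[]].
have sBm N : (A `\` cls_event x (s + N)) `\` TN N `<=` A by move=> w [[]].
have [C1 C10 h1] := chain_upper alpha01 me1 e3 p0 p1 pQ mA mH Hbehead Hstep HB0 s1 hFp Fp01 Cp0 (ltW e0) eta0 lam0
   mBp sBp ptp e0.
have [C2 C20 h2] := chain_upper alpha01 me1 e3 p0 p1 pQ mA mH Hbehead Hstep HB0 s1 hFm Fm01 Cm0 (ltW e0) eta0 lam0
   mBm sBm ptm e0.
(* The size of [sqrt (s + N)] beyond which the exceptional event and both rate terms are at most
   [e]. *)
pose X := `|M| / eta + C1 / e + C2 / e.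
have X1 : 0 <= `|M| / eta by rewrite divr_ge0 // ltW.
have X2 : 0 <= C1 / e by rewrite divr_ge0 // ltW.
have X3 : 0 <= C2 / e by rewrite divr_ge0 // ltW.
have X0 : 0 <= X by rewrite !addr_ge0.
exists (Num.truncn (X ^+ 2)).+1 => N N0N.
have Xr : X <= r N.
  rewrite -(ger0_norm X0) -sqrtr_sqr ler_wsqrtr //; apply: (@le_trans _ _ (Num.truncn (X ^+ 2)).+1%:R).
    by rewrite ltW // truncnS_gt.
  by rewrite ler_nat (leq_trans N0N) // leq_addl.
have hT : fine (P (TN N)) <= e.
  apply: PTN; apply: le_trans (ler_norm _) _; rewrite mulrC -ler_pdivrMr //.
  by apply: le_trans Xr; rewrite /X; lra.
have hC1 : C1 / r N <= e.
  by rewrite ler_pdivrMr // mulrC -ler_pdivrMr //; apply: le_trans Xr; rewrite /X; lra.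
have hC2 : C2 / r N <= e.
  by rewrite ler_pdivrMr // mulrC -ler_pdivrMr //; apply: le_trans Xr; rewrite /X; lra.
have mAE : measurable (A `&` cls_event x (s + N)) by exact: measurableI.
have mAD : measurable (A `\` cls_event x (s + N)) by exact: measurableD.
have split_le (E F : set T) : measurable E -> measurable F ->
    fine (P E) <= fine (P (E `\` F)) + fine (P F).
  move=> mE' mF; rewrite -fineD ?fin_num_measure //; last exact: measurableD.
  rewrite fine_le ?fin_num_measure //; first by rewrite fin_numD !fin_num_measure //; exact: measurableD.
  rewrite (measureDI P mE' mF); apply: leeD => //.
  by apply: le_measure; rewrite ?inE //; exact: measurableI.
have PAE : fine (P A) = fine (P (A `\` cls_event x (s + N))) + fine (P (A `&` cls_event x (s + N))).
  by rewrite -fineD ?fin_num_measure //; congr fine; exact: measureDI.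
have sp := split_le _ _ mAE (mTN N); have sm := split_le _ _ mAD (mTN N).
have /= u1 := h1 N; have /= u2 := h2 N; rewrite -/(r N) in u1 u2.
have PA0 : 0 <= fine (P A) by rewrite fine_ge0.
have PA1 : fine (P A) <= 1 by exact: PA_le1.
have contp : Fp 0 V <= Phi (a / Num.sqrt V) + e.
  by have := hdel _ etad; rewrite ler_norml /Fp /hF /hz /hsd subr0 => /andP[_]; lra.
have contm : Phi (a / Num.sqrt V) - e <= Fm 0 V.
  have := hdel (- eta); rewrite normrN => /(_ etad); rewrite sqrrN mulrN ler_norml => /andP[+ _].
  by rewrite /Fm /hF /hz /hsd subr0; lra.
have k1 : fine (P A) * Fp 0 V <= fine (P A) * Phi (a / Num.sqrt V) + e.
  apply: le_trans (ler_wpM2l PA0 contp) _; rewrite mulrDr lerD2l ler_piMl // ltW //.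
have k2 : fine (P A) * Phi (a / Num.sqrt V) - e <= fine (P A) * Fm 0 V.
  apply: le_trans (ler_wpM2l PA0 contm); rewrite mulrBr lerD2l lerN2 ler_piMl // ltW //.
exact: (sandwich_arith PAE sp sm u1 u2 hC1 hC2 hT k1 k2).
Qed.
End limit.

(** The square of the second moment cancels the denominator of [sigma2_alpha_eps]; taking the root,
    it also cancels the [m2] in the threshold [x * m2]. *)
Lemma pir_qvar c :
  pir (qvar P alpha (eps 1%N) c) = (pir (fun x => x%:R ^+ 2)) ^+ 2 * (c ^+ 2 * sigma2_alpha_eps P alpha eps p).
Proof.
have m20 := m2_gt0.
have /andP[al0 al1] := alpha01.
have c3 := @cubic_exp R 3 isT; have c2 := @cubic_exp R 2 isT.
have q3 (m : nat) : 0 <= m%:R ^+ 3 :> R by exact: exprn_ge0.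
have q2 (m : nat) : 0 <= m%:R ^+ 2 :> R by exact: exprn_ge0.
have k3 : 0 <= c ^+ 2 * (alpha * (1 - alpha)).
  by rewrite mulr_ge0 ?sqr_ge0 // mulr_ge0 ?subr_ge0 ?ltW.
have k2 : 0 <= c ^+ 2 * var_eps P eps.
  by rewrite mulr_ge0 ?sqr_ge0 //; exact: sig2e_ge0.
rewrite /qvar (pirD alpha01 me1 e3 p0 p1 pQ) ?(pirZ alpha01 me1 e3 p0 p1 pQ) //.
- rewrite /sigma2_alpha_eps -[fine (pmf_moment p 3)]/(pir (fun x => x%:R ^+ 3)).
  rewrite -[fine (pmf_moment p 2)]/(pir (fun x => x%:R ^+ 2)) -[Ee _ _ _]/(var_eps P eps).
  by field; rewrite gt_eqF.
- exact: cubicZ.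
- exact: cubicZ.
- by move=> m; rewrite mulr_ge0.
- by move=> m; rewrite mulr_ge0.
Qed.

Lemma cls_cvg_dist (c : R) (A : set T) : c != 0 -> hist_det Y0 eps xi s theta s A -> (0 < P A)%E ->
  cvg_dist_cond P (fun n w => c * (Num.sqrt n%:R * (alpha_tilde Y mu s n w - alpha))) A
    (normal_cdf (c ^+ 2 * sigma2_alpha_eps P alpha eps p)).
Proof.
move=> c0 hA PA x _.
have m20 := m2_gt0.
have V0 := V_gt0 c0.
have VE := pir_qvar c.
set m2 := pir (fun x => x%:R ^+ 2) in m20 VE *.
set v := c ^+ 2 * _ in VE *.
have v0 : 0 < v by move: V0; rewrite VE pmulr_rgt0 // exprn_gt0.
have PhiE : Phi (x * m2 / Num.sqrt (pir (qvar P alpha (eps 1%N) c))) = normal_cdf v x.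
  rewrite normal_cdfE // VE sqrtrM ?sqr_ge0 // sqrtr_sqr gtr0_norm //.
  by congr Phi; field; rewrite !gt_eqF // sqrtr_gt0.
have mA : measurable A by exact: hist_det_measurable hA.
have PA0 : 0 < fine (P A) by rewrite fine_gt0 // PA /= ltey_eq fin_num_measure.
apply/cvgrPdist_le => e e0.
have e'0 : 0 < e * fine (P A) / 5 by rewrite divr_gt0 // mulr_gt0.
have [N0 hN0] := cls_event_limit c0 hA x e'0.
exists (s + N0)%N => // n /= hn.
have sn : (s <= n)%N by apply: leq_trans hn; exact: leq_addr.
have := hN0 (n - s)%N; rewrite leq_subRL // subnKC // => /(_ hn).
rewrite PhiE setIC /cls_event => h.
rewrite distrC -[X in `|_ - X|](mulfK (lt0r_neq0 PA0)) -mulrBl normrM normfV (gtr0_norm PA0).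
rewrite ler_pdivrMr // [normal_cdf _ _ * _]mulrC; apply: le_trans h _; lra.
Qed.
End outlier.

Theorem theorem4p2p2 (d : measure_display) (T : measurableType d) (R : realType)
  (P : probability T R) (alpha : R)
  (Y0 : T -> nat) (eps : nat -> T -> nat) (xi : nat -> nat -> T -> nat)
  (s theta : nat) (pi : nat -> R) :
  0 < alpha < 1 ->
  (* measurability *)
  nat_rv Y0 -> (forall k, nat_rv (eps k)) -> (forall k j, nat_rv (xi k j)) ->
  (* Y_0, (eps_k)_{k>=1}, (xi_{k,j})_{k,j>=1} mutually independent *)
  mutually_independent P (inar_family Y0 eps xi) ->
  (* eps_k identically distributed *)
  (forall k m, (1 <= k)%N -> P [set w | eps k w = m] = P [set w | eps 1%N w = m]) ->
  (* xi_{k,j} Bernoulli(alpha) *)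
  (forall k j, (1 <= k)%N -> (1 <= j)%N ->
     P [set w | xi k j w = 1%N] = alpha%:E /\ P [set w | xi k j w = 0%N] = (1 - alpha)%:E) ->
  (* moment conditions *)
  (\int[P]_w (((eps 1%N w)%:R : R) ^+ 2)%:E < +oo)%E ->
  (0 < P [set w | eps 1%N w != 0%N])%E ->
  (\int[P]_w (((Y0 w)%:R : R) ^+ 3)%:E < +oo)%E ->
  (\int[P]_w (((eps 1%N w)%:R : R) ^+ 3)%:E < +oo)%E ->
  (* outlier time s in N, size theta in N *)
  (1 <= s)%N -> (1 <= theta)%N ->
  (* pi is the stationary distribution of the INAR(1) chain *)
  is_stationary P eps xi pi ->
  let mu := mean_eps P eps in
  let Y := Yproc Y0 eps xi s theta in
  let sig2 := sigma2_alpha_eps P alpha eps pi in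
  cvg_dist_cond P
    (fun n w => Num.sqrt (n%:R) * (alpha_tilde Y mu s n w - alpha))
    setT (normal_cdf sig2)
  /\
  (forall m : nat, (0 < P [set w | Y s.-1 w = m])%E ->
    cvg_dist_cond P
      (fun n w => Num.sqrt (n%:R) *
         (theta_tilde Y mu s n w - ((Y s w)%:R - alpha * (Y s.-1 w)%:R - mu)))
      [set w | Y s.-1 w = m] (normal_cdf ((m%:R) ^+ 2 * sig2))).
Proof.
move=> alpha01 mY0 meps mxi indep eps_id xi_bern _ eps_ne0 Y03 e3 s1 _ stat mu Y sig2.
have main := cls_cvg_dist alpha01 mY0 meps mxi indep eps_id xi_bern eps_ne0 Y03 e3 s1 stat (theta := theta).
split.
  have := main 1 setT (oner_neq0 R) (@hist_det_setT _ T Y0 eps xi s theta s).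
  rewrite (_ : P setT = 1%E); last exact: probability_setT.
  rewrite expr1n mul1r => /(_ lte01); congr (cvg_dist_cond _ _ _ _).
  by apply/funext => n; apply/funext => w; rewrite mul1r.
move=> m Pm x xc.
have setE n : [set w | Num.sqrt n%:R * (theta_tilde Y mu s n w - ((Y s w)%:R - alpha * (Y s.-1 w)%:R - mu)) <= x]
     `&` [set w | Y s.-1 w = m] =
   [set w | - m%:R * (Num.sqrt n%:R * (alpha_tilde Y mu s n w - alpha)) <= x] `&` [set w | Y s.-1 w = m].
  (* On the conditioning event [Y_s] and [mu] drop out, and the error is a deterministic multiple of
     that of [alpha_tilde]. *)
  have E w : Y s.-1 w = m -> Num.sqrt n%:R * (theta_tilde Y mu s n w - ((Y s w)%:R - alpha * (Y s.-1 w)%:R - mu)) =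
      - m%:R * (Num.sqrt n%:R * (alpha_tilde Y mu s n w - alpha)).
    by rewrite /theta_tilde => ->; ring.
  by apply/seteqP; split => w /= [+ Ym]; rewrite (E _ Ym).
rewrite -[X in X @ _](_ : (fun n => fine (P ([set w | - m%:R * (Num.sqrt n%:R * (alpha_tilde Y mu s n w - alpha)) <= x]
     `&` [set w | Y s.-1 w = m])) / fine (P [set w | Y s.-1 w = m])) = _); last first.
  by apply/funext => n; rewrite setE.
have hdet := @hist_det_Y _ T Y0 eps xi s theta s s.-1 m (leq_pred s).
(* For [m = 0] the error vanishes identically on the event, and both sides are the distribution
   function of the point mass at 0. *)
have [m0|m0] := eqVneq m 0%N; last first.
  have c0 : - m%:R != 0 :> R by rewrite oppr_eq0 pnatr_eq0.
  have := main (- m%:R) _ c0 hdet Pm x; rewrite sqrrN => /(_ xc).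
  by [].
rewrite /normal_cdf m0 expr0n /= mul0r ltxx.
have mA : measurable [set w | Y s.-1 w = 0%N].
  by rewrite -m0; exact: (hist_det_measurable mY0 meps mxi indep eps_id xi_bern e3 hdet).
rewrite m0 in Pm.
have PA0 : 0 < fine (P [set w | Y s.-1 w = 0%N]) by rewrite fine_gt0 // Pm /= ltey_eq fin_num_measure.
rewrite (_ : (fun n => _) = fun=> if 0 <= x then 1 else 0); first exact: cvg_cst.
apply/funext => n; have [x0|x0] := leP 0 x.
  rewrite (_ : [set w | _] = setT) ?setTI ?divff ?gt_eqF //.
  by apply/seteqP; split => w //= _; rewrite oppr0 mul0r.
rewrite (_ : [set w | _] = set0) ?set0I ?measure0 ?mul0r //.
by apply/seteqP; split => w //=; rewrite oppr0 mul0r leNgt x0.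
Qed.
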